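(* Let $d\ge1$ and let $h$ be a Gaussian field in $\mathbb{R}^d$ with $\star$-scale invariant kernel $K(x,y)=\int_1^\infty\frac{k(u|x-y|)}{u}\,du$. Let $\theta$ be a positive measure on $\mathbb{R}^d$ with H\''older continuous density and with $$\iint \big|\log|u-v|\big|\,\theta(du)\theta(dv)<\infty,\quad \operatorname{supp}(\theta)\subseteq\overline{B(0,1)},\quad \int_{\overline{B(0,1)}}\theta(dx)=1,\quad \sup_{v\in B(0,5)}\int\frac{1}{|u-v|}\,\theta(du)<\infty .$$ Let $h_\varepsilon=h\star\theta_\varepsilon$ and $$D_\varepsilon(dx)=\big(-h_\varepsilon(x)+\sqrt{2d}\operatorname{var}(h_\varepsilon(x))\big)\,e^{\sqrt{2d}\,h_\varepsilon(x)-d\operatorname{var}(h_\varepsilon(x))}\,dx .$$ Then $D_\varepsilon$ converges weakly in probability as $\varepsilon\to0$ to a limiting measure. This measure is independent of the choice of approximation (i.e. of $\theta$), and agrees with the critical measure $\mu'$ of $h$.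
   Context: $\star$-scale invariant kernel: $k:[0,\infty)\to\mathbb{R}$ is a compactly supported $C^1$ function with $k(0)=1$ which is positive-definite (i.e. $(x,y)\mapsto k(|x-y|)$ is a positive-definite kernel on $\mathbb{R}^d$). The field $h$ is the centred Gaussian process $(h,\rho)_{\rho\in\mathcal{M}}$ with $\operatorname{cov}((h,\rho),(h,\rho'))=\iint K(x,y)\rho(dx)\rho'(dy)$, where $\mathcal{M}$ is the set of (compactly supported) signed measures $\rho=\rho^+-\rho^-$ with $\iint|K(x,y)|\rho^\pm(dx)\rho^\pm(dy)<\infty$. Mollification: $\theta_\varepsilon$ is the image of $\theta$ under $y\mapsto\varepsilon y$, $\theta_{\varepsilon,x}$ is the image of $\theta_\varepsilon$ under $y\mapsto y+x$, and $h_\varepsilon(x):=(h,\theta_{\varepsilon,x})$. Weak convergence in probability of $D_\varepsilon$ to $\mu'$: for every continuous compactly supported $f:\mathbb{R}^d\to\mathbb{R}$, $\int f\,dD_\varepsilon\to\int f\,d\mu'$ in probability. Critical measure $\mu'$ (Duplantier, Rhodes, Sheffield and Vargas): for $\varepsilon\in(0,1]$ put $K_\varepsilon(x,y)=\int_1^{1/\varepsilon}\frac{k(u|x-y|)}{u}\,du$, and let $(\tilde h_\varepsilon(x))_{\varepsilon\in(0,1],x\in\mathbb{R}^d}$ be the cut-off approximations to $h$, i.e. the centred Gaussian family, jointly Gaussian with $h$, with $\operatorname{cov}(\tilde h_\varepsilon(x),\tilde h_\delta(y))=K_{\varepsilon\vee\delta}(x,y)$ and $\operatorname{cov}(\tilde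 h_\varepsilon(x),(h,\rho))=\int K_\varepsilon(x,y)\rho(dy)$. Then $\mu'$ is the (nontrivial, nonnegative) limit, weakly in probability as $\varepsilon\to0$, of $(-\tilde h_\varepsilon(x)+\sqrt{2d}\log(1/\varepsilon))e^{\sqrt{2d}\,\tilde h_\varepsilon(x)}\varepsilon^{d}\,dx$. It is a known result (Junnila and Saksman) that, for every $\theta$ as in the claim, $\sqrt{\log(1/\varepsilon)}\,e^{\sqrt{2d}h_\varepsilon(x)-d\operatorname{var}(h_\varepsilon(x))}dx$ converges weakly in probability to $\sqrt{2/\pi}\,\mu'$. *)

(* Defs.v *)
From HB Require Import structures.
From mathcomp Require Import all_boot all_order all_algebra.
From mathcomp Require Import all_classical all_reals all_analysis.
From mathcomp Require Import measurable_realfun.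

Set Implicit Arguments.
Unset Strict Implicit.
Unset Printing Implicit Defensive.

Import Order.TTheory GRing.Theory Num.Theory.
Import numFieldNormedType.Exports.
Import numFieldTopology.Exports.

Local Open Scope classical_set_scope.
Local Open Scope ring_scope.

(* The Borel sigma-algebra on matrices, in particular on R^d = 'rV[R]_d. *)
Section borel_matrix.
Context {R : realType} (m n : nat).
Let B : set (set 'M[R]_(m, n)) := <<s open >>.

Let B0 : B set0. Proof. exact: sigma_algebra0. Qed.
Let BC A : B A -> B (~` A). Proof. exact: sigma_algebraC. Qed.
Let BU (F : (set 'M[R]_(m, n))^nat) : (forall i, B (F i)) -> B (\bigcup_i (F i)).
Proof. exact: sigma_algebra_bigcup. Qed.

HB.instance Definition _ := @isMeasurable.Build (sigma_display (@open 'M[R]_(m, n)))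
  'M[R]_(m, n) B B0 BC BU.
End borel_matrix.

Section borel_matrix_lemmas.
Context {R : realType}.

Lemma open_measurable_mx m n (U : set 'M[R]_(m, n)) : open U -> measurable U.
Proof. exact: sub_sigma_algebra. Qed.

Lemma continuous_measurable_mx m n p q (f : 'M[R]_(m, n) -> 'M[R]_(p, q)) :
  continuous f -> measurable_fun setT f.
Proof.
move=> /continuousP cf; apply: (measurability (@open 'M[R]_(p, q))) => //.
by move=> _ [U oU <-]; rewrite setTI; apply: open_measurable_mx; exact: cf.
Qed.

Lemma measurable_coord m n (i : 'I_m) (j : 'I_n) :
  measurable_fun setT (fun A : 'M[R]_(m, n) => A i j).
Proof.
have /continuousP cf : continuous (fun A : 'M[R]_(m, n) => A i j).
  exact: coord_continuous.
apply: (measurability _ (RGenOpens.measurableE R)) => _ [_ [a [b ->]] <-].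
by rewrite setTI; apply: open_measurable_mx; apply: cf; exact: interval_open.
Qed.

(* Every open set of R^n is a countable union of rational cubes, so the Borel
   sigma-algebra of R^n is generated by the coordinates. *)
Definition rat_cube n (p : 'rV[rat]_n * rat) : set 'rV[R]_n :=
  [set y | forall i, `|ratr (p.1 ord0 i) - y ord0 i| < ratr p.2].

Lemma open_bigcup_rat_cube n (U : set 'rV[R]_n) : open U ->
  U = \bigcup_(p in [set p | rat_cube p `<=` U]) rat_cube p.
Proof.
move=> oU; apply/seteqP; split => [x Ux|x [p pU] /pU //].
have /nbhs_ballP[e /= e0 eU] : nbhs x U by exact: open_nbhs_nbhs.
have e20 : 0 < e / 2 by rewrite divr_gt0.
have [r /[!in_itv]/= /andP[r0 re]] := rat_in_itvoo e20.
have qP i : exists q : rat, `|ratr q - x ord0 i| < ratr r.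
  have [|q] := @rat_in_itvoo R (x ord0 i - ratr r) (x ord0 i + ratr r).
    by rewrite ltrBlDr -addrA ltrDl addr_gt0.
  by rewrite in_itv/= -ltr_distl => xq; exists q.
pose q := \row_i xchoose (qP i).
exists (q, r) => /=; last by move=> i /=; rewrite mxE; exact: (xchooseP (qP i)).
move=> y yq; apply: eU; split => // i j.
rewrite ord1 /ball/= (le_lt_trans (ler_distD (ratr (q ord0 j)) _ _))//.
rewrite (splitr e) ltrD//; last by rewrite (lt_trans (yq j)).
by rewrite distrC /q mxE (lt_trans (xchooseP (qP j))).
Qed.

Lemma measurable_fun_rV d (T : measurableType d) n (f : T -> 'rV[R]_n) :
  (forall i, measurable_fun setT (fun t => f t ord0 i)) -> measurable_fun setT f.
Proof.
move=> mf; apply: (measurability (@open 'rV[R]_n)) => // _ [U oU <-].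
rewrite setTI (open_bigcup_rat_cube oU) preimage_bigcup bigcup_mkcond.
apply: countable_bigcupT_measurable; first exact: countableP.
move=> p; case: ifPn => // _.
rewrite (_ : _ @^-1` _ = \bigcap_(i in [set: 'I_n])
    (fun t => f t ord0 i) @^-1` (ball (ratr (p.1 ord0 i) : R) (ratr p.2))).
  apply: fin_bigcap_measurable; first exact: finite_finset.
  move=> i _; rewrite -[X in measurable X]setTI; apply: mf => //.
  exact: measurable_ball.
by apply/seteqP; split => t /= tp i; [move=> _|]; exact: tp.
Qed.
End borel_matrix_lemmas.

(* Lebesgue measure on R^n, as the n-fold product of lebesgue_measure. *)
Section lebesgue_rV.
Context {R : realType}.
Local Open Scope ereal_scope.

Definition rV_cons n (p : measurableTypeR R * 'rV[R]_n) : 'rV[R]_n.+1 :=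
  row_mx (const_mx p.1 : 'rV[R]_1) p.2.

Definition rV_uncons n (x : 'rV[R]_n.+1) : measurableTypeR R * 'rV[R]_n :=
  (x ord0 ord0, @rsubmx R 1%N 1%N n x).

Lemma rV_consK n : cancel (@rV_cons n) (@rV_uncons n).
Proof.
move=> [t x]; rewrite /rV_uncons /rV_cons /= row_mxKr; congr pair.
by rewrite mxE; case: splitP => // j _; rewrite mxE.
Qed.

Lemma measurable_rV_cons n : measurable_fun setT (@rV_cons n).
Proof.
apply: measurable_fun_rV => i; rewrite /rV_cons.
under eq_fun do rewrite mxE; case: (@fintype.split 1%N n i) => j.
  by under eq_fun do rewrite mxE; exact: measurable_fst.
exact: (measurableT_comp (measurable_coord ord0 j) measurable_snd).
Qed.

Lemma measurable_rV_uncons n : measurable_fun setT (@rV_uncons n).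
Proof.
apply/measurable_fun_pairP; split; first exact: measurable_coord.
apply: measurable_fun_rV => i /=.
by under eq_fun do rewrite mxE; exact: measurable_coord.
Qed.

Section step.
Variables (n : nat) (mu : {sigma_finite_measure set 'rV[R]_n -> \bar R}).

Definition lebesgue_rV_step : set 'rV[R]_n.+1 -> \bar R :=
  pushforward (@lebesgue_measure R \x mu) (@rV_cons n).

Let step0 : lebesgue_rV_step set0 = 0.
Proof. by rewrite /lebesgue_rV_step /pushforward preimage_set0 measure0. Qed.

Let step_ge0 A : 0 <= lebesgue_rV_step A.
Proof. by rewrite /lebesgue_rV_step /pushforward measure_ge0. Qed.

Let step_sigma_additive : semi_sigma_additive lebesgue_rV_step.
Proof.
have mpre A : measurable A -> measurable (@rV_cons n @^-1` A).
  by move=> mA; rewrite -[X in measurable X]setTI; exact: measurable_rV_cons.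
move=> F mF tF mUF; rewrite /lebesgue_rV_step /pushforward preimage_bigcup.
apply: measure_semi_sigma_additive.
- by move=> k; exact: mpre.
- apply/trivIsetP => /= i j _ _ ij; rewrite -preimage_setI.
  by move/trivIsetP : tF => /(_ _ _ _ _ ij) ->//; rewrite preimage_set0.
- by rewrite -preimage_bigcup; exact: mpre.
Qed.

HB.instance Definition _ := isMeasure.Build _ _ _ lebesgue_rV_step
  step0 step_ge0 step_sigma_additive.

Let step_sigma_finite : sigma_finite setT lebesgue_rV_step.
Proof.
have /sigma_finiteP[F [FT ndF Foo]] := sigma_finiteT (@lebesgue_measure R).
have /sigma_finiteP[G [GT ndG Goo]] := sigma_finiteT mu.
exists (fun k => @rV_uncons n @^-1` (F k `*` G k)).
  apply/esym; rewrite -subTset => x _.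
  have [k _ Fk] : (\bigcup_k F k) (rV_uncons x).1 by rewrite -FT.
  have [l _ Gl] : (\bigcup_k G k) (rV_uncons x).2 by rewrite -GT.
  exists (maxn k l) => //; split.
    by move: Fk; exact/subsetPset/ndF/leq_maxl.
  by move: Gl; exact/subsetPset/ndG/leq_maxr.
move=> k; have [mF Fk] := Foo k; have [mG Gk] := Goo k; split.
  rewrite -[X in measurable X]setTI; apply: measurable_rV_uncons => //.
  exact: measurableX.
rewrite /lebesgue_rV_step /pushforward -comp_preimage.
rewrite (_ : _ \o _ = id); last by apply/funext => p; exact: rV_consK.
by rewrite preimage_id product_measure1E// lte_mul_pinfty// ge0_fin_numE.
Qed.

HB.instance Definition _ := Measure_isSigmaFinite.Build _ _ _ lebesgue_rV_step
  step_sigma_finite.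

End step.

Fixpoint lebesgue_rV n : {sigma_finite_measure set 'rV[R]_n -> \bar R} :=
  match n with
  | 0 => \d_(0%R : 'rV[R]_0)
  | n'.+1 => lebesgue_rV_step (lebesgue_rV n')
  end.

Lemma measurable_box n (a b : 'I_n -> R) :
  measurable [set x : 'rV[R]_n | forall i, (a i <= x ord0 i <= b i)%R].
Proof.
rewrite (_ : mkset _ = \bigcap_(i in [set: 'I_n])
    (fun x : 'rV[R]_n => x ord0 i) @^-1` `[a i, b i]).
  apply: fin_bigcap_measurable; first exact: finite_finset.
  move=> i _; rewrite -[X in measurable X]setTI.
  by apply: measurable_coord => //; exact: measurable_itv.
apply/seteqP; split => x /= xab i.
  by move=> _; rewrite ?in_itv/=; exact: xab.
by have := xab i I; rewrite /= ?in_itv.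
Qed.

Lemma lebesgue_rV_box n (a b : 'I_n -> R) : (forall i, a i <= b i)%R ->
  lebesgue_rV n [set x | forall i, (a i <= x ord0 i <= b i)%R] =
  (\prod_(i < n) (b i - a i))%R%:E.
Proof.
elim: n a b => [|n IH] a b ab.
  by rewrite big_ord0 /= diracE mem_set//= => -[].
have cons0 t (x : 'rV[R]_n) : rV_cons (t, x) ord0 ord0 = t.
  by have [] := rV_consK (t, x).
have consS t (x : 'rV[R]_n) i : rV_cons (t, x) ord0 (lift ord0 i) = x ord0 i.
  have [_ /rowP/(_ i)] := rV_consK (t, x); rewrite mxE => <-.
  by congr (_ _ _); exact/val_inj.
pose box := [set x : 'rV[R]_n | forall i : 'I_n,
  (a (lift ord0 i) <= x ord0 i <= b (lift ord0 i))%R].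
transitivity ((@lebesgue_measure R \x lebesgue_rV n)
    ((`[a ord0, b ord0]%classic : set (measurableTypeR R)) `*` box)).
  rewrite /= /lebesgue_rV_step /pushforward; congr (_ _).
  apply/seteqP; split => -[t x] /=.
    move=> xab; split; first by have := xab ord0; rewrite cons0 in_itv.
    by move=> i; have := xab (lift ord0 i); rewrite consS.
  move=> [tab xab] i; case: (unliftP ord0 i) => [j|] ->; first by rewrite consS.
  by rewrite cons0; move: tab; rewrite in_itv.
rewrite product_measure1E//; last exact: measurable_box.
rewrite big_ord_recl /= lebesgue_measure_itv/= lte_fin IH// EFinM.
have := ab ord0; rewrite le_eqVlt => /predU1P[->|->//].
by rewrite ltxx subrr.
Qed.

End lebesgue_rV.

Section image_charge.
Context d1 d2 (T1 : measurableType d1) (T2 : measurableType d2) (R : realType).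
Variables (rho : {charge set T1 -> \bar R}) (f : {mfun T1 >-> T2}).
Local Open Scope ereal_scope.

Definition image_charge : set T2 -> \bar R := pushforward rho f.

Let mpre A : measurable A -> measurable (f @^-1` A).
Proof. by move=> mA; rewrite -[X in measurable X]setTI; exact: measurable_funP. Qed.

Let image_charge0 : image_charge set0 = 0.
Proof. by rewrite /image_charge /pushforward preimage_set0 charge0. Qed.

Let image_charge_finite A : measurable A -> image_charge A \is a fin_num.
Proof.
move=> mA; rewrite /image_charge /pushforward; apply: fin_num_measure.
exact: mpre.
Qed.

Let image_charge_sigma_additive : semi_sigma_additive image_charge.
Proof.
move=> F mF tF mUF; rewrite /image_charge /pushforward preimage_bigcup.
apply: charge_semi_sigma_additive.
- by move=> k; exact: mpre.
- apply/trivIsetP => /= i j _ _ ij; rewrite -preimage_setI.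
  by move/trivIsetP : tF => /(_ _ _ _ _ ij) ->//; rewrite preimage_set0.
- by rewrite -preimage_bigcup; exact: mpre.
Qed.

HB.instance Definition _ := isCharge.Build _ _ _ image_charge
  image_charge0 image_charge_finite image_charge_sigma_additive.
End image_charge.

Section dilation_translation.
Context {R : realType} (d : nat).
Local Notation Rd := 'rV[R]_d.

Definition dilation (eps : R) (y : Rd) : Rd := eps *: y.
Definition translation (x : Rd) (y : Rd) : Rd := y + x.

Let measurable_dilation eps : measurable_fun setT (dilation eps).
Proof. by apply: continuous_measurable_mx; exact: scaler_continuous. Qed.

Let measurable_translation x : measurable_fun setT (translation x).
Proof.
apply: continuous_measurable_mx => y.
exact: (@cvgD R _ _ (nbhs y) _ id (cst x) y x cvg_id (cvg_cst x)).
Qed.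

HB.instance Definition _ eps :=
  isMeasurableFun.Build _ _ Rd Rd (dilation eps) (measurable_dilation eps).
HB.instance Definition _ x :=
  isMeasurableFun.Build _ _ Rd Rd (translation x) (measurable_translation x).

End dilation_translation.

Section euclidean.
Context {R : realType} (d : nat).
Local Notation Rd := 'rV[R]_d.

(* The norm of the library on 'rV[R]_d is the sup norm. *)
Definition enorm (x : Rd) : R := Num.sqrt (\sum_(i < d) x ord0 i ^+ 2).

Definition eball (r : R) : set Rd := [set x | enorm x < r].
Definition ecball (r : R) : set Rd := [set x | enorm x <= r].

Definition msupport (mu : set Rd -> \bar R) : set Rd :=
  [set x | forall U : set Rd, open U -> U x -> (0 < mu U)%E].

End euclidean.

Section signed_measures.
Context {R : realType} (d : nat).
Local Notation Rd := 'rV[R]_d.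
Implicit Types rho : {charge set Rd -> \bar R}.
Local Open Scope ereal_scope.

Definition hahn rho :=
  svalP (cid (svalP (cid (Hahn_decomposition rho)))).
Definition rho_pos rho : {finite_measure set Rd -> \bar R} := jordan_pos (hahn rho).
Definition rho_neg rho : {finite_measure set Rd -> \bar R} := jordan_neg (hahn rho).
Definition rho_var rho : set Rd -> \bar R := charge_variation (hahn rho).

Definition cintegral rho (f : Rd -> \bar R) : \bar R :=
  \int[rho_pos rho]_x f x - \int[rho_neg rho]_x f x.

End signed_measures.

Section star_scale.
Context {R : realType} (d : nat).
Local Notation Rd := 'rV[R]_d.
Variable k : R -> R.

(* [k] is a function on [0, +oo[; its values on the negative half-line are
   irrelevant, and its derivative at 0 is one-sided. *)
Definition C1_nonneg := exists2 k' : R -> R,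
  {within `[0, +oo[, continuous k'} &
  forall x : R, 0 <= x ->
    (fun y : R => (k y - k x) / (y - x)) @ within (fun y : R => 0 <= y) x^' --> k' x.

Definition star_scale_seed :=
  [/\ C1_nonneg,
      exists r, forall u, r < u -> k u = 0,
      k 0 = 1 &
      forall n (x : 'I_n -> Rd) (c : 'I_n -> R),
        0 <= \sum_(i < n) \sum_(j < n) c i * c j * k (enorm (x i - x j))].

(* Equal to +oo on the diagonal. *)
Definition Kstar (x y : Rd) : \bar R :=
  (\int[lebesgue_measure]_(u in `[1%R, +oo[) (k (u * enorm (x - y)) / u)%:E)%E.

Definition Kcut (eps : R) (x y : Rd) : R :=
  \int[lebesgue_measure]_(u in `[1, eps^-1]) (k (u * enorm (x - y)) / u).

Definition field_test (rho : {charge set Rd -> \bar R}) :=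
  [/\ compact (msupport (rho_var rho)),
      (\int[rho_pos rho]_x \int[rho_pos rho]_y `|Kstar x y| < +oo)%E &
      (\int[rho_neg rho]_x \int[rho_neg rho]_y `|Kstar x y| < +oo)%E].

End star_scale.

Section gaussian.
Context {R : realType} {dT : measure_display} {T : measurableType dT}.
Variable P : probability T R.

(* [normal_prob 0 0] is not the point mass at 0 in the library. *)
Definition centred_gaussian (X : T -> R) := exists s : R, forall A : set R,
  measurable A ->
  P (X @^-1` A) = if s == 0 then \d_(0 : R) A else normal_prob 0 s A.

Definition centred_gaussian_process (I : Type) (D : set I)
    (X : I -> {RV P >-> R}) :=
  forall n (i : 'I_n -> I) (c : 'I_n -> R), (forall j, D (i j)) ->
    centred_gaussian (fun w => \sum_(j < n) c j * X (i j) w).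

End gaussian.

Section fields.
Context {R : realType} (d : nat) {dT : measure_display} {T : measurableType dT}.
Variable P : probability T R.
Local Notation Rd := 'rV[R]_d.
Implicit Types (k : R -> R) (h : {charge set Rd -> \bar R} -> {RV P >-> R})
  (ht : R -> Rd -> {RV P >-> R}) (theta : {finite_measure set Rd -> \bar R})
  (f : R -> Rd -> T -> R) (nu : R.-ker T ~> Rd).

(* Only the values of [h] on [field_test k] matter. *)
Definition star_scale_field k h :=
  centred_gaussian_process (field_test k) h /\
  forall rho rho', field_test k rho -> field_test k rho' ->
    covariance P (h rho) (h rho') =
      cintegral rho (fun x => cintegral rho' (fun y => Kstar k x y)).

Definition jointly_measurable (f : Rd -> T -> R) :=
  measurable_fun setT (fun p : T * Rd => f p.2 p.1).

(* Joint measurability in (omega, x) is what gives a meaning to the integrals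
   over x of functions of the field. *)
Definition cutoff_field k h ht :=
  [/\ centred_gaussian_process
        [set i | match i with
                 | inl rho => field_test k rho
                 | inr p => 0 < p.1 <= 1
                 end]
        (fun i : {charge set Rd -> \bar R} + R * Rd =>
           match i with inl rho => h rho | inr p => ht p.1 p.2 end),
      forall (eps delta : R) x y, 0 < eps <= 1 -> 0 < delta <= 1 ->
        covariance P (ht eps x) (ht delta y) =
          (Kcut k (Num.max eps delta) x y)%:E,
      forall (eps : R) x rho, 0 < eps <= 1 -> field_test k rho ->
        covariance P (ht eps x) (h rho) =
          cintegral rho (fun y => (Kcut k eps x y)%:E) &
      forall eps : R, 0 < eps <= 1 -> jointly_measurable (fun x => ht eps x)].

Definition mollifier_at theta (eps : R) (x : Rd) : {charge set Rd -> \bar R} :=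
  image_charge (image_charge (charge_of_finite_measure theta) (dilation eps))
    (translation x).

(* [f eps x] is a version of (h, theta_{eps,x}), measurable in (omega, x). *)
Definition mollification h theta f := forall eps : R, 0 < eps ->
  jointly_measurable (f eps) /\
  forall x, {ae P, forall w, f eps x w = h (mollifier_at theta eps x) w}.

Definition holder_density theta := exists g : Rd -> R,
  [/\ forall x, 0 <= g x,
      exists alpha C : R, 0 < alpha /\
        forall x y, `|g x - g y| <= C * enorm (x - y) `^ alpha &
      forall A, measurable A ->
        theta A = (\int[lebesgue_rV d]_(x in A) (g x)%:E)%E].

(* [lne 0 = -oo] and [0^-1 = +oo] in [\bar R], so both integrands are +oo on
   the diagonal. *)
Definition admissible_mollifier theta :=
  [/\ holder_density theta,
      (\int[theta]_u \int[theta]_v `|lne (enorm (u - v))%:E| < +oo)%E,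
      msupport theta `<=` ecball 1,
      theta (ecball 1) = 1%E &
      (ereal_sup [set \int[theta]_u ((enorm (u - v))%:E)^-1 | v in eball 5]
         < +oo)%E].

(* [D eps x w] is the density at [x] of a random signed measure. *)
Definition weak_cvg_in_probability (D : R -> Rd -> T -> R) nu :=
  forall g : Rd -> R, continuous g -> compact (closure [set x | g x != 0]) ->
  forall eta : R, 0 < eta ->
    P [set w | eta < `|\int[lebesgue_rV d]_x (g x * D eps x w)
                       - \int[nu w]_x g x| ] @[eps --> 0^'+] --> 0%E.

Definition locally_finite nu :=
  {ae P, forall w, forall A : set Rd, compact A -> (nu w A < +oo)%E}.

Definition sqrt2d : R := Num.sqrt (2 * d%:R).

Definition critical_measure ht nu := locally_finite nu /\
  weak_cvg_in_probability
    (fun eps x w => (- ht eps x w + sqrt2d * ln (eps^-1))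
                    * expR (sqrt2d * ht eps x w) * eps ^+ d) nu.

Definition derivative_density f (eps : R) (x : Rd) (w : T) : R :=
  let v := fine 'V_P[f eps x] in
  (- f eps x w + sqrt2d * v) * expR (sqrt2d * f eps x w - d%:R * v).

End fields.

(* Main.v *)
(** Write gamma = sqrt(2d), t = log(1/eps), l = log t, and, for a centred
    Gaussian Y of variance v, D(Y) = (-Y + gamma v) exp(gamma Y - d v).  Let
    Z_u be the cut-off field at scale exp(-u), averaged against a discrete
    version of theta_eps.  Four comparisons of integrals against a fixed test
    function, each valid with probability close to one, link D(h_eps) to the
    approximations that define mu':
    - D(h_eps) is close in L^1 to D(Z_(t+6l)): the variance of
      h_eps - Z_(t+6l) is of order t^-6, which beats the polynomial factors in
      the L^1 modulus of continuity of Y |-> D(Y);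
    - D(Z_(u+al)) is close to D(Z_u) for u between t-6l and t and a = 1/(64d).
      Outside an event of probability O(t^-1/4) the cut-off field at scale
      exp(-u) stays below gamma u - l/(4 gamma) on a grid of mesh exp(-u).
      On the good event the difference of the two integrals has small second
      moment: pairs of points at distance of order at least exp(-u) contribute
      exactly zero, because Z_(u+al) - Z_u is centred at one point given
      everything at scale exp(-u) and Z_(u+al) at the other, and near pairs are
      controlled by a Chernoff bound under the barrier.  A bounded number 384 d
      of such steps leads from t+6l to t-6l;
    - at scale t-6l the mollifier is invisible: Z_(t-6l) differs from the
      cut-off field by a Gaussian of variance O(t^-6), and D is again continuous
      in L^1;
    - D of the cut-off field at scale exp(-(t-6l)) converges to mu' by
      hypothesis. *)

Require Import Defs.
From mathcomp Require Import all_boot all_order all_algebra.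
From mathcomp Require Import all_classical all_reals all_analysis.
From mathcomp Require Import measurable_realfun.
From mathcomp Require Import ring lra.

Set Implicit Arguments.
Unset Strict Implicit.
Unset Printing Implicit Defensive.

Import Order.TTheory GRing.Theory Num.Theory.
Import numFieldNormedType.Exports.

Local Open Scope classical_set_scope.
Local Open Scope ring_scope.

Lemma measurable_fun_EFin d (T : measurableType d) (R : realType) (D : set T) (f : T -> R) :
  measurable_fun D f -> measurable_fun D (fun x => (f x)%:E).
Proof. by move=> mf; apply/measurable_EFinP. Qed.

Local Notation mu := lebesgue_measure.

(** * Gaussian integrals *)

Lemma ge0_integral_normal_prob (R : realType) (m s : R) (f : R -> \bar R) :
  measurable_fun setT f -> (forall x, 0 <= f x)%E ->
  (\int[normal_prob m s]_x f x = \int[mu]_x (f x * (normal_pdf m s x)%:E))%E.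
Proof.
move=> mf f0.
have dom := normal_prob_dominates m s.
rewrite -(Radon_Nikodym_SigmaFinite.change_of_variables dom)//.
apply: ae_eq_integral => //.
- apply: emeasurable_funM => //; apply: (measurable_int mu).
  exact: Radon_Nikodym_SigmaFinite.f_integrable.
- apply: emeasurable_funM => //=; apply/measurableT_comp => //=.
  exact: measurable_normal_pdf.
- apply: ae_eqe_mul2l => /=.
  apply: integral_ae_eq => //=.
  + exact: Radon_Nikodym_SigmaFinite.f_integrable.
  + by apply/measurableT_comp => //; exact: measurable_normal_pdf.
  + by move=> E E01 mE; rewrite -Radon_Nikodym_SigmaFinite.f_integral.
Qed.

Lemma normal_pdf_exp (R : realType) (s x : R) : s != 0 ->
  expR x * normal_pdf 0 s x = expR (s ^+ 2 / 2) * normal_pdf (s ^+ 2) s x.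
Proof.
move=> s0; rewrite !normal_pdfE// /normal_fun mulrCA [RHS]mulrCA; congr (_ * _).
rewrite -!expRD; congr expR; field; exact: s0.
Qed.

Lemma integral_expR_normal (R : realType) (s : R) : s != 0 ->
  (\int[normal_prob 0 s]_x (expR x)%:E = (expR (s ^+ 2 / 2))%:E)%E.
Proof.
move=> s0; rewrite ge0_integral_normal_prob; last 2 first.
- by apply: measurable_fun_EFin; exact: measurable_expR.
- by move=> x; rewrite lee_fin expR_ge0.
under eq_integral do rewrite -EFinM normal_pdf_exp// EFinM.
rewrite ge0_integralZl//=; last 2 first.
- by apply: measurable_fun_EFin; exact: measurable_normal_pdf.
- by move=> x _; rewrite lee_fin normal_pdf_ge0.
by rewrite integral_normal_pdf mule1.
Qed.

Lemma cvg_normal_fun (R : realType) (s : R) : s != 0 ->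
  normal_fun 0 s x @[x --> +oo%R] --> (0 : R).
Proof.
move=> s0; have s2 : 0 < s ^+ 2 *+ 2 by rewrite pmulrn_rgt0// exprn_even_gt0.
apply: (squeeze_cvgr (f := cst 0) (h := fun x => expR (- (x / (s ^+ 2 *+ 2))))).
- near=> x.
  have x1 : 1 <= x by near: x; exact: nbhs_pinfty_ge.
  rewrite expR_ge0/= /normal_fun subr0 ler_expR mulNr lerN2.
  by rewrite ler_pM2r ?invr_gt0// expr2 ler_peMl// (le_trans _ x1).
- exact: cvg_cst.
- apply: (cvg_comp (fun x => x / (s ^+ 2 *+ 2)) (fun x => expR (- x)) _ (@cvgr_expR R)).
  by apply: gt0_cvgMly; [rewrite invr_gt0|exact: cvg_id].
Unshelve. all: by end_near. Qed.

Lemma normal_prob_tail (R : realType) (s a : R) : s != 0 -> 0 < a ->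
  (normal_prob 0 s `]a, +oo[ <= (`|s| / a * expR (- (a ^+ 2 / (2 * s ^+ 2))))%:E)%E.
Proof.
move=> s0 a0; have s20 : 0 < s ^+ 2 by rewrite exprn_even_gt0.
set e := expR _.
pose F (x : R) := - s ^+ 2 * normal_fun 0 s x.
have dF (x : R) : is_derive x (1 : R) F (x * normal_fun 0 s x).
  rewrite /F /normal_fun; apply: trigger_derive.
  by rewrite /GRing.scale/=; field.
have cxn : continuous (fun x : R => x * normal_fun 0 s x).
  move=> x; apply: cvgM; first exact: cvg_id.
  apply: (cvg_comp _ expR); last exact: continuous_expR.
  apply: cvgM; last exact: cvg_cst.
  apply: (@cvgN _ R^o).
  apply: (cvg_comp (fun x => x - 0) (fun x => x ^+ 2)).
    by apply: (@cvgB _ R^o) => //; [exact: cvg_id|exact: cvg_cst].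
  exact: sqr_continuous.
have key : (\int[mu]_(x in `[a, +oo[) (x * normal_fun 0 s x)%:E =
    (s ^+ 2 * normal_fun 0 s a)%:E)%E.
  rewrite (@ge0_continuous_FTC2y _ _ F a 0).
  - by rewrite -EFinB /F sub0r mulNr opprK.
  - by move=> x ax; rewrite mulr_ge0 ?normal_fun_ge0// (le_trans _ ax)// ltW.
  - exact: continuous_subspaceT.
  - rewrite -[X in _ --> X](mulr0 (- s ^+ 2)); apply: cvgM; first exact: cvg_cst.
    exact: cvg_normal_fun.
  - by move=> x _.
  - apply: cvg_at_right_filter.
    apply: differentiable_continuous; apply/derivable1_diffP.
    by have := dF a.
  - by move=> x _; rewrite derive1E derive_val.
apply: (@le_trans _ _ (\int[mu]_(x in `[a, +oo[)
    ((normal_peak s / a)%:E * (x * normal_fun 0 s x)%:E))%E).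
  apply: (@le_trans _ _ (\int[mu]_(x in `[a, +oo[) (normal_pdf 0 s x)%:E)%E).
    apply: ge0_subset_integral => //=.
    - by apply/measurable_funTS; apply: measurable_fun_EFin; exact: measurable_normal_pdf.
    - by move=> x _; rewrite lee_fin normal_pdf_ge0.
    - by move=> x /=; rewrite !in_itv/= !andbT => /ltW.
  apply: ge0_le_integral => //=.
  - by move=> x _; rewrite lee_fin normal_pdf_ge0.
  - by apply/measurable_funTS; apply: measurable_fun_EFin; exact: measurable_normal_pdf.
  - apply/measurable_funTS; apply: measurable_fun_EFin; apply/measurable_funM => //.
    by apply: measurable_funM => //; exact: measurable_normal_fun.
  - move=> x; rewrite in_itv/= andbT => ax; rewrite -EFinM lee_fin normal_pdfE//.
    rewrite -mulrA ler_wpM2l ?normal_peak_ge0// mulrA ler_peMl ?normal_fun_ge0//.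
    by rewrite mulrC ler_pdivlMr// mul1r.
rewrite ge0_integralZl//=; last 3 first.
- apply/measurable_funTS; apply: measurable_fun_EFin; apply/measurable_funM => //.
  exact: measurable_normal_fun.
- move=> x; rewrite /= in_itv/= andbT => ax.
  by rewrite lee_fin mulr_ge0 ?normal_fun_ge0// (le_trans _ ax)// ltW.
- by rewrite lee_fin divr_ge0 ?normal_peak_ge0// ltW.
rewrite key -EFinM lee_fin.
have -> : normal_fun 0 s a = e.
  by rewrite /normal_fun /e; congr expR; rewrite subr0 mulNr mulr_natl.
rewrite mulrA ler_wpM2r ?expR_ge0// mulrAC ler_wpM2r ?invr_ge0 ?(ltW a0)//.
rewrite /normal_peak -mulrnAr sqrtrM ?sqr_ge0// sqrtr_sqr.
rewrite invfM mulrAC -[s ^+ 2]real_normK ?num_real// expr2 mulrA mulVf ?normr_eq0// mul1r.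
have p0 : 0 < @pi R *+ 2 by rewrite pmulrn_lgt0// pi_gt0.
rewrite ler_piMr// invf_le1 ?sqrtr_gt0//.
rewrite -[leLHS]sqrtr1 ler_wsqrtr//.
by rewrite mulr2n; move: (pi_ge2 R); set p : R := pi; lra.
Qed.

Lemma normal_fun_derive (R : realType) (s : R) (p dp : R -> R) (x : R) : s != 0 ->
  is_derive x (1 : R) p (dp x) ->
  is_derive x (1 : R) (fun x => p x * normal_fun 0 s x)
    ((dp x - p x * x / s ^+ 2) * normal_fun 0 s x).
Proof.
move=> s0 dpx.
have dn : is_derive x (1 : R) (normal_fun 0 s) (- x / s ^+ 2 * normal_fun 0 s x).
  rewrite /normal_fun; apply: trigger_derive.
  by rewrite /GRing.scale/=; field.
apply: is_derive_eq; rewrite /GRing.scale/=.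
by field.
Qed.

Lemma continuous_normal_fun (R : realType) (s : R) : s != 0 -> continuous (normal_fun (0 : R) s).
Proof.
move=> s0 x; apply: differentiable_continuous; apply/derivable1_diffP.
have := @normal_fun_derive R s (cst 1) (cst 0) x s0 (is_derive_cst _ _ _).
have -> : (fun x => cst 1 x * normal_fun 0 s x) = normal_fun 0 s.
  by apply/funext => y; rewrite mul1r.
by case.
Qed.

Lemma cvg_mul_normal_fun (R : realType) (s : R) : s != 0 ->
  x * normal_fun 0 s x @[x --> +oo%R] --> (0 : R).
Proof.
move=> s0; have s2 : 0 < s ^+ 2 by rewrite exprn_even_gt0.
have c0 : 4 * s ^+ 2 / x @[x --> +oo%R] --> (0 : R).
  rewrite -[X in _ --> X](mulr0 (4 * s ^+ 2)); apply: cvgMr.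
  by apply/gtr0_cvgV0; [exact: nbhs_pinfty_gt|exact: cvg_id].
apply: (squeeze_cvgr (f := cst 0) (h := fun x => 4 * s ^+ 2 / x)).
- near=> x.
  have x0 : 0 < x by near: x; exact: nbhs_pinfty_gt.
  rewrite mulr_ge0 ?normal_fun_ge0 ?(ltW x0)//=.
  rewrite ler_pdivlMr// mulrAC -expr2 /normal_fun subr0 mulNr expRN.
  rewrite ler_pdivrMr ?expR_gt0//.
  have : x ^+ 2 / (s ^+ 2 *+ 2) <= expR (x ^+ 2 / (s ^+ 2 *+ 2)).
    by apply: le_trans (expR_ge1Dx _); rewrite lerDr.
  rewrite ler_pdivrMr ?pmulrn_lgt0// => /le_trans; apply.
  rewrite mulrC ler_wpM2r ?expR_ge0// -mulr_natl ler_wpM2r ?(ltW s2)//.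
  by rewrite ler_nat.
- exact: cvg_cst.
- exact: c0.
Unshelve. all: by end_near. Qed.

Lemma normal_prob_norm (R : realType) (m s : R) : normal_prob m `|s| = normal_prob m s.
Proof.
suff E : normal_pdf m `|s| = normal_pdf m s by rewrite /normal_prob E.
apply/funext => x; rewrite /normal_pdf normr_eq0 /normal_peak /normal_fun.
by rewrite real_normK ?num_real.
Qed.

Lemma integral_sqr_normal_gt0 (R : realType) (s : R) : 0 < s ->
  (\int[normal_prob 0 s]_x (x ^+ 2)%:E = (s ^+ 2)%:E)%E.
Proof.
move=> sp; have s0 : s != 0 by rewrite gt_eqF.
have mn : measurable_fun setT (normal_fun (0 : R) s) by exact: measurable_normal_fun.
have cn := continuous_normal_fun s0.
pose F (x : R) := s ^+ 2 * x * normal_fun 0 s x.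
have dF (x : R) : is_derive x (1 : R) F ((s ^+ 2 - x ^+ 2) * normal_fun 0 s x).
  have d1 : is_derive x (1 : R) (fun x => s ^+ 2 * x) (s ^+ 2).
    by apply: is_derive_eq; rewrite /GRing.scale/= mulr1.
  have -> : s ^+ 2 - x ^+ 2 = s ^+ 2 - s ^+ 2 * x * x / s ^+ 2 by field.
  exact: (@normal_fun_derive R s (fun x => s ^+ 2 * x) (cst (s ^+ 2)) x s0).
have F0 : F 0 = 0 by rewrite /F mulr0 mul0r.
have cF : continuous F.
  by move=> x; apply: differentiable_continuous; apply/derivable1_diffP; have := dF x.
have cf : continuous (fun x : R => (s ^+ 2 - x ^+ 2) * normal_fun 0 s x).
  move=> x; apply: cvgM; last exact: cn.
  by apply: (@cvgB _ R^o); [exact: cvg_cst|exact: sqr_continuous].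
have cf2 : continuous (fun x : R => (x ^+ 2 - s ^+ 2) * normal_fun 0 s x).
  move=> x; apply: cvgM; last exact: cn.
  by apply: (@cvgB _ R^o); [exact: sqr_continuous|exact: cvg_cst].
have E1 : (\int[mu]_(x in `[0%R, s]) ((s ^+ 2 - x ^+ 2) * normal_fun 0 s x)%:E = (F s)%:E)%E.
  rewrite (@continuous_FTC2 _ _ F) ?F0 ?sube0//.
  - exact: continuous_subspaceT.
  - split=> //.
    + by apply: cvg_at_right_filter; exact: cF.
    + by apply: cvg_at_left_filter; exact: cF.
  - by move=> x _; rewrite derive1E derive_val.
have E2 : (\int[mu]_(x in `[s, +oo[) ((x ^+ 2 - s ^+ 2) * normal_fun 0 s x)%:E = (F s)%:E)%E.
  rewrite (@ge0_continuous_FTC2y _ _ (fun x : R => - F x) s 0).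
  - by rewrite sub0e -EFinN opprK.
  - move=> x sx; rewrite mulr_ge0 ?normal_fun_ge0// subr_ge0.
    by rewrite lerXn2r// nnegrE (le_trans (ltW sp)).
  - exact: continuous_subspaceT.
  - rewrite -oppr0; apply: (@cvgN _ R^o); rewrite -(mulr0 (s ^+ 2)).
    rewrite /F; under eq_fun do rewrite -mulrA.
    by apply: cvgMr; exact: cvg_mul_normal_fun.
  - by move=> x _.
  - by apply: cvg_at_right_filter; apply: (@cvgN _ R^o); exact: cF.
  - move=> x _; rewrite derive1E derive_val -mulNr opprB//.
pose f (x : R) := x ^+ 2 * normal_fun 0 s x.
have f0 x : 0 <= f x by rewrite mulr_ge0 ?sqr_ge0 ?normal_fun_ge0.
have mf : measurable_fun setT f by apply: measurable_funM => //; exact: measurable_funX.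
pose g (x : R) := s ^+ 2 * normal_fun 0 s x.
have g0 x : 0 <= g x by rewrite mulr_ge0 ?sqr_ge0 ?normal_fun_ge0.
have mg : measurable_fun setT g by apply: measurable_funM.
have sumE1 : (\int[mu]_(x in `[0%R, s]) (f x)%:E + (F s)%:E = \int[mu]_(x in `[0%R, s]) (g x)%:E)%E.
  rewrite -E1 -ge0_integralD//=.
  - by apply: eq_integral => x _; rewrite -EFinD /f /g; congr EFin; ring.
  - by move=> x _; rewrite lee_fin.
  - by apply/measurable_funTS; apply: measurable_fun_EFin.
  - move=> x; rewrite in_itv/= => /andP[x0 xs]; rewrite lee_fin mulr_ge0 ?normal_fun_ge0// subr_ge0.
    by rewrite lerXn2r// nnegrE ltW.
  - by apply/measurable_funTS; apply: measurable_fun_EFin; apply: measurable_funM => //; apply: measurable_funB => //; exact: measurable_funX.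
have sumE2 : (\int[mu]_(x in `[s, +oo[) (f x)%:E = \int[mu]_(x in `[s, +oo[) (g x)%:E + (F s)%:E)%E.
  rewrite -E2 -ge0_integralD//=.
  - by apply: eq_integral => x _; rewrite -EFinD /f /g; congr EFin; ring.
  - by move=> x _; rewrite lee_fin.
  - by apply/measurable_funTS; apply: measurable_fun_EFin.
  - move=> x; rewrite in_itv/= andbT => sx; rewrite lee_fin mulr_ge0 ?normal_fun_ge0// subr_ge0.
    by rewrite lerXn2r// nnegrE (le_trans (ltW sp)).
  - by apply/measurable_funTS; apply: measurable_fun_EFin; apply: measurable_funM => //; apply: measurable_funB => //; exact: measurable_funX.
have split (h : R -> R) : measurable_fun setT h -> (forall x, 0 <= h x) ->
  (\int[mu]_(x in [set x | 0%R <= x]%R) (h x)%:E =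
   \int[mu]_(x in `[0%R, s]) (h x)%:E + \int[mu]_(x in `[s, +oo[) (h x)%:E)%E.
  move=> mh h0.
  rewrite -[in RHS](@integral_itv_obnd_cbnd _ s +oo%O); last by apply/measurable_funTS; apply: measurable_fun_EFin.
  rewrite -ge0_integral_setU//=.
  - congr (integral _ _ _); rewrite -itv_bndbnd_setU ?bnd_simp ?(ltW sp)//.
    by apply/seteqP; split => x /=; rewrite in_itv/= andbT.
  - by apply/measurable_funTS; apply: measurable_fun_EFin.
  - by move=> x _; rewrite lee_fin.
  - apply/disj_setPS => x [] /=; rewrite !in_itv/= andbT => /andP[_ xs] sx.
    by move: (le_lt_trans xs sx); rewrite ltxx.
have half : (\int[mu]_(x in [set x | 0%R <= x]%R) (f x)%:E = \int[mu]_(x in [set x | 0%R <= x]%R) (g x)%:E)%E.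
  rewrite (split f)// (split g)// sumE2 -sumE1 -addeA.
  by congr (_ + _)%E; rewrite addeC.
have nE : normal_fun (0 : R) s =1 normal_fun 0 s \o -%R.
  by move=> x; rewrite /normal_fun /= !subr0 sqrrN.
have full : (\int[mu]_x (f x)%:E = \int[mu]_x (g x)%:E)%E.
  rewrite (ge0_symfun_integralT f0) ?(ge0_symfun_integralT g0) ?half//.
  - by move=> x; apply: cvgMr; exact: cn.
  - by move=> x; rewrite /g /= nE.
  - by move=> x; apply: cvgM; [exact: sqr_continuous|exact: cn].
  - by move=> x; rewrite /f /= nE /= sqrrN.
rewrite ge0_integral_normal_prob; last 2 first.
- by apply: measurable_fun_EFin; exact: measurable_funX.
- by move=> x; rewrite lee_fin sqr_ge0.
transitivity (\int[mu]_x ((normal_peak s)%:E * (f x)%:E))%E.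
  by apply: eq_integral => x _; rewrite -!EFinM normal_pdfE// /f; congr EFin; ring.
rewrite ge0_integralZl//=; last 3 first.
- exact: measurable_fun_EFin.
- by move=> x _; rewrite lee_fin.
- by rewrite lee_fin normal_peak_ge0.
rewrite full -ge0_integralZl//=; last 3 first.
- exact: measurable_fun_EFin.
- by move=> x _; rewrite lee_fin.
- by rewrite lee_fin normal_peak_ge0.
transitivity (\int[mu]_x ((s ^+ 2)%:E * (normal_pdf 0 s x)%:E))%E.
  by apply: eq_integral => x _; rewrite -!EFinM normal_pdfE// /g; congr EFin; ring.
rewrite ge0_integralZl//=; last 3 first.
- by apply: measurable_fun_EFin; exact: measurable_normal_pdf.
- by move=> x _; rewrite lee_fin normal_pdf_ge0.
- by rewrite lee_fin sqr_ge0.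
by rewrite integral_normal_pdf mule1.
Qed.

Lemma integral_sqr_normal (R : realType) (s : R) : s != 0 ->
  (\int[normal_prob 0 s]_x (x ^+ 2)%:E = (s ^+ 2)%:E)%E.
Proof.
move=> s0; rewrite -normal_prob_norm -(real_normK (num_real s)).
by apply: integral_sqr_normal_gt0; rewrite normr_gt0.
Qed.

Lemma integral_translation (R : realType) (G : R -> R) (y : R) : continuous G ->
  (forall x, 0 <= G x) ->
  (\int[mu]_x (G (x + y))%:E = \int[mu]_x (G x)%:E)%E.
Proof.
move=> cG G0.
pose F (x : R) := x + y.
have dF (x : R) : is_derive x (1 : R) F 1.
  by rewrite /F; apply: is_derive_eq; rewrite addr0.
have F'E : F^`()%classic = cst 1 by apply/funext => x; rewrite derive1E derive_val.
rewrite (@increasing_ge0_integration_by_substitutionT R F G)//.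
- by apply: eq_integral => x _; rewrite F'E/= mulr1.
- by move=> u v uv; rewrite /F ltrD2r.
- by rewrite F'E => ?; exact: cvg_cst.
- by rewrite F'E; exact: is_cvg_cst.
- by rewrite F'E; exact: is_cvg_cst.
- exact: cvg_addrr_Ny.
- exact: cvg_addrr.
Qed.

Lemma normal_pdf_conv (R : realType) (a b c y z : R) :
  a != 0 -> b != 0 -> c != 0 -> c ^+ 2 = a ^+ 2 + b ^+ 2 ->
  normal_pdf y a z * normal_pdf 0 b y =
  normal_pdf 0 c z * normal_pdf (z * (b ^+ 2 / c ^+ 2)) (a * b / c) y.
Proof.
move=> a0 b0 c0 cE.
have s0 : a * b / c != 0 by rewrite !mulf_neq0// invr_neq0.
rewrite !normal_pdfE// mulrACA [RHS]mulrACA; congr (_ * _).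
  rewrite /normal_peak -!invfM; congr (_^-1).
  change (Num.sqrt (a ^+ 2 * pi *+ 2) * Num.sqrt (b ^+ 2 * pi *+ 2) =
    Num.sqrt (c ^+ 2 * pi *+ 2) * Num.sqrt ((a * b / c) ^+ 2 * pi *+ 2)).
  have h (u : R) : 0 <= u ^+ 2 * pi *+ 2 by rewrite mulrn_wge0// mulr_ge0 ?sqr_ge0 ?pi_ge0.
  rewrite -!sqrtrM ?h//; apply: (f_equal Num.sqrt).
  set p : R := pi; have -> : (a * b / c) ^+ 2 = a ^+ 2 * b ^+ 2 / c ^+ 2.
    by rewrite !exprMn exprVn.
  by field.
rewrite /normal_fun -!expRD; congr expR.
have -> : (a * b / c) ^+ 2 = a ^+ 2 * b ^+ 2 / c ^+ 2 by rewrite !exprMn exprVn.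
have ab0 : a ^+ 2 + b ^+ 2 != 0 by rewrite -cE expf_neq0.
rewrite cE; field.
by rewrite a0 b0 ab0.
Qed.

Lemma integral_normal_conv (R : realType) (f : R -> R) (a b c : R) :
  a != 0 -> b != 0 -> c != 0 -> c ^+ 2 = a ^+ 2 + b ^+ 2 ->
  continuous f -> (forall x, 0 <= f x) ->
  (\int[normal_prob 0 b]_y \int[normal_prob 0 a]_x (f (x + y))%:E =
   \int[normal_prob 0 c]_z (f z)%:E)%E.
Proof.
move=> a0 b0 c0 cE cf f0.
have mf : measurable_fun setT f by exact: continuous_measurable_fun.
have inner y : (\int[normal_prob 0 a]_x (f (x + y))%:E =
    \int[mu]_z (f z * normal_pdf y a z)%:E)%E.
  rewrite ge0_integral_normal_prob; last 2 first.
  - by apply: measurable_fun_EFin; apply: measurableT_comp => //; exact: measurable_funD.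
  - by move=> x; rewrite lee_fin.
  rewrite -(@integral_translation R (fun z => f z * normal_pdf y a z) y).
  - apply: eq_integral => x _; rewrite -EFinM; congr (_ * _)%:E.
    by rewrite !normal_pdfE// /normal_fun addrK subr0.
  - by move=> z; apply: cvgM; [exact: cf|exact: continuous_normal_pdf].
  - by move=> z; rewrite mulr_ge0 ?normal_pdf_ge0.
under eq_integral do rewrite inner.
have mpdf2 : measurable_fun setT (fun p : R * R => normal_pdf p.1 a p.2).
  under eq_fun do rewrite normal_pdfE//.
  apply: measurable_funM => //; rewrite /normal_fun; apply: measurableT_comp => //.
  apply: measurable_funM => //; apply: measurableT_comp => //.
  by apply: measurable_funX; exact: measurable_funB.
have mk : measurable_fun setT (fun p : R * R => (f p.2 * normal_pdf p.1 a p.2)%:E).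
  apply: measurable_fun_EFin; apply: measurable_funM => //.
  by apply: measurableT_comp => //; exact: measurable_snd.
have k0 p : (0 <= (f p.2 * normal_pdf p.1 a p.2)%:E)%E.
  by rewrite lee_fin mulr_ge0 ?normal_pdf_ge0.
rewrite (@ge0_integral_normal_prob _ 0 b); last 2 first.
- exact: (@measurable_fun_fubini_tonelli_F _ _ _ _ _ mu (fun p : R * R => (f p.2 * normal_pdf p.1 a p.2)%:E)).
- by move=> y; apply: integral_ge0 => z _; exact: (k0 (y, z)).
transitivity (\int[mu]_y \int[mu]_z (f z * normal_pdf y a z * normal_pdf 0 b y)%:E)%E.
  apply: eq_integral => y _; rewrite muleC -ge0_integralZl//=.
  - by apply: eq_integral => z _; rewrite -EFinM mulrC.
  - by apply: measurable_fun_EFin; apply: measurable_funM => //; exact: measurable_normal_pdf.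
  - by move=> z _; exact: (k0 (y, z)).
  - by rewrite lee_fin normal_pdf_ge0.
rewrite (@fubini_tonelli _ _ _ _ _ mu mu (fun p : R * R => (f p.2 * normal_pdf p.1 a p.2 * normal_pdf 0 b p.1)%:E)); last 2 first.
- apply: measurable_fun_EFin; apply: measurable_funM; first exact/measurable_EFinP.
  by apply: measurableT_comp; [exact: measurable_normal_pdf|exact: measurable_fst].
- by move=> p; rewrite lee_fin !mulr_ge0 ?normal_pdf_ge0.
rewrite ge0_integral_normal_prob; last 2 first.
- exact: measurable_fun_EFin.
- by move=> x; rewrite lee_fin.
apply: eq_integral => z _ /=.
transitivity (\int[mu]_y ((f z * normal_pdf 0 c z)%:E *
    (normal_pdf (z * (b ^+ 2 / c ^+ 2)) (a * b / c) y)%:E))%E.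
  apply: eq_integral => y _; transitivity ((f z * (normal_pdf y a z * normal_pdf 0 b y))%:E).
    by rewrite mulrA.
  by rewrite (normal_pdf_conv y z a0 b0 c0 cE); exact: (congr1 EFin (mulrA _ _ _)).
rewrite ge0_integralZl//=.
- by rewrite integral_normal_pdf mule1 -EFinM.
- by apply: measurable_fun_EFin; exact: measurable_normal_pdf.
- by move=> y _; rewrite lee_fin normal_pdf_ge0.
- by rewrite lee_fin mulr_ge0 ?normal_pdf_ge0.
Qed.

Lemma bounded_integrable d (T : measurableType d) (R : realType)
    (P : {finite_measure set T -> \bar R}) (f : T -> R) (M : R) :
  measurable_fun setT f -> (forall x, `|f x| <= M) -> P.-integrable setT (EFin \o f).
Proof.
move=> mf fM; apply: measurable_bounded_integrable => //.
  by rewrite -ge0_fin_numE ?fin_num_measure.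
by exists M; split; rewrite ?num_real// => x Mx y _; apply: le_trans (fM y) _; exact: ltW.
Qed.

Lemma measurable_cos (R : realType) : measurable_fun setT (@cos R).
Proof. exact: continuous_measurable_fun (@continuous_cos R). Qed.

Lemma measurable_sin (R : realType) : measurable_fun setT (@sin R).
Proof. exact: continuous_measurable_fun (@continuous_sin R). Qed.

Lemma integrableDR d (T : measurableType d) (R : realType)
    (m : {measure set T -> \bar R}) (f g : T -> R) :
  m.-integrable setT (EFin \o f) -> m.-integrable setT (EFin \o g) ->
  m.-integrable setT (EFin \o (fun x => f x + g x)).
Proof. by move=> i j; apply: eq_integrable (integrableD measurableT i j). Qed.

Lemma integrableBR d (T : measurableType d) (R : realType)
    (m : {measure set T -> \bar R}) (f g : T -> R) :
  m.-integrable setT (EFin \o f) -> m.-integrable setT (EFin \o g) ->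
  m.-integrable setT (EFin \o (fun x => f x - g x)).
Proof. by move=> i j; apply: eq_integrable (integrableB measurableT i j). Qed.

Lemma integrableZlR d (T : measurableType d) (R : realType)
    (m : {measure set T -> \bar R}) (f : T -> R) (c : R) :
  m.-integrable setT (EFin \o f) -> m.-integrable setT (EFin \o (fun x => c * f x)).
Proof. by move=> i; apply: eq_integrable (integrableZl measurableT c i). Qed.

Lemma integrableZrR d (T : measurableType d) (R : realType)
    (m : {measure set T -> \bar R}) (f : T -> R) (c : R) :
  m.-integrable setT (EFin \o f) -> m.-integrable setT (EFin \o (fun x => f x * c)).
Proof. by move=> i; apply: eq_integrable (integrableZr measurableT c i). Qed.

Lemma EFin_Rintegral d (T : measurableType d) (R : realType)
    (m : {measure set T -> \bar R}) (f : T -> R) :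
  m.-integrable setT (EFin \o f) -> (\int[m]_x (f x)%:E = (\int[m]_x f x)%:E)%E.
Proof. by move=> mf; rewrite /Rintegral fineK//; exact: integrable_fin_num. Qed.

Lemma cos_conv d (T : measurableType d) (R : realType) (A B C : probability T R) (X : T -> R) :
  measurable_fun setT X ->
  (\int[B]_y \int[A]_x (1 + cos (X x + X y))%:E = \int[C]_z (1 + cos (X z))%:E)%E ->
  \int[C]_x cos (X x) =
  \int[A]_x cos (X x) * \int[B]_x cos (X x) - \int[A]_x sin (X x) * \int[B]_x sin (X x).
Proof.
move=> mX H.
have ic (m : probability T R) (y : R) : m.-integrable setT (EFin \o (fun x => cos (X x + y))).
  apply: (@bounded_integrable _ _ _ _ _ 1) => [|x].
    apply: (measurableT_comp (f := @cos R)); first exact: measurable_cos.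
    exact: measurable_funD.
  by rewrite ler_norml cos_geN1 cos_le1.
have ic0 (m : probability T R) : m.-integrable setT (EFin \o (fun x => cos (X x))).
  apply: (@bounded_integrable _ _ _ _ _ 1) => [|x].
    by apply: (measurableT_comp (f := @cos R)) => //; exact: measurable_cos.
  by rewrite ler_norml cos_geN1 cos_le1.
have is0 (m : probability T R) : m.-integrable setT (EFin \o (fun x => sin (X x))).
  apply: (@bounded_integrable _ _ _ _ _ 1) => [|x].
    by apply: (measurableT_comp (f := @sin R)) => //; exact: measurable_sin.
  by rewrite ler_norml sin_geN1 sin_le1.
have i1 (m : probability T R) : m.-integrable setT (EFin \o (fun=> 1)).
  by apply: (@bounded_integrable _ _ _ _ _ 1) => // x; rewrite normr1.
have E1 (m : probability T R) : \int[m]_x (1 : R) = 1.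
  by rewrite Rintegral_cst//= probability_setT/= mulr1.
set c := \int[A]_x cos (X x); set s := \int[A]_x sin (X x).
have inner y : (\int[A]_x (1 + cos (X x + X y))%:E = (1 + (c * cos (X y) - s * sin (X y)))%:E)%E.
  have iC := integrableZrR (cos (X y)) (ic0 A).
  have iS := integrableZrR (sin (X y)) (is0 A).
  rewrite EFin_Rintegral; last exact: (integrableDR (i1 A) (ic A (X y))).
  congr EFin; rewrite (RintegralD measurableT (i1 A) (ic A (X y))); congr (_ + _).
    exact: E1.
  under eq_Rintegral do rewrite cosD.
  by rewrite (RintegralB measurableT iC iS) (RintegralZr _ measurableT (ic0 A))
    (RintegralZr _ measurableT (is0 A)).
rewrite (eq_integral _ _ (fun y _ => inner y)) in H.
have iC := integrableZlR c (ic0 B).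
have iS := integrableZlR s (is0 B).
have iCS := integrableBR iC iS.
rewrite EFin_Rintegral in H; last exact: (integrableDR (i1 B) iCS).
rewrite [in RHS]EFin_Rintegral in H; last exact: (integrableDR (i1 C) (ic0 C)).
case: H; rewrite (RintegralD measurableT (i1 B) iCS) (RintegralD measurableT (i1 C) (ic0 C)).
rewrite -/(\int[B]_x 1) -/(\int[C]_x 1) (E1 B) (E1 C) => /addrI <-.
by rewrite (RintegralB measurableT iC iS) (RintegralZl _ measurableT (ic0 B))
  (RintegralZl _ measurableT (is0 B)).
Qed.

Lemma cos_conv_normal (R : realType) (a b c : R) :
  a != 0 -> b != 0 -> c != 0 -> c ^+ 2 = a ^+ 2 + b ^+ 2 ->
  \int[normal_prob 0 c]_x cos x =
  \int[normal_prob 0 a]_x cos x * \int[normal_prob 0 b]_x cos x -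
  \int[normal_prob 0 a]_x sin x * \int[normal_prob 0 b]_x sin x.
Proof.
move=> a0 b0 c0 cE.
have c1 : continuous (fun x : R => 1 + cos x).
  by move=> x; apply: (@cvgD _ R^o); [exact: cvg_cst|exact: continuous_cos].
have p1 (x : R) : 0 <= 1 + cos x by have := cos_geN1 x; lra.
have H := integral_normal_conv a0 b0 c0 cE c1 p1.
exact: (@cos_conv _ _ _ (normal_prob 0 a) (normal_prob 0 b) (normal_prob 0 c) id _ H).
Qed.
Lemma dominated_Rintegral_eq0 d (T : measurableType d) (R : realType)
    (m : {measure set T -> \bar R}) (h_ : nat -> T -> R) (h G : T -> R) :
  (forall n, measurable_fun setT (h_ n)) -> m.-integrable setT (EFin \o G) ->
  (forall n w, `|h_ n w| <= G w) -> (forall w, h_ n w @[n --> \oo] --> h w) ->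
  (forall n, \int[m]_w h_ n w = 0) -> \int[m]_w h w = 0.
Proof.
move=> mh iG hG hc h0.
have mlim : measurable_fun setT h.
  by apply: (measurable_fun_cvg (h := h_)) => // w _; exact: hc.
have [|||||_ _ c] := @dominated_convergence _ T R m setT measurableT
    (fun n => EFin \o h_ n) (EFin \o h) (EFin \o G).
- by move=> n; exact: measurable_fun_EFin.
- exact: measurable_fun_EFin.
- by apply: aeW => w _; apply: cvg_EFin; [exact: nearW|exact: hc].
- exact: iG.
- by apply: aeW => w n _; rewrite /= lee_fin hG.
have ih n : m.-integrable setT (EFin \o h_ n).
  apply: (le_integrable measurableT _ _ iG); first exact: measurable_fun_EFin.
  by move=> w _; rewrite /= lee_fin (le_trans (hG n w))// ler_norm.
rewrite /Rintegral.
suff -> : (\int[m]_w (h w)%:E = 0)%E by [].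
have c0 : [sequence (\int[m]_w (EFin \o h_ n) w)%E]_n @ \oo --> (0 : \bar R)%E.
  rewrite (_ : [sequence _]_n = cst 0%E); first exact: cvg_cst.
  by apply/funext => n /=; rewrite (EFin_Rintegral (ih n)) h0.
by apply: (cvg_unique _ c c0).
Qed.

(** * Testing against trigonometric functions *)

Inductive trig_poly {R : realType} : (R -> R) -> Prop :=
| trig_cst c : trig_poly (fun=> c)
| trig_cos a : trig_poly (fun v => cos (a * v))
| trig_sin a : trig_poly (fun v => sin (a * v))
| trig_add f g : trig_poly f -> trig_poly g -> trig_poly (fun v => f v + g v)
| trig_mul f g : trig_poly f -> trig_poly g -> trig_poly (fun v => f v * g v).

(* Odd, fixes -1, 0, 1 and pushes ]0, 1] towards 1: its iterates approximate the sign. *)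
Definition sgn_step {R : realType} (y : R) : R := (3 * y - y ^+ 3) / 2.

Lemma trig_poly_sgn_step (R : realType) (f : R -> R) (n : nat) : trig_poly f ->
  trig_poly (fun v => iter n sgn_step (f v)).
Proof.
move=> tf; elim: n => [//|n IH] /=.
have -> : (fun v => sgn_step (iter n sgn_step (f v))) =
    (fun v => (3 / 2) * iter n sgn_step (f v) +
      (- 2^-1) * (iter n sgn_step (f v) * (iter n sgn_step (f v) * iter n sgn_step (f v)))).
  by apply/funext => v; rewrite /sgn_step; field.
apply: trig_add; apply: trig_mul; [exact: trig_cst|exact: IH|exact: trig_cst|].
by apply: trig_mul => //; exact: trig_mul.
Qed.

Lemma sgn_step_bounded (R : realType) (n : nat) (y : R) : `|y| <= 1 -> `|iter n sgn_step y| <= 1.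
Proof.
move=> y1; elim: n => [//|n] /=; set z := iter n _ _ => z1.
move: z1; rewrite !ler_norml /sgn_step => /andP[z1 z2].
have h1 : 0 <= (1 - z) ^+ 2 * (2 + z) by rewrite mulr_ge0 ?sqr_ge0//; lra.
have h2 : 0 <= (1 + z) ^+ 2 * (2 - z) by rewrite mulr_ge0 ?sqr_ge0//; lra.
by apply/andP; split; nra.
Qed.

Lemma sgn_stepN (R : realType) (n : nat) (y : R) : iter n sgn_step (- y) = - iter n sgn_step y.
Proof.
elim: n => [//|n IH] /=; by rewrite IH /sgn_step; field.
Qed.

Lemma sgn_step0 (R : realType) (n : nat) : iter n sgn_step (0 : R) = 0.
Proof. by elim: n => [//|n IH] /=; by rewrite IH /sgn_step; field. Qed.

Lemma sgn_step_lower (R : realType) (n : nat) (y : R) : 0 < y <= 1 ->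
  y <= iter n sgn_step y <= 1 /\ 1 - iter n sgn_step y <= (1 - y / 2) ^+ n.
Proof.
move=> /andP[y0 y1]; elim: n => [|n] /=.
  by rewrite expr0 lexx y1; split => //; lra.
set z := iter n _ _ => -[/andP[yz z1] IH]; rewrite /sgn_step.
have E : 1 - (3 * z - z ^+ 3) / 2 = (1 - z) * ((1 - z) * (2 + z) / 2) by field.
have F : (1 - z) * (2 + z) / 2 <= 1 - y / 2 by nra.
have F0 : 0 <= (1 - z) * (2 + z) / 2 by apply: divr_ge0 => //; apply: mulr_ge0; lra.
split; last by rewrite E exprSr ler_pM//; lra.
have h1 : 0 <= (1 - z) ^+ 2 * (2 + z) by rewrite mulr_ge0 ?sqr_ge0//; lra.
have h2 : 0 <= z * ((1 - z) * (1 + z)) by rewrite !mulr_ge0//; lra.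
by apply/andP; split; nra.
Qed.

Lemma cvg_sgn_step (R : realType) (y : R) : `|y| <= 1 ->
  iter n sgn_step y @[n --> \oo] --> Num.sg y.
Proof.
have pos (z : R) : 0 < z <= 1 -> iter n sgn_step z @[n --> \oo] --> (1 : R).
  move=> z01; have /andP[z0 z1] := z01.
  apply: (squeeze_cvgr (f := fun n => 1 - (1 - z / 2) ^+ n) (h := cst 1)).
  - near=> n; have [/andP[_ a] b] := sgn_step_lower n z01.
    by rewrite a andbT lerBlDr -lerBlDl.
  - rewrite -[X in _ --> X]subr0; apply: (@cvgB _ R^o); first exact: cvg_cst.
    by apply: cvg_expr; rewrite ger0_norm; lra.
  - exact: cvg_cst.
move=> /[!ler_norml] /andP[y1 y2]; case: (ltrgt0P y) => y0.
- by rewrite gtr0_sg//; apply: pos; rewrite y0.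
- rewrite ltr0_sg//; rewrite -[y]opprK; under eq_fun do rewrite sgn_stepN.
  by apply: (@cvgN _ R^o); apply: pos; lra.
- rewrite y0 sgr0; under eq_fun do rewrite sgn_step0.
  exact: cvg_cst.
Unshelve. all: by end_near. Qed.

Lemma sgn_sin (R : realType) (x : R) : `|x| < pi -> Num.sg (sin x) = Num.sg x.
Proof.
rewrite ltr_norml => /andP[x1 x2]; case: (ltrgt0P x) => x0.
- by rewrite !gtr0_sg// sin_gt0_pi// x0.
- rewrite !ltr0_sg// -oppr_gt0 -sinN sin_gt0_pi// oppr_gt0 x0/=; lra.
- by rewrite x0 sin0.
Qed.

Lemma cvg_eventually (R : realType) (u : nat -> R) (l : R) :
  (\forall n \near \oo, u n = l) -> u n @[n --> \oo] --> l.
Proof.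
move=> h; apply/cvgrPdist_lt => e e0; near=> n.
suff -> : u n = l by rewrite subrr normr0.
by near: n.
Unshelve. all: by end_near. Qed.

Lemma integrable_mul_bounded d (T : measurableType d) (R : realType)
    (m : {measure set T -> \bar R}) (W f : T -> R) (M : R) :
  m.-integrable setT (EFin \o W) -> measurable_fun setT f ->
  (forall w, `|f w| <= M) -> m.-integrable setT (EFin \o (fun w => W w * f w)).
Proof.
move=> iW mf fM.
have mW : measurable_fun setT W by apply/measurable_EFinP; exact: measurable_int iW.
 have iM := integrableZlR M iW.
apply: (le_integrable measurableT _ _ iM); first by apply: measurable_fun_EFin; exact: measurable_funM.
move=> w _; rewrite /= lee_fin !normrM mulrC ler_wpM2r//.
by rewrite (le_trans (fM w))// ler_norm.
Qed.

Section trig_annihilation.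
Context d (T : measurableType d) (R : realType) (m : {measure set T -> \bar R}).
Variables (W V : T -> R).
Hypotheses (iW : m.-integrable setT (EFin \o W)) (mV : measurable_fun setT V).
Hypothesis cos0 : forall a, \int[m]_w (W w * cos (a * V w)) = 0.
Hypothesis sin0' : forall a, \int[m]_w (W w * sin (a * V w)) = 0.

Let mW : measurable_fun setT W.
Proof. by apply/measurable_EFinP; exact: measurable_int iW. Qed.

Let K (f : R -> R) := [/\ measurable_fun setT f, exists M : R, forall v, `|f v| <= M &
  forall a, \int[m]_w (W w * f (V w) * cos (a * V w)) = 0 /\
            \int[m]_w (W w * f (V w) * sin (a * V w)) = 0].

Let bnd (f : R -> R) (M : R) : measurable_fun setT f -> (forall v, `|f v| <= M) -> forall a,
  m.-integrable setT (EFin \o (fun w => W w * f (V w) * cos (a * V w))) /\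
  m.-integrable setT (EFin \o (fun w => W w * f (V w) * sin (a * V w))).
Proof.
move=> mf fM a.
have mfV : measurable_fun setT (fun w => f (V w)) by exact: measurableT_comp.
have mav : measurable_fun setT (fun w => a * V w) by exact: measurable_funM.
split.
- have -> : (fun w => W w * f (V w) * cos (a * V w)) = (fun w => W w * (f (V w) * cos (a * V w))).
    by apply/funext => w; rewrite mulrA.
  apply: (@integrable_mul_bounded _ _ _ _ _ _ M iW).
    apply: measurable_funM => //; apply: (measurableT_comp (f := @cos R)) => //.
    exact: measurable_cos.
  by move=> w; rewrite normrM -[M]mulr1 ler_pM// ler_norml cos_geN1 cos_le1.
- have -> : (fun w => W w * f (V w) * sin (a * V w)) = (fun w => W w * (f (V w) * sin (a * V w))).
    by apply/funext => w; rewrite mulrA.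
  apply: (@integrable_mul_bounded _ _ _ _ _ _ M iW).
    apply: measurable_funM => //; apply: (measurableT_comp (f := @sin R)) => //.
    exact: measurable_sin.
  by move=> w; rewrite normrM -[M]mulr1 ler_pM// ler_norml sin_geN1 sin_le1.
Qed.

Let K1 : K (fun=> 1).
Proof.
split; [exact: measurable_cst|by exists 1 => v; rewrite normr1|move=> a].
split; [rewrite -[RHS](cos0 a)|rewrite -[RHS](sin0' a)];
  by apply: eq_Rintegral => w _; rewrite mulr1.
Qed.

Let Kmul (t : R -> R) : trig_poly t -> forall f, K f -> K (fun v => t v * f v).
Proof.
elim=> {t} [c|b|b|t s _ IHt _ IHs|t s _ IHt _ IHs] f Kf; have [mf [M fM] f0] := Kf.
- split; first exact: measurable_funM.
    by exists (`|c| * M) => v; rewrite normrM ler_pM.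
  move=> a; have [iC iS] := bnd mf fM a; have [c0 s0] := f0 a.
  split.
    rewrite -[RHS](mulr0 c) -[in RHS]c0 -RintegralZl//.
    by apply: eq_Rintegral => w _; ring.
  rewrite -[RHS](mulr0 c) -[in RHS]s0 -RintegralZl//.
  by apply: eq_Rintegral => w _; ring.
- split.
  + apply: measurable_funM => //; apply: (measurableT_comp (f := @cos R)); first exact: measurable_cos.
    exact: measurable_funM.
  + by exists (1 * M) => v; rewrite normrM ler_pM// ler_norml cos_geN1 cos_le1.
  + move=> a.
    have [iC1 iS1] := bnd mf fM (a + b); have [c1 s1] := f0 (a + b).
    have [iC2 iS2] := bnd mf fM (a - b); have [c2 s2] := f0 (a - b).
    split.
      transitivity (\int[m]_w (2^-1 * (W w * f (V w) * cos ((a + b) * V w) + W w * f (V w) * cos ((a - b) * V w)))).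
        by apply: eq_Rintegral => w _; rewrite mulrDl mulrBl cosD cosB; field.
      by rewrite RintegralZl// ?RintegralD// ?c1 ?c2 ?addr0 ?mulr0//; exact: integrableDR.
    transitivity (\int[m]_w (2^-1 * (W w * f (V w) * sin ((a + b) * V w) + W w * f (V w) * sin ((a - b) * V w)))).
      by apply: eq_Rintegral => w _; rewrite mulrDl mulrBl sinD sinB; field.
    by rewrite RintegralZl// ?RintegralD// ?s1 ?s2 ?addr0 ?mulr0//; exact: integrableDR.
- split.
  + apply: measurable_funM => //; apply: (measurableT_comp (f := @sin R)); first exact: measurable_sin.
    exact: measurable_funM.
  + by exists (1 * M) => v; rewrite normrM ler_pM// ler_norml sin_geN1 sin_le1.
  + move=> a.
    have [iC1 iS1] := bnd mf fM (a + b); have [c1 s1] := f0 (a + b).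
    have [iC2 iS2] := bnd mf fM (a - b); have [c2 s2] := f0 (a - b).
    split.
      transitivity (\int[m]_w (2^-1 * (W w * f (V w) * sin ((a + b) * V w) - W w * f (V w) * sin ((a - b) * V w)))).
        by apply: eq_Rintegral => w _; rewrite mulrDl mulrBl sinD sinB; field.
      by rewrite RintegralZl// ?RintegralB// ?s1 ?s2 ?subr0 ?mulr0//; exact: integrableBR.
    transitivity (\int[m]_w (2^-1 * (W w * f (V w) * cos ((a - b) * V w) - W w * f (V w) * cos ((a + b) * V w)))).
      by apply: eq_Rintegral => w _; rewrite mulrBl mulrDl cosB cosD; field.
    by rewrite RintegralZl// ?RintegralB// ?c1 ?c2 ?subr0 ?mulr0//; exact: integrableBR.
- have [mt [Mt tM] t0] := IHt f Kf; have [ms [Ms sM] s0] := IHs f Kf.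
  split.
  + by under eq_fun do rewrite mulrDl; exact: measurable_funD.
  + by exists (Mt + Ms) => v; rewrite mulrDl (le_trans (ler_normD _ _))// lerD.
  + move=> a; have [iC1 iS1] := bnd mt tM a; have [c1 s1] := t0 a.
    have [iC2 iS2] := bnd ms sM a; have [c2 s2] := s0 a.
    split.
      rewrite -[RHS]addr0 -[X in _ = X + _]c1 -[X in _ = _ + X]c2 -RintegralD//.
      by apply: eq_Rintegral => w _; ring.
    rewrite -[RHS]addr0 -[X in _ = X + _]s1 -[X in _ = _ + X]s2 -RintegralD//.
    by apply: eq_Rintegral => w _; ring.
- have -> : (fun v => t v * s v * f v) = (fun v => t v * (s v * f v)).
    by apply/funext => v; rewrite mulrA.
  exact/IHt/IHs.
Qed.

Lemma trig_poly_annihilated (t : R -> R) : trig_poly t -> \int[m]_w (W w * t (V w)) = 0.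
Proof.
move=> /Kmul/(_ _ K1)[_ _ /(_ 0)[+ _]] => <-.
by apply: eq_Rintegral => w _; rewrite mul0r trigo.cos0 !mulr1.
Qed.

End trig_annihilation.

Import HBNNSimple.

Section annihilation.
Context d (T : measurableType d) (R : realType) (m : {measure set T -> \bar R}).
Variables (W V : T -> R).
Hypotheses (iW : m.-integrable setT (EFin \o W)) (mV : measurable_fun setT V).
Hypothesis cosW : forall a, \int[m]_w (W w * cos (a * V w)) = 0.
Hypothesis sinW : forall a, \int[m]_w (W w * sin (a * V w)) = 0.

Let mW : measurable_fun setT W.
Proof. by apply/measurable_EFinP; exact: measurable_int iW. Qed.

Let iaW : m.-integrable setT (EFin \o (fun w => `|W w|)).
Proof.
apply: (le_integrable measurableT _ _ iW).
  by apply: measurable_fun_EFin; exact: measurableT_comp.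
by move=> w _; rewrite /= normr_id.
Qed.

Let int0 : \int[m]_w W w = 0.
Proof.
rewrite -[RHS](trig_poly_annihilated iW mV cosW sinW (trig_cst 1)).
by apply: eq_Rintegral => w _; rewrite mulr1.
Qed.

Let bounded_lim (h_ : nat -> T -> R) (h : T -> R) : (forall n, measurable_fun setT (h_ n)) ->
  (forall n w, `|h_ n w| <= 1) -> (forall w, h_ n w @[n --> \oo] --> h w) ->
  (forall n, \int[m]_w (W w * h_ n w) = 0) -> \int[m]_w (W w * h w) = 0.
Proof.
move=> mh h1 hc h0.
apply: (dominated_Rintegral_eq0 (h_ := fun n w => W w * h_ n w) _ iaW).
- by move=> n; exact: measurable_funM.
- by move=> n w; rewrite normrM ler_piMr.
- by move=> w; apply: cvgM; [exact: cvg_cst|exact: hc].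
- exact: h0.
Qed.

Let mstep n : measurable_fun setT (fun y : R => iter n sgn_step y).
Proof.
elim: n => [|n IH] /=; first exact: measurable_id.
apply: (measurableT_comp (f := sgn_step)) => //; rewrite /sgn_step.
apply: measurable_funM => //; apply: measurable_funB; first exact: measurable_funM.
exact: measurable_funX.
Qed.

Let msin (s : R) (N : nat) : measurable_fun setT (fun w => sin ((V w - s) / N.+1%:R)).
Proof.
apply: (measurableT_comp (f := @sin R)); first exact: measurable_sin.
by apply: measurable_funM => //; exact: measurable_funB.
Qed.

Let sg_annihilated (s : R) : measurable_fun setT (fun w => Num.sg (V w - s)) /\
  \int[m]_w (W w * Num.sg (V w - s)) = 0.
Proof.
have sin1 (x : R) : `|sin x| <= 1 by rewrite ler_norml sin_geN1 sin_le1.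
have sg1 (x : R) : `|Num.sg x| <= 1 by rewrite normr_sg; case: (x != 0).
pose hN (N : nat) (w : T) := Num.sg (sin ((V w - s) / N.+1%:R)).
have hNc N w : iter n sgn_step (sin ((V w - s) / N.+1%:R)) @[n --> \oo] --> hN N w.
  exact/cvg_sgn_step/sin1.
have mhN N : measurable_fun setT (hN N).
  apply: (measurable_fun_cvg (h := fun n w => iter n sgn_step (sin ((V w - s) / N.+1%:R)))).
    by move=> n; exact: (measurableT_comp (mstep n) (msin s N)).
  by move=> w _; exact: hNc.
have hc w : hN N w @[N --> \oo] --> Num.sg (V w - s).
  apply: cvg_eventually; near=> N; rewrite /hN sgn_sin.
    by rewrite sgrM (gtr0_sg (_ : 0 < N.+1%:R^-1)) ?mulr1// invr_gt0.
  rewrite normrM normfV (ger0_norm (_ : 0 <= N.+1%:R))//.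
  rewrite ltr_pdivrMr// (le_lt_trans (ltW (truncnS_gt _)))//.
  apply: (@le_lt_trans _ _ N.+1%:R).
    rewrite ler_nat; near: N; exists (Num.trunc `|V w - s|) => // k /=.
  by rewrite ltr_pMl//; have := pi_ge2 R; set p : R := pi; lra.
split.
  by apply: (measurable_fun_cvg (h := hN)) => // w _; exact: hc.
apply: (bounded_lim mhN) => //.
  by move=> N w; exact: sg1.
move=> N; apply: (bounded_lim (h_ := fun n w => iter n sgn_step (sin ((V w - s) / N.+1%:R)))).
- by move=> n; exact: (measurableT_comp (mstep n) (msin s N)).
- by move=> n w; exact/sgn_step_bounded/sin1.
- exact: hNc.
move=> n.
rewrite -[RHS](@trig_poly_annihilated _ _ _ m W V iW mV cosW sinW
  (fun v => iter n sgn_step (sin ((v - s) / N.+1%:R)))) //.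
apply: trig_poly_sgn_step.
have -> : (fun v => sin ((v - s) / N.+1%:R)) =
    (fun v => cos (s / N.+1%:R) * sin (N.+1%:R^-1 * v) + (- sin (s / N.+1%:R)) * cos (N.+1%:R^-1 * v)).
  by apply/funext => v; rewrite mulrBl sinB [v / _]mulrC; ring.
apply: trig_add; apply: trig_mul; [exact: trig_cst|exact: trig_sin|exact: trig_cst|exact: trig_cos].
Unshelve. all: by end_near. Qed.

Let mind (A : set R) : measurable A -> measurable_fun setT (fun w => \1_A (V w) : R).
Proof. by move=> mA; exact: (measurableT_comp (measurable_indic mA) mV). Qed.

Let ind1 (A : set R) (v : R) : `|\1_A v : R| <= 1.
Proof. by rewrite indicE; case: (_ \in _); rewrite ?normr1// normr0. Qed.

Let iind (A : set R) : measurable A ->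
  m.-integrable setT (EFin \o (fun w => W w * \1_A (V w))).
Proof.
by move=> mA; apply: (@integrable_mul_bounded _ _ _ _ _ _ 1 iW (mind mA)) => w; exact: ind1.
Qed.

Let ray_annihilated (s : R) : \int[m]_w (W w * \1_(`]s, +oo[%classic : set R) (V w)) = 0.
Proof.
have iI := iind (@measurable_itv R `]s, +oo[).
have H : \int[m]_w (W w * (2 * \1_(`]s, +oo[%classic : set R) (V w) - 1)) = 0.
  apply: (bounded_lim (h_ := fun n w => Num.sg (V w - (s + n.+1%:R^-1)))).
  - by move=> n; exact: (sg_annihilated _).1.
  - by move=> n w; rewrite normr_sg; case: (_ != 0).
  - move=> w; rewrite indicE; apply: cvg_eventually.
    have [Vs|sV] := leP (V w) s; near=> n.
      rewrite memNset ?mulr0 ?sub0r; last by rewrite /= in_itv/= andbT; apply/negP; rewrite -leNgt.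
      rewrite ltr0_sg// subr_lt0 (le_lt_trans Vs)// ltrDl invr_gt0//.
    rewrite mem_set ?mulr1; last by rewrite /= in_itv/= andbT.
    rewrite gtr0_sg; first by lra.
    rewrite subr_gt0 -ltrBrDl.
    near: n; have sV0 : 0 < V w - s by rewrite subr_gt0.
    exact: (near_infty_natSinv_lt (PosNum sV0)).
  - by move=> n; exact: (sg_annihilated _).2.
have : \int[m]_w (W w * (2 * \1_(`]s, +oo[%classic : set R) (V w) - 1)) =
  2 * \int[m]_w (W w * \1_(`]s, +oo[%classic : set R) (V w)) - \int[m]_w W w.
  rewrite -(RintegralZl _ measurableT iI) -(RintegralB measurableT (integrableZlR 2 iI) iW).
  by apply: eq_Rintegral => w _; ring.
rewrite H int0 subr0 => /esym/eqP; rewrite mulf_eq0 pnatr_eq0/= => /eqP //.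
Unshelve. all: by end_near. Qed.

Let set_annihilated (A : set R) : measurable A -> \int[m]_w (W w * \1_A (V w)) = 0.
Proof.
move=> mA.
have sA : (@RGenOInfty.G R).-sigma.-measurable A.
  by move: mA; rewrite -[measurable]/(@ocitv R).-sigma.-measurable RGenOInfty.measurableE.
move: (A) sA => {mA}{}A.
apply: (@dynkin_induction _ (measurableTypeR R) (@RGenOInfty.G R)
  (fun A => \int[m]_w (W w * \1_A (V w)) = 0) (RGenOInfty.measurableE R)).
- move=> _ _ [x ->] [y ->]; exists (Num.max x y).
  apply/seteqP; split => z /=; rewrite !in_itv/= !andbT gt_max; first by move=> [-> ->].
  by move=> /andP[].
- rewrite -[RHS]int0; apply: eq_Rintegral => w _; by rewrite indicT mulr1.
- by move=> _ [x ->]; exact: ray_annihilated.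
- move=> B mB B0.
  transitivity (\int[m]_w W w - \int[m]_w (W w * \1_B (V w))); last by rewrite int0 B0 subr0.
  rewrite -(RintegralB measurableT iW (iind mB)); apply: eq_Rintegral => w _.
  by rewrite !indicE in_setC; case: (_ \in B) => /=; ring.
- move=> F mF tF F0.
  have E (w : T) (k : nat) : F k (V w) -> forall i, \1_(F i) (V w) = (i == k)%:R :> R.
    move=> Fk i; rewrite indicE; case: eqVneq => [->|ik]; first by rewrite mem_set.
    rewrite memNset// => Fi; have := tF i k I I (ex_intro _ (V w) (conj Fi Fk)).
    by move/eqP : ik.
  have S (w : T) (k : nat) (n : nat) : F k (V w) ->
      \sum_(i < n) (\1_(F i) (V w) : R) = (k < n)%:R.
    move=> Fk; under eq_bigr do rewrite (E w k Fk).
    case: ltnP => kn; first by rewrite (bigD1 (Ordinal kn))//= eqxx big1 ?addr0// => i; rewrite -val_eqE/= => /negbTE ->.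
    by rewrite big1// => i _; rewrite ltn_eqF// (leq_trans (ltn_ord i)).
  have S0 (w : T) n : ~ (\bigcup_k F k) (V w) -> \sum_(i < n) (\1_(F i) (V w) : R) = 0.
    move=> nF; rewrite big1// => i _; rewrite indicE memNset// => Fi.
    by apply: nF; exists i.
  apply: (bounded_lim (h_ := fun n w => \sum_(i < n) (\1_(F i) (V w) : R))).
  + by move=> n; apply: measurable_sum => i; apply: mind; exact: mF.
  + move=> n w; have [[k _ Fk]|nF] := pselect ((\bigcup_k F k) (V w)).
      by rewrite (S w k n Fk); case: ltnP; rewrite ?normr1 ?normr0.
    by rewrite S0// normr0.
  + move=> w; apply: cvg_eventually; have [[k _ Fk]|nF] := pselect ((\bigcup_k F k) (V w)); near=> n.
      rewrite (S w k n Fk) indicE mem_set; last by exists k.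
      by rewrite (_ : (k < n)%N = true)//; near: n; exact: nbhs_infty_gt.
    by rewrite S0// indicE memNset.
  + elim=> [|n IH]; first by under eq_Rintegral do rewrite big_ord0 mulr0; rewrite /Rintegral integral0.
    transitivity (\int[m]_w (W w * (\sum_(i < n) (\1_(F i) (V w) : R)) + W w * \1_(F n) (V w))).
      by apply: eq_Rintegral => w _; rewrite big_ord_recr/= mulrDr.
    rewrite RintegralD//; first by rewrite IH F0 addr0.
      apply: (@integrable_mul_bounded _ _ _ _ _ _ 1 iW).
        by apply: measurable_sum => i; apply: mind; exact: mF.
      move=> w; have [[k _ Fk]|nF] := pselect ((\bigcup_k F k) (V w)).
        by rewrite (S w k n Fk); case: ltnP; rewrite ?normr1 ?normr0.
      by rewrite S0// normr0.
    by apply: iind; exact: mF.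
Unshelve. all: by end_near. Qed.

Let ge0_fun_annihilated (F : R -> R) : measurable_fun setT F -> (forall v, 0 <= F v) ->
  m.-integrable setT (EFin \o (fun w => W w * F (V w))) ->
  \int[m]_w (W w * F (V w)) = 0.
Proof.
move=> mF F0 iF; have mEF : measurable_fun setT (EFin \o F) by exact: measurable_fun_EFin.
pose f_ := nnsfun_approx measurableT mEF.
have fc v : f_ n v @[n --> \oo] --> F v.
  exact: (fine_cvg (@cvg_nnsfun_approx _ _ _ _ measurableT _ mEF (fun x _ => F0 x) v I)).
have fF n v : f_ n v <= F v.
  rewrite -(cvg_lim (@Rhausdorff R) (fc v)).
  apply: (nondecreasing_cvgn_le (u_ := fun n => f_ n v)).
    by move=> a b ab; exact: (lefP _ _ (nd_nnsfun_approx measurableT mEF ab)).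
  by apply/cvg_ex; exists (F v); exact: fc.
have f0 n : \int[m]_w (W w * f_ n (V w)) = 0.
  have E w : W w * f_ n (V w) =
     \sum_(y <- finmap.enum_fset (fset_set (range (f_ n)))) W w * (y * \1_(f_ n @^-1` [set y]) (V w)).
    rewrite fimfunE fsbig_finite//= big_distrr//=.
  under eq_Rintegral do rewrite E.
  elim: (finmap.enum_fset _) => [|y s IH].
    by under eq_Rintegral do rewrite big_nil; rewrite /Rintegral integral0.
  have mA : measurable (f_ n @^-1` [set y]) by exact: measurable_sfunP.
  have iy : m.-integrable setT (EFin \o (fun w => W w * (y * \1_(f_ n @^-1` [set y]) (V w)))).
    under eq_fun do rewrite mulrCA.
    exact/integrableZlR/iind.
  have is_ (r : seq R) : m.-integrable setT
      (EFin \o (fun w => \sum_(z <- r) W w * (z * \1_(f_ n @^-1` [set z]) (V w)))).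
    elim: r => [|z r IHr].
      have -> : (fun w => \sum_(z <- [::]) W w * (z * \1_(f_ n @^-1` [set z]) (V w))) = cst (0 : R).
        by apply/funext => w; rewrite big_nil.
      exact: integrable0.
    under eq_fun do rewrite big_cons; apply: integrableDR => //.
    under eq_fun do rewrite mulrCA.
    exact/integrableZlR/iind.
  under eq_Rintegral do rewrite big_cons.
  rewrite RintegralD// IH addr0; under eq_Rintegral do rewrite mulrCA.
  by rewrite RintegralZl ?set_annihilated ?mulr0//; exact: iind.
apply: (dominated_Rintegral_eq0 (h_ := fun n w => W w * f_ n (V w)) (G := fun w => `|W w * F (V w)|) _ _ _ _ f0).
- move=> n; apply: measurable_funM => //; apply: (measurableT_comp (f := f_ n)) => //.
- apply: (le_integrable measurableT _ _ iF (f := fun w => `|W w * F (V w)|%:E)).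
    apply: measurable_fun_EFin; apply: measurableT_comp => //; apply: measurable_funM => //.
    exact: measurableT_comp.
  by move=> w _; rewrite /= normr_id.
- by move=> n w; rewrite !normrM ler_wpM2l// !ger0_norm.
- by move=> w; apply: cvgM; [exact: cvg_cst|exact: fc].
Qed.

Lemma fun_annihilated (F : R -> R) : measurable_fun setT F ->
  m.-integrable setT (EFin \o (fun w => W w * F (V w))) ->
  \int[m]_w (W w * F (V w)) = 0.
Proof.
move=> mF iF.
have half (s : R) : `|s| = 1 -> m.-integrable setT (EFin \o (fun w => W w * Num.max (s * F (V w)) 0))
   /\ \int[m]_w (W w * Num.max (s * F (V w)) 0) = 0.
  move=> s1; have mm : measurable_fun setT (fun v => Num.max (s * F v) 0).
    by apply: measurable_maxr => //; exact: measurable_funM.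
  have iM : m.-integrable setT (EFin \o (fun w => W w * Num.max (s * F (V w)) 0)).
    apply: (le_integrable measurableT _ _ iF).
      apply: measurable_fun_EFin; apply: measurable_funM => //.
      exact: (measurableT_comp (f := fun v => Num.max (s * F v) 0)).
    move=> w _; rewrite /= lee_fin !normrM ler_wpM2l//.
    rewrite -[leRHS]mul1r -s1 -normrM ger0_norm ?le_max ?lexx ?orbT//.
    by rewrite ge_max ler_norm normr_ge0.
  split => //; apply: (ge0_fun_annihilated (F := fun v => Num.max (s * F v) 0)) => // v.
  by rewrite le_max lexx orbT.
have [i1 e1] := half 1 (normr1 _).
have [i2 e2] := half (-1) (normrN1 _).
transitivity (\int[m]_w (W w * Num.max (1 * F (V w)) 0 - W w * Num.max (- 1 * F (V w)) 0)).
  apply: eq_Rintegral => w _; rewrite -mulrBr; congr (_ * _).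
  by rewrite mul1r mulN1r; case/orP: (le_total 0 (F (V w))) => h;
    [rewrite max_l// max_r ?oppr_le0// subr0|rewrite max_r// max_l ?oppr_ge0// sub0r opprK].
by rewrite RintegralB// e1 e2 subr0.
Qed.

End annihilation.

(** * Gaussian spaces *)

(* Closure under linear combinations makes every joint law accessible through
   one-dimensional ones. *)
Definition gaussian_space d (T : measurableType d) (R : realType) (P : probability T R)
    (G : set (T -> R)) :=
  [/\ forall X, G X -> measurable_fun setT X,
      forall X, G X -> centred_gaussian P X,
      G (fun=> 0) &
      forall a X Y, G X -> G Y -> G (fun w => a * X w + Y w)].

Section gaussian_space.
Context d (T : measurableType d) (R : realType) (P : probability T R).
Variable G : set (T -> R).
Hypothesis GG : gaussian_space P G.

Local Notation "''E' X" := (\int[P]_w X w) (at level 10, X at level 8).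

Definition ip (X Y : T -> R) : R := \int[P]_w (X w * Y w).

Lemma gs_measurable X : G X -> measurable_fun setT X. Proof. by case: GG => + _ _ _; apply. Qed.

Lemma gs0 : G (fun=> 0). Proof. by case: GG. Qed.

Lemma gsZD a X Y : G X -> G Y -> G (fun w => a * X w + Y w). Proof. by case: GG => _ _ _; apply. Qed.

Lemma gsD X Y : G X -> G Y -> G (fun w => X w + Y w).
Proof.
move=> GX GY; have -> : (fun w => X w + Y w) = (fun w => 1 * X w + Y w).
  by apply/funext => w; rewrite mul1r.
exact: gsZD.
Qed.

Lemma gsZ a X : G X -> G (fun w => a * X w).
Proof.
move=> GX; have -> : (fun w => a * X w) = (fun w => a * X w + (fun=> 0) w).
  by apply/funext => w; rewrite addr0.
exact: gsZD gs0.
Qed.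

Lemma gsN X : G X -> G (fun w => - X w).
Proof.
move=> GX; have -> : (fun w => - X w) = (fun w => -1 * X w).
  by apply/funext => w; rewrite mulN1r.
exact: gsZ.
Qed.

Lemma gsB X Y : G X -> G Y -> G (fun w => X w - Y w).
Proof. by move=> GX GY; apply: gsD => //; exact: gsN. Qed.

Let gs_law0 X : G X -> exists s : R, forall f : R -> \bar R,
  measurable_fun setT f -> (forall x, 0 <= f x)%E ->
  (\int[P]_w f (X w) = if s == 0%R then f 0%R else \int[normal_prob 0 s]_x f x)%E.
Proof.
move=> GX; have mX := gs_measurable GX; have [_ /(_ _ GX)[s sP] _ _] := GG.
exists s => f mf f0.
case: eqVneq => [s0|s0].
  transitivity (\int[pushforward P X]_y f y)%E; first by rewrite ge0_integral_pushforward.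
  transitivity (\int[\d_(0%R : R)]_y f y)%E.
    apply: (eq_measure_integral (\d_(0%R : R))) => A mA _.
    by have := sP A mA; rewrite s0 eqxx.
  by rewrite integral_dirac// diracT mul1e.
pose X' : T -> measurableTypeR R := X.
transitivity (\int[pushforward P X']_y f y)%E; first by rewrite ge0_integral_pushforward.
apply: (@eq_measure_integral _ _ R setT (normal_prob 0 s)) => A mA _.
by have := sP A mA; rewrite (negbTE s0).
Qed.

Let gs_law1 X : G X -> exists s : R,
 [/\ forall f : R -> \bar R, measurable_fun setT f -> (forall x, 0 <= f x)%E ->
  (\int[P]_w f (X w) = if s == 0%R then f 0%R else \int[normal_prob 0 s]_x f x)%E,
  (\int[P]_w (X w ^+ 2)%:E = (s ^+ 2)%:E)%E &
  (\int[P]_w (expR (X w))%:E = (expR (s ^+ 2 / 2))%:E)%E].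
Proof.
move=> /gs_law0[s sP]; exists s; split => //.
- rewrite (sP (fun x => (x ^+ 2)%:E)); last 2 first.
  + by apply: measurable_fun_EFin; exact: measurable_funX.
  + by move=> x; rewrite lee_fin sqr_ge0.
  case: eqVneq => [->|s0]; first by [].
  exact: integral_sqr_normal.
- rewrite (sP (fun x => (expR x)%:E)); last 2 first.
  + by apply: measurable_fun_EFin; exact: measurable_expR.
  + by move=> x; rewrite lee_fin expR_ge0.
  case: eqVneq => [->|s0]; first by rewrite expr0n/= mul0r.
  exact: integral_expR_normal.
Qed.

Let ge0_integrable (f : T -> R) (r : R) : measurable_fun setT f -> (forall w, 0 <= f w) ->
  (\int[P]_w (f w)%:E = r%:E)%E -> P.-integrable setT (EFin \o f).
Proof.
move=> mf f0 fr; apply/integrableP; split; first exact: measurable_fun_EFin.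
under eq_integral do rewrite /= ger0_norm//.
by rewrite fr ltry.
Qed.

Lemma gs_integrable_expR X : G X -> P.-integrable setT (EFin \o (fun w => expR (X w))).
Proof.
move=> GX; have [s [_ _ E]] := gs_law1 GX.
apply: (ge0_integrable _ _ E) => [|w]; last exact: expR_ge0.
by apply: (measurableT_comp (f := @expR R)) => //; exact: gs_measurable.
Qed.

Lemma gs_ip X : G X -> (\int[P]_w (X w ^+ 2)%:E = (ip X X)%:E)%E.
Proof.
move=> GX; have [s [_ E _]] := gs_law1 GX.
by rewrite /ip /Rintegral; under [in RHS]eq_integral do rewrite -expr2; rewrite E.
Qed.

Lemma gs_law X (f : R -> \bar R) : G X -> measurable_fun setT f -> (forall x, 0 <= f x)%E ->
  (\int[P]_w f (X w) = if ip X X == 0%R then f 0%R else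
     \int[normal_prob 0 (Num.sqrt (ip X X))]_x f x)%E.
Proof.
move=> GX mf f0; have [s [sP E _]] := gs_law1 GX.
rewrite (sP f mf f0); move: E; rewrite (gs_ip GX) => -[->].
by rewrite sqrf_eq0 sqrtr_sqr normal_prob_norm.
Qed.

Lemma ip_ge0 X : 0 <= ip X X.
Proof. by apply: Rintegral_ge0 => w _; rewrite -expr2 sqr_ge0. Qed.

Lemma gs_expE X : G X -> 'E (fun w => expR (X w)) = expR (ip X X / 2).
Proof.
move=> GX; have [s [_ E1 E2]] := gs_law1 GX.
by move: E1; rewrite gs_ip// => -[->]; rewrite /Rintegral E2.
Qed.

Lemma gs_integrable_sqr X : G X -> P.-integrable setT (EFin \o (fun w => X w ^+ 2)).
Proof.
move=> GX; apply: (ge0_integrable _ _ (gs_ip GX)) => [|w]; last exact: sqr_ge0.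
by apply: measurable_funX; exact: gs_measurable.
Qed.

Lemma gs_integrableM X Y : G X -> G Y -> P.-integrable setT (EFin \o (fun w => X w * Y w)).
Proof.
move=> GX GY.
have h := integrableDR (gs_integrable_sqr GX) (gs_integrable_sqr GY).
apply: (le_integrable measurableT _ _ h).
  by apply: measurable_fun_EFin; apply: measurable_funM; exact: gs_measurable.
move=> w _; rewrite /= lee_fin [leRHS]ger0_norm ?addr_ge0 ?sqr_ge0// ler_norml.
have h1 := sqr_ge0 (X w + Y w); have h2 := sqr_ge0 (X w - Y w).
by rewrite !expr2 in h1 h2 *; apply/andP; split; nra.
Qed.

Lemma ipC X Y : ip X Y = ip Y X.
Proof. by apply: eq_Rintegral => w _; rewrite mulrC. Qed.

Lemma ipZDl a X Y Z : G X -> G Y -> G Z -> ip (fun w => a * X w + Y w) Z = a * ip X Z + ip Y Z.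
Proof.
move=> GX GY GZ; rewrite /ip.
rewrite -(RintegralZl _ measurableT (gs_integrableM GX GZ)).
rewrite -(RintegralD measurableT (integrableZlR a (gs_integrableM GX GZ)) (gs_integrableM GY GZ)).
by apply: eq_Rintegral => w _; ring.
Qed.

Lemma ipDl X Y Z : G X -> G Y -> G Z -> ip (fun w => X w + Y w) Z = ip X Z + ip Y Z.
Proof.
move=> GX GY GZ; rewrite -[X in _ = X + _]mul1r -ipZDl//; congr (ip _ _).
by apply/funext => w; rewrite mul1r.
Qed.

Lemma ipZl a X Z : G X -> G Z -> ip (fun w => a * X w) Z = a * ip X Z.
Proof.
by move=> GX GZ; rewrite /ip -(RintegralZl _ measurableT (gs_integrableM GX GZ));
  apply: eq_Rintegral => w _; rewrite mulrA.
Qed.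

Lemma ipNl X Z : G X -> G Z -> ip (fun w => - X w) Z = - ip X Z.
Proof.
move=> GX GZ; rewrite -[RHS]mulN1r -ipZl//; congr (ip _ _).
by apply/funext => w; rewrite mulN1r.
Qed.

Lemma ipBl X Y Z : G X -> G Y -> G Z -> ip (fun w => X w - Y w) Z = ip X Z - ip Y Z.
Proof. by move=> GX GY GZ; rewrite (ipDl GX (gsN GY) GZ) ipNl. Qed.

Lemma ip_comb a b X Y : G X -> G Y ->
  ip (fun w => a * X w + b * Y w) (fun w => a * X w + b * Y w) =
  a ^+ 2 * ip X X + 2 * a * b * ip X Y + b ^+ 2 * ip Y Y.
Proof.
move=> GX GY; have GZ : G (fun w => a * X w + b * Y w) by exact: gsZD (gsZ b GY).
rewrite (ipZDl _ GX (gsZ b GY) GZ) ipZl// ![ip _ (fun w => _ + _)]ipC.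
rewrite !(ipZDl _ GX (gsZ b GY)) ?ipZl// [ip Y X]ipC; ring.
Qed.

Lemma gs_expE_comb a b X Y : G X -> G Y -> 'E (fun w => expR (a * X w + b * Y w)) =
  expR ((a ^+ 2 * ip X X + 2 * a * b * ip X Y + b ^+ 2 * ip Y Y) / 2).
Proof. by move=> GX GY; rewrite gs_expE ?ip_comb//; exact: gsZD (gsZ b GY). Qed.

Lemma gs_tail X (a : R) : G X -> 0 < ip X X -> 0 < a ->
  (P [set w | (a < X w)%R] <=
    (Num.sqrt (ip X X) / a * expR (- (a ^+ 2 / (2 * ip X X))))%:E)%E.
Proof.
move=> GX q0 a0; have mX := gs_measurable GX.
have mA : measurable ([set` `]a, +oo[] : set R) by exact: measurable_itv.
have -> : [set w | a < X w] = X @^-1` [set` `]a, +oo[].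
  by apply/seteqP; split => w; rewrite /= in_itv/= andbT.
have := @gs_law X (fun x => (\1_[set` `]a, +oo[] x)%:E) GX.
rewrite gt_eqF// => /(_ _ _)/esym H.
have s0 : Num.sqrt (ip X X) != 0 by rewrite gt_eqF// sqrtr_gt0.
have := normal_prob_tail s0 a0; rewrite ger0_norm ?sqrtr_ge0// sqr_sqrtr ?ip_ge0//.
apply: le_trans.
have mXA : measurable (X @^-1` [set` `]a, +oo[]) by rewrite -[X in measurable X]setTI; exact: mX.
have <- : (\int[P]_w (\1_[set` `]a, +oo[] (X w))%:E = P (X @^-1` [set` `]a, +oo[]))%E.
  rewrite -[RHS]mule1 -[in RHS](setIT (X @^-1` _)) -(integral_indic P measurableT mXA) mule1.
  by apply: eq_integral => w _; rewrite !indicE; congr (_%:R)%:E; apply/asbool_equiv_eq.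
have <- : (\int[normal_prob 0 (Num.sqrt (ip X X))]_x (\1_[set` `]a, +oo[] x)%:E =
    normal_prob 0 (Num.sqrt (ip X X)) [set` `]a, +oo[])%E.
  by rewrite integral_indic// setIT.
rewrite H//.
by apply: measurable_fun_EFin; exact: measurable_indic.
Qed.

Lemma gs_symm X (f : R -> \bar R) : G X -> measurable_fun setT f -> (forall x, 0 <= f x)%E ->
  (\int[P]_w f (- X w)%R = \int[P]_w f (X w))%E.
Proof.
move=> GX mf f0; rewrite (gs_law (gsN GX) mf f0) (gs_law GX mf f0).
suff -> : ip (fun w => - X w) (fun w => - X w) = ip X X by [].
by apply: eq_Rintegral => w _; rewrite mulrNN.
Qed.

Lemma gs_girsanov X (f : R -> R) : G X -> continuous f -> (forall x, 0 <= f x) ->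
  (\int[P]_w (f (X w) * expR (X w - ip X X / 2))%:E = \int[P]_w (f (X w + ip X X))%:E)%E.
Proof.
move=> GX cf f0; have mf : measurable_fun setT f by exact: continuous_measurable_fun.
set q := ip X X.
have me : measurable_fun setT (fun x => f x * expR (x - q / 2)).
  apply: measurable_funM => //; apply: (measurableT_comp (f := @expR R)) => //.
  exact: measurable_funB.
rewrite (@gs_law X (fun x => (f x * expR (x - q / 2))%:E))//; last 2 first.
- exact: measurable_fun_EFin.
- by move=> x; rewrite lee_fin mulr_ge0 ?expR_ge0.
rewrite (@gs_law X (fun x => (f (x + q))%:E))//; last 2 first.
- by apply: measurable_fun_EFin; apply: measurableT_comp => //; exact: measurable_funD.
- by move=> x; rewrite lee_fin.
rewrite -/q; case: eqVneq => [->|q0]; first by rewrite mul0r subr0 expR0 mulr1 addr0.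
have s0 : Num.sqrt q != 0 by rewrite gt_eqF// sqrtr_gt0 lt_neqAle eq_sym q0 ip_ge0.
have sq : Num.sqrt q ^+ 2 = q by rewrite sqr_sqrtr ?ip_ge0.
rewrite ge0_integral_normal_prob; last 2 first.
- exact: measurable_fun_EFin.
- by move=> x; rewrite lee_fin mulr_ge0 ?expR_ge0.
rewrite ge0_integral_normal_prob; last 2 first.
- by apply: measurable_fun_EFin; apply: measurableT_comp => //; exact: measurable_funD.
- by move=> x; rewrite lee_fin.
transitivity (\int[lebesgue_measure]_x (f x * normal_pdf q (Num.sqrt q) x)%:E)%E.
  apply: eq_integral => x _; rewrite -EFinM; congr EFin.
  rewrite expRD -!mulrA; congr (_ * _); rewrite [X in _ * X]mulrC mulrA.
  by rewrite normal_pdf_exp// sq expRN mulrAC divff ?mul1r// gt_eqF// expR_gt0.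
rewrite -(@integral_translation R (fun x => f x * normal_pdf q (Num.sqrt q) x) q).
- apply: eq_integral => x _; rewrite -EFinM; congr (_ * _)%:E.
  by rewrite !normal_pdfE// /normal_fun addrK subr0.
- by move=> x; apply: cvgM; [exact: cf|exact: continuous_normal_pdf].
- by move=> x; rewrite mulr_ge0 ?normal_pdf_ge0.
Qed.

Lemma gs_integrable X : G X -> P.-integrable setT (EFin \o X).
Proof.
move=> GX; have i1 : P.-integrable setT (EFin \o (fun=> 1 : R)).
  by apply: (@bounded_integrable _ _ _ _ _ 1) => // x; rewrite normr1.
have h := integrableDR i1 (gs_integrable_sqr GX).
apply: (le_integrable measurableT _ _ h); first by apply: measurable_fun_EFin; exact: gs_measurable.
move=> w _; rewrite /= lee_fin [leRHS]ger0_norm ?addr_ge0 ?sqr_ge0// ler_norml.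
have h1 := sqr_ge0 (X w + 1); have h2 := sqr_ge0 (X w - 1); have h3 := sqr_ge0 (X w).
by rewrite !expr2 in h1 h2 h3 *; apply/andP; split; nra.
Qed.

Let i1 : P.-integrable setT (EFin \o (fun=> 1 : R)).
Proof. by apply: (@bounded_integrable _ _ _ _ _ 1) => // x; rewrite normr1. Qed.

Let E1 : 'E (fun=> 1) = 1.
Proof. by rewrite Rintegral_cst//= probability_setT/= mulr1. Qed.

Lemma gs_mean0 X : G X -> 'E X = 0.
Proof.
move=> GX; have mf : measurable_fun setT (fun x : R => ((x + 1) ^+ 2)%:E).
  by apply: measurable_fun_EFin; apply: measurable_funX; exact: measurable_funD.
have H := gs_symm GX mf (fun x => _).
have {H} := H (fun x => (_ : (0 <= ((x + 1) ^+ 2)%:E)%E)).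
have f0 (x : R) : (0 <= ((x + 1) ^+ 2)%:E)%E by rewrite lee_fin sqr_ge0.
move=> /(_ f0) H.
have [iX iX2] := (gs_integrable GX, gs_integrable_sqr GX).
have E2 (c : R) : 'E (fun w => (c * X w + 1) ^+ 2) = c ^+ 2 * 'E (fun w => X w ^+ 2) + (2 * c * 'E X + 1).
  rewrite -(RintegralZl (c ^+ 2) measurableT iX2) -(RintegralZl (2 * c) measurableT iX).
  have j1 := integrableZlR (2 * c) iX; have j2 := integrableZlR (c ^+ 2) iX2.
  rewrite -[X in _ = _ + (_ + X)]E1 -(RintegralD measurableT j1 i1).
  rewrite -(RintegralD measurableT j2 (integrableDR j1 i1)).
  by apply: eq_Rintegral => w _; ring.
have E3 : 'E (fun w => (-1 * X w + 1) ^+ 2) = 'E (fun w => (1 * X w + 1) ^+ 2).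
  rewrite /Rintegral; congr fine.
  transitivity (\int[P]_w ((- X w + 1) ^+ 2)%:E)%E.
    by apply: eq_integral => w _; rewrite mulN1r.
  by rewrite H; apply: eq_integral => w _; rewrite mul1r.
by move: E3; rewrite !E2; set a := 'E X; lra.
Qed.

Definition normal_mean (s : R) (f : R -> R) : R := \int[normal_prob 0 s]_x f x.

Let cos_conv_normal_mean (a b c : R) :
  a != 0 -> b != 0 -> c != 0 -> c ^+ 2 = a ^+ 2 + b ^+ 2 ->
  normal_mean c cos = normal_mean a cos * normal_mean b cos - normal_mean a sin * normal_mean b sin.
Proof. exact: cos_conv_normal. Qed.

(* The value exp(- q / 2) is not needed, only multiplicativity in q. *)
Definition gauss_char (q : R) : R :=
  if q == 0 then 1 else normal_mean (Num.sqrt q) cos.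

Let itrig (m : probability (measurableTypeR R) R) (f : R -> R) : measurable_fun setT f ->
  (forall x, `|f x| <= 1) -> m.-integrable setT (EFin \o f).
Proof. by move=> mf f1; exact: (@bounded_integrable _ _ _ _ _ 1). Qed.

Let trig1 (x : R) : `|cos x| <= 1 /\ `|sin x| <= 1.
Proof. by rewrite !ler_norml cos_geN1 cos_le1 sin_geN1 sin_le1. Qed.

Let bounded_law (f : R -> R) X : G X -> measurable_fun setT f -> (forall x, `|f x| <= 1) ->
  'E (fun w => f (X w)) = if ip X X == 0 then f 0 else normal_mean (Num.sqrt (ip X X)) f.
Proof.
move=> GX mf f1.
have f0 (x : R) : 0 <= 1 + f x by have := f1 x; rewrite ler_norml => /andP[]; lra.
have mF : measurable_fun setT (fun x => (1 + f x)%:E) by apply: measurable_fun_EFin; exact: measurable_funD.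
have := @gs_law X (fun x => (1 + f x)%:E) GX mF (fun x => _).
move=> /(_ (fun x => (f0 x : (0 <= (1 + f x)%:E)%E))) H.
have ifX : P.-integrable setT (EFin \o (fun w => f (X w))).
  apply: (@bounded_integrable _ _ _ _ _ 1) => //.
  by apply: measurableT_comp => //; exact: gs_measurable.
move: H; rewrite (EFin_Rintegral (integrableDR i1 ifX)) (RintegralD measurableT i1 ifX).
rewrite -/('E (fun=> 1)) E1.
case: eqVneq => [_|q0]; first by case=> /addrI.
rewrite /normal_mean.
set N := normal_prob 0 _.
have j1 : (N : probability _ _).-integrable setT (EFin \o (fun=> 1 : R)).
  by apply: itrig => // x; rewrite normr1.
have jf : (N : probability _ _).-integrable setT (EFin \o f) by exact: itrig.
rewrite (EFin_Rintegral (integrableDR j1 jf)) (RintegralD measurableT j1 jf).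
by rewrite Rintegral_cst//= probability_setT/= mulr1 => -[/addrI].
Qed.

Lemma gs_cos X : G X -> 'E (fun w => cos (X w)) = gauss_char (ip X X).
Proof.
move=> GX; rewrite (bounded_law GX (@measurable_cos R)) /gauss_char ?cos0// => x.
exact: (trig1 x).1.
Qed.

Lemma gs_sin X : G X -> 'E (fun w => sin (X w)) = 0.
Proof.
move=> GX.
have H Y : G Y -> 'E (fun w => sin (Y w)) = if ip Y Y == 0 then sin 0 else normal_mean (Num.sqrt (ip Y Y)) sin.
  by move=> GY; rewrite (bounded_law GY (@measurable_sin R)) // => x; exact: (trig1 x).2.
have H2 := H _ (gsN GX); have H1 := H _ GX.
have qN : ip (fun w => - X w) (fun w => - X w) = ip X X.
  by apply: eq_Rintegral => w _; rewrite mulrNN.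
move: H2; rewrite qN -H1 => H3.
have is1 : P.-integrable setT (EFin \o (fun w => sin (X w))).
  apply: (@bounded_integrable _ _ _ _ _ 1) => [|w]; last exact: (trig1 _).2.
  by apply: measurableT_comp; [exact: measurable_sin|exact: gs_measurable].
have : 'E (fun w => sin (- X w)) = - 1 * 'E (fun w => sin (X w)).
  by rewrite -(RintegralZl _ measurableT is1); apply: eq_Rintegral => w _; rewrite sinN mulN1r.
by rewrite H3 mulN1r => /eqP; rewrite -addr_eq0 -mulr2n mulrn_eq0/= => /eqP.
Qed.

Lemma gauss_charD X Y : G X -> G Y -> gauss_char (ip X X + ip Y Y) = gauss_char (ip X X) * gauss_char (ip Y Y).
Proof.
move=> GX GY; rewrite /gauss_char; have qX := ip_ge0 X; have qY := ip_ge0 Y.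
case: (eqVneq (ip X X) 0) => [->|x0]; first by rewrite add0r mul1r.
case: (eqVneq (ip Y Y) 0) => [->|y0]; first by rewrite addr0 mulr1 (negbTE x0).
have xp : 0 < ip X X by rewrite lt_neqAle eq_sym x0.
have yp : 0 < ip Y Y by rewrite lt_neqAle eq_sym y0.
rewrite gt_eqF ?addr_gt0//.
have sx : Num.sqrt (ip X X) != 0 by rewrite gt_eqF// sqrtr_gt0.
have sy : Num.sqrt (ip Y Y) != 0 by rewrite gt_eqF// sqrtr_gt0.
have sxy : Num.sqrt (ip X X + ip Y Y) != 0 by rewrite gt_eqF// sqrtr_gt0 addr_gt0.
have sE : Num.sqrt (ip X X + ip Y Y) ^+ 2 = Num.sqrt (ip X X) ^+ 2 + Num.sqrt (ip Y Y) ^+ 2.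
  by rewrite !sqr_sqrtr// addr_ge0.
rewrite (cos_conv_normal_mean sx sy sxy sE).
have := gs_sin GX; rewrite (bounded_law GX (@measurable_sin R)); last by move=> x; exact: (trig1 x).2.
by rewrite (negbTE x0) => ->; rewrite mul0r subr0.
Qed.

Section independence.
Variable zeta : T -> R.
Hypothesis Gz : G zeta.

Definition orth (V : T -> R) := G V /\ ip zeta V = 0.

Lemma orthZD a U V : orth U -> orth V -> orth (fun w => a * U w + V w).
Proof.
move=> [GU U0] [GV V0]; split; first exact: gsZD.
by rewrite ipC ipZDl// [ip U _]ipC [ip V _]ipC U0 V0 mulr0 addr0.
Qed.

Lemma orth0 : orth (fun=> 0).
Proof.
split; first exact: gs0; rewrite /ip; under eq_Rintegral do rewrite mulr0.
by rewrite /Rintegral integral0.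
Qed.

Let orth_norm a V : orth V -> ip (fun w => a * zeta w + V w) (fun w => a * zeta w + V w) =
  ip (fun w => a * zeta w) (fun w => a * zeta w) + ip V V.
Proof.
move=> [GV V0].
have E : (fun w => a * zeta w + V w) = (fun w => a * zeta w + 1 * V w).
  by apply/funext => w; rewrite mul1r.
have E' : (fun w => a * zeta w) = (fun w => a * zeta w + 0 * V w).
  by apply/funext => w; rewrite mul0r addr0.
by rewrite E E' !ip_comb// V0; ring.
Qed.

(* Replaces the independence of [zeta] and the variables orthogonal to it, so
   that no joint density is ever computed. *)
Definition annihilates (W : T -> R) := P.-integrable setT (EFin \o W) /\
  forall V, orth V -> 'E (fun w => W w * cos (V w)) = 0 /\ 'E (fun w => W w * sin (V w)) = 0.

Let mtrig V : G V -> measurable_fun setT (fun w => cos (V w)) /\ measurable_fun setT (fun w => sin (V w)).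
Proof.
move=> GV; split; apply: measurableT_comp; [exact: measurable_cos|exact: gs_measurable|
  exact: measurable_sin|exact: gs_measurable].
Qed.

Let itrigP V : G V -> P.-integrable setT (EFin \o (fun w => cos (V w))) /\
  P.-integrable setT (EFin \o (fun w => sin (V w))).
Proof.
move=> /mtrig[mc ms]; split; apply: (@bounded_integrable _ _ _ _ _ 1) => // w.
  exact: (trig1 _).1.
exact: (trig1 _).2.
Qed.

Let iWtrig W V : P.-integrable setT (EFin \o W) -> G V ->
  P.-integrable setT (EFin \o (fun w => W w * cos (V w))) /\
  P.-integrable setT (EFin \o (fun w => W w * sin (V w))).
Proof.
move=> iW /mtrig[mc ms]; split; apply: (@integrable_mul_bounded _ _ _ _ _ _ 1 iW) => // w.
  exact: (trig1 _).1.
exact: (trig1 _).2.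
Qed.

Lemma trig_product a V : orth V ->
  [/\ 'E (fun w => cos (V w) * cos (a * zeta w)) = 'E (fun w => cos (V w)) * 'E (fun w => cos (a * zeta w)),
      'E (fun w => cos (V w) * sin (a * zeta w)) = 0,
      'E (fun w => sin (V w) * cos (a * zeta w)) = 0 &
      'E (fun w => sin (V w) * sin (a * zeta w)) = 0].
Proof.
move=> oV; have [GV V0] := oV; have Ga := gsZ a Gz.
have GS := gsD Ga GV; have GD := gsD (gsN Ga) GV.
have GD' : G (fun w => - a * zeta w + V w) by exact: gsZD.
have eD : (fun w => - (a * zeta w) + V w) = (fun w => - a * zeta w + V w).
  by apply/funext => w; rewrite mulNr.
have [cS sS] := itrigP GS; have [cD sD] := itrigP GD.
have qS : ip (fun w => a * zeta w + V w) (fun w => a * zeta w + V w) = ip V V + ip (fun w => a * zeta w) (fun w => a * zeta w).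
  by rewrite orth_norm// addrC.
have qD : ip (fun w => - (a * zeta w) + V w) (fun w => - (a * zeta w) + V w) = ip V V + ip (fun w => a * zeta w) (fun w => a * zeta w).
  rewrite eD orth_norm// addrC; congr (_ + _).
  by apply: eq_Rintegral => w _; ring.
split.
- rewrite gs_cos// gs_cos// -gauss_charD//.
  transitivity (2^-1 * ('E (fun w => cos (a * zeta w + V w)) + 'E (fun w => cos (- (a * zeta w) + V w)))).
    rewrite -(RintegralD measurableT cS cD) -(RintegralZl _ measurableT (integrableDR cS cD)).
    by apply: eq_Rintegral => w _; rewrite !cosD cosN sinN; field.
  by rewrite !gs_cos// qS qD; field.
- transitivity (2^-1 * ('E (fun w => sin (a * zeta w + V w)) - 'E (fun w => sin (- (a * zeta w) + V w)))).
    rewrite -(RintegralB measurableT sS sD) -(RintegralZl _ measurableT (integrableBR sS sD)).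
    by apply: eq_Rintegral => w _; rewrite !sinD cosN sinN; field.
  by rewrite !gs_sin// subr0 mulr0.
- transitivity (2^-1 * ('E (fun w => sin (a * zeta w + V w)) + 'E (fun w => sin (- (a * zeta w) + V w)))).
    rewrite -(RintegralD measurableT sS sD) -(RintegralZl _ measurableT (integrableDR sS sD)).
    by apply: eq_Rintegral => w _; rewrite !sinD cosN sinN; field.
  by rewrite !gs_sin// addr0 mulr0.
- transitivity (2^-1 * ('E (fun w => cos (- (a * zeta w) + V w)) - 'E (fun w => cos (a * zeta w + V w)))).
    rewrite -(RintegralB measurableT cD cS) -(RintegralZl _ measurableT (integrableBR cD cS)).
    by apply: eq_Rintegral => w _; rewrite !cosD cosN sinN; field.
  by rewrite !gs_cos// qS qD subrr mulr0.
Qed.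

Lemma annihilates_fun (F : R -> R) : measurable_fun setT F ->
  P.-integrable setT (EFin \o (fun w => F (zeta w))) -> 'E (fun w => F (zeta w)) = 0 ->
  annihilates (fun w => F (zeta w)).
Proof.
move=> mF iF F0; split => // V oV; have [GV _] := oV.
have [cV sV] := itrigP GV; have mz := gs_measurable Gz.
have [iFc iFs] := iWtrig iF GV.
split.
- set c := 'E (fun w => cos (V w)).
  have ic := integrableBR cV (integrableZlR c i1).
  have key : 'E (fun w => (cos (V w) - c * 1) * F (zeta w)) = 0.
    apply: (@fun_annihilated _ _ _ P (fun w => cos (V w) - c * 1) zeta) => //.
    + move=> a; have [E _ _ _] := trig_product a oV.
      have [ca _] := itrigP (gsZ a Gz).
      transitivity ('E (fun w => cos (V w) * cos (a * zeta w)) - c * 'E (fun w => cos (a * zeta w))).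
        rewrite -(RintegralZl _ measurableT ca).
        rewrite -(RintegralB measurableT (iWtrig cV (gsZ a Gz)).1 (integrableZlR c ca)).
        by apply: eq_Rintegral => w _; ring.
      by rewrite E subrr.
    + move=> a; have [_ E _ _] := trig_product a oV.
      have [_ sa] := itrigP (gsZ a Gz).
      transitivity ('E (fun w => cos (V w) * sin (a * zeta w)) - c * 'E (fun w => sin (a * zeta w))).
        rewrite -(RintegralZl _ measurableT sa).
        rewrite -(RintegralB measurableT (iWtrig cV (gsZ a Gz)).2 (integrableZlR c sa)).
        by apply: eq_Rintegral => w _; ring.
      by rewrite E gs_sin ?mulr0 ?subr0//; exact: gsZ.
    + have -> : (fun w => (cos (V w) - c * 1) * F (zeta w)) = (fun w => F (zeta w) * cos (V w) - c * F (zeta w)).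
        by apply/funext => w; ring.
      exact: (integrableBR iFc (integrableZlR c iF)).
  transitivity ('E (fun w => (cos (V w) - c * 1) * F (zeta w)) + c * 'E (fun w => F (zeta w))).
    rewrite -(RintegralZl _ measurableT iF).
    have -> : (fun w => (cos (V w) - c * 1) * F (zeta w)) = (fun w => F (zeta w) * cos (V w) - c * F (zeta w)).
      by apply/funext => w; ring.
    rewrite -(RintegralD measurableT (integrableBR iFc (integrableZlR c iF)) (integrableZlR c iF)).
    by apply: eq_Rintegral => w _; ring.
  by rewrite key F0 mulr0 addr0.
- under eq_Rintegral do rewrite mulrC.
  apply: (@fun_annihilated _ _ _ P (fun w => sin (V w)) zeta) => //.
  + by move=> a; have [_ _ E _] := trig_product a oV.
  + by move=> a; have [_ _ _ E] := trig_product a oV.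
  + by under eq_fun do rewrite mulrC.
Qed.

Lemma annihilates_mul W V (F : R -> R) : annihilates W -> orth V -> measurable_fun setT F ->
  P.-integrable setT (EFin \o (fun w => W w * F (V w))) ->
  annihilates (fun w => W w * F (V w)).
Proof.
move=> [iW aW] oV mF iWF; have [GV _] := oV; split => // U oU; have [GU _] := oU.
have mV := gs_measurable GV.
have oS a : orth (fun w => a * V w + U w) by exact: orthZD.
have oD a : orth (fun w => - a * V w + U w) by exact: orthZD.
have [iWc iWs] := iWtrig iW GU.
have iWS a := iWtrig iW (oS a).1; have iWD a := iWtrig iW (oD a).1.
split.
- transitivity ('E (fun w => (W w * cos (U w)) * F (V w))); first by apply: eq_Rintegral => w _; ring.
  apply: (@fun_annihilated _ _ _ P (fun w => W w * cos (U w)) V) => //.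
  + move=> a; transitivity (2^-1 * ('E (fun w => W w * cos (a * V w + U w)) + 'E (fun w => W w * cos (- a * V w + U w)))).
      rewrite -(RintegralD measurableT (iWS a).1 (iWD a).1).
      rewrite -(RintegralZl _ measurableT (integrableDR (iWS a).1 (iWD a).1)).
      by apply: eq_Rintegral => w _; rewrite !cosD mulNr cosN sinN; field.
    by rewrite (aW _ (oS a)).1 (aW _ (oD a)).1 addr0 mulr0.
  + move=> a; transitivity (2^-1 * ('E (fun w => W w * sin (a * V w + U w)) - 'E (fun w => W w * sin (- a * V w + U w)))).
      rewrite -(RintegralB measurableT (iWS a).2 (iWD a).2).
      rewrite -(RintegralZl _ measurableT (integrableBR (iWS a).2 (iWD a).2)).
      by apply: eq_Rintegral => w _; rewrite !sinD mulNr cosN sinN; field.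
    by rewrite (aW _ (oS a)).2 (aW _ (oD a)).2 subr0 mulr0.
  + by have [h _] := iWtrig iWF GU; under eq_fun do rewrite mulrAC.
- transitivity ('E (fun w => (W w * sin (U w)) * F (V w))); first by apply: eq_Rintegral => w _; ring.
  apply: (@fun_annihilated _ _ _ P (fun w => W w * sin (U w)) V) => //.
  + move=> a; transitivity (2^-1 * ('E (fun w => W w * sin (a * V w + U w)) + 'E (fun w => W w * sin (- a * V w + U w)))).
      rewrite -(RintegralD measurableT (iWS a).2 (iWD a).2).
      rewrite -(RintegralZl _ measurableT (integrableDR (iWS a).2 (iWD a).2)).
      by apply: eq_Rintegral => w _; rewrite !sinD mulNr cosN sinN; field.
    by rewrite (aW _ (oS a)).2 (aW _ (oD a)).2 addr0 mulr0.
  + move=> a; transitivity (2^-1 * ('E (fun w => W w * cos (- a * V w + U w)) - 'E (fun w => W w * cos (a * V w + U w)))).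
      rewrite -(RintegralB measurableT (iWD a).1 (iWS a).1).
      rewrite -(RintegralZl _ measurableT (integrableBR (iWD a).1 (iWS a).1)).
      by apply: eq_Rintegral => w _; rewrite !cosD mulNr cosN sinN; field.
    by rewrite (aW _ (oS a)).1 (aW _ (oD a)).1 subr0 mulr0.
  + by have [_ h] := iWtrig iWF GU; under eq_fun do rewrite mulrAC.
Qed.

Lemma annihilates_mean0 W : annihilates W -> 'E W = 0.
Proof.
move=> [_ /(_ _ orth0)[+ _]] => <-; apply: eq_Rintegral => w _.
by rewrite cos0 mulr1.
Qed.

End independence.

(* Closed under products, which keeps every integrability side condition at the
   level of exponential moments. *)
Inductive expsum : (T -> R) -> Prop :=
| expsum_exp c X : 0 <= c -> G X -> expsum (fun w => c * expR (X w))
| expsum_add f g : expsum f -> expsum g -> expsum (fun w => f w + g w).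

Lemma expsum_integrable f : expsum f -> P.-integrable setT (EFin \o f).
Proof.
by elim=> [c X c0 GX|g h _ ig _ ih]; [exact/integrableZlR/gs_integrable_expR|exact: integrableDR].
Qed.

Lemma expsum_mul f g : expsum f -> expsum g -> expsum (fun w => f w * g w).
Proof.
move=> sf; elim: sf g => [c X c0 GX|f1 f2 _ IH1 _ IH2] g sg; last first.
  have -> : (fun w => (f1 w + f2 w) * g w) = (fun w => f1 w * g w + f2 w * g w).
    by apply/funext => w; rewrite mulrDl.
  by apply: expsum_add; [exact: IH1|exact: IH2].
elim: sg => [a Y a0 GY|g1 g2 _ IH1 _ IH2].
  have -> : (fun w => c * expR (X w) * (a * expR (Y w))) = (fun w => (c * a) * expR (X w + Y w)).
    by apply/funext => w; rewrite expRD; ring.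
  by apply: expsum_exp; [exact: mulr_ge0|exact: gsD].
have -> : (fun w => c * expR (X w) * (g1 w + g2 w)) =
    (fun w => c * expR (X w) * g1 w + c * expR (X w) * g2 w).
  by apply/funext => w; rewrite mulrDr.
exact: expsum_add.
Qed.

Definition expbdd (W : T -> R) := measurable_fun setT W /\
  exists2 f, expsum f & forall w, `|W w| <= f w.

Lemma expbdd_integrable W : expbdd W -> P.-integrable setT (EFin \o W).
Proof.
move=> [mW [f sf Wf]]; apply: (le_integrable measurableT _ _ (expsum_integrable sf)).
  exact: measurable_fun_EFin.
by move=> w _; rewrite /= lee_fin (le_trans (Wf w))// ler_norm.
Qed.

Lemma expbddM U V : expbdd U -> expbdd V -> expbdd (fun w => U w * V w).
Proof.
move=> [mU [f sf Uf]] [mV [g sg Vg]]; split; first exact: measurable_funM.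
exists (fun w => f w * g w); first exact: expsum_mul.
by move=> w; rewrite normrM ler_pM.
Qed.

Lemma expbddD U V : expbdd U -> expbdd V -> expbdd (fun w => U w + V w).
Proof.
move=> [mU [f sf Uf]] [mV [g sg Vg]]; split; first exact: measurable_funD.
exists (fun w => f w + g w); first exact: expsum_add.
by move=> w; rewrite (le_trans (ler_normD _ _))// lerD.
Qed.

Definition expgrowth (F : R -> R) := measurable_fun setT F /\
  exists C c : R, 0 <= C /\ forall v, `|F v| <= C * (expR (c * v) + expR (- (c * v))).

Lemma expbdd_fun V F : G V -> expgrowth F -> expbdd (fun w => F (V w)).
Proof.
move=> GV [mF [C [c [C0 FC]]]]; split.
  by apply: measurableT_comp => //; exact: gs_measurable.
exists (fun w => C * expR (c * V w) + C * expR (- c * V w)); last first.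
  by move=> w; rewrite -mulrDr mulNr.
by apply: expsum_add; apply: expsum_exp => //; exact: gsZ.
Qed.

Lemma expgrowthD F H : expgrowth F -> expgrowth H -> expgrowth (fun v => F v + H v).
Proof.
move=> [mF [C [c [C0 FC]]]] [mH [D [e [D0 HD]]]]; split; first exact: measurable_funD.
exists (C + D), (`|c| + `|e|); split; first exact: addr_ge0.
have mono (a b v : R) : 0 <= b -> `|a| <= b -> expR (a * v) + expR (- (a * v)) <= expR (b * v) + expR (- (b * v)).
  move=> b0 ab; have key (x y : R) : `|x| <= y -> expR x + expR (- x) <= expR y + expR (- y).
    wlog x0 : x / 0 <= x => [W|] xy.
      have [x0|x0] := leP 0 x; first exact: W.
      by rewrite addrC -{2}[x]opprK; apply: W; rewrite ?normrN// oppr_ge0 ltW.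
    rewrite ger0_norm// in xy; have ex := expR_gt0 x; have ey := expR_gt0 y.
    rewrite !expRN -subr_ge0.
    have -> : expR y + (expR y)^-1 - (expR x + (expR x)^-1) =
       (expR y - expR x) * (1 - (expR x * expR y)^-1).
      by field; rewrite !gt_eqF.
    rewrite mulr_ge0// subr_ge0 ?ler_expR// invf_le1 ?mulr_gt0//.
    by rewrite -expRD -[leLHS]expR0 ler_expR addr_ge0// (le_trans x0).
  have [v0|v0] := leP 0 v.
    by apply: key; rewrite normrM (ger0_norm v0) ler_wpM2r.
  have vn : 0 <= - v by rewrite oppr_ge0 ltW.
  rewrite addrC [leRHS]addrC -{1}mulrN -{1}(mulrN b) -[a * v]opprK -[b * v]opprK -mulrN -(mulrN b).
  by apply: key; rewrite normrM (ger0_norm vn) ler_wpM2r.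
move=> v; rewrite (le_trans (ler_normD _ _))// mulrDl lerD//.
  rewrite (le_trans (FC v))// ler_wpM2l// mono ?addr_ge0// lerDl.
  exact: normr_ge0.
by rewrite (le_trans (HD v))// ler_wpM2l// mono ?addr_ge0// lerDr.
Qed.

Lemma expgrowth_bounded (F : R -> R) : measurable_fun setT F -> (forall v, `|F v| <= 1) -> expgrowth F.
Proof.
move=> mF F1; split => //; exists 1, 0; split => // v.
by rewrite mul0r oppr0 expR0 mul1r (le_trans (F1 v))// lerDl.
Qed.

Lemma norm_le_expR2 (x : R) : `|x| <= expR x + expR (- x).
Proof.
have h1 := expR_ge1Dx x; have h2 := expR_ge1Dx (- x).
have h3 := expR_gt0 x; have h4 := expR_gt0 (- x).
by rewrite ler_norml; apply/andP; split; lra.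
Qed.

(** * The derivative density of one Gaussian variable *)

Definition dens (g v z : R) : R := (- z + g * v) * expR (g * z - g ^+ 2 / 2 * v).

Lemma measurable_dens g v : measurable_fun setT (dens g v).
Proof.
apply: measurable_funM; first by apply: measurable_funD => //; exact: measurable_funN.
apply: (measurableT_comp (f := @expR R)) => //.
by apply: measurable_funB => //; exact: measurable_funM.
Qed.

Lemma expgrowth_dens g v : expgrowth (dens g v).
Proof.
split; first exact: measurable_dens.
pose A := expR (- (g ^+ 2 / 2 * v)) * (1 + `|g * v|).
exists (2 * A), (`|g| + 1); split.
  by rewrite mulr_ge0// mulr_ge0 ?expR_ge0// addr_ge0.
move=> z; rewrite /dens normrM (ger0_norm (expR_ge0 _)) expRD.
have ez : expR (g * z) <= expR (`|g| * `|z|) by rewrite ler_expR -normrM ler_norm.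
have e1 : 1 <= expR `|z| by rewrite -[leLHS]expR0 ler_expR.
have hz : `|- z + g * v| <= (1 + `|g * v|) * expR `|z|.
  rewrite (le_trans (ler_normD _ _))// normrN mulrDl mul1r lerD//.
    by have := expR_ge1Dx `|z|; lra.
  by rewrite ler_peMr.
have hE : expR (`|z| + `|g| * `|z|) <= expR ((`|g| + 1) * z) + expR (- ((`|g| + 1) * z)).
  have -> : `|z| + `|g| * `|z| = (`|g| + 1) * `|z| by ring.
  have a0 := expR_gt0 ((`|g| + 1) * z); have b0 := expR_gt0 (- ((`|g| + 1) * z)).
  have [z0|z0] := leP 0 z; first by rewrite (ger0_norm z0); lra.
  by rewrite (ltr0_norm z0) mulrN; lra.
have P1 : `|- z + g * v| * expR (g * z) <= (1 + `|g * v|) * expR (`|z| + `|g| * `|z|).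
  by rewrite expRD mulrA ler_pM ?expR_ge0.
have P2 : `|- z + g * v| * expR (g * z) <= (1 + `|g * v|) * (expR ((`|g| + 1) * z) + expR (- ((`|g| + 1) * z))).
  by rewrite (le_trans P1)// ler_wpM2l// addr_ge0.
rewrite /A; set E := expR (- (g ^+ 2 / 2 * v)); set S := _ + expR _ in P2 *.
have E0 : 0 <= E := expR_ge0 _.
have K0 : 0 <= (1 + `|g * v|) * S by rewrite mulr_ge0 ?addr_ge0 ?expR_ge0.
by rewrite [leLHS]mulrA; move: P2 K0; move: (`|- z + g * v| * _) (`|g * v|) => a b P2 K0;
  have := ler_wpM2r E0 P2; have := mulr_ge0 E0 K0; lra.
Qed.

Lemma annihilates_expbdd zeta W V F : G zeta -> expbdd W /\ annihilates zeta W ->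
  orth zeta V -> expgrowth F ->
  expbdd (fun w => W w * F (V w)) /\ annihilates zeta (fun w => W w * F (V w)).
Proof.
move=> Gz [eW aW] oV gF; have eWF := expbddM eW (expbdd_fun oV.1 gF).
by split => //; apply: annihilates_mul => //; [case: gF|exact: expbdd_integrable].
Qed.

Lemma tilt_integrable X : G X -> P.-integrable setT (EFin \o (fun w => (X w - ip X X) ^+ 2 * expR (X w - ip X X / 2))) /\
  P.-integrable setT (EFin \o (fun w => expR (X w - ip X X / 2))).
Proof.
move=> GX.
have e1 : expbdd (fun w => expR (X w - ip X X / 2)).
  split; first by apply: (measurableT_comp (f := @expR R)) => //; apply: measurable_funB => //; exact: gs_measurable.
  exists (fun w => expR (- (ip X X / 2)) * expR (X w)); first by apply: expsum_exp => //; exact: expR_ge0.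
  by move=> w; rewrite ger0_norm ?expR_ge0// -expRD addrC.
have e2 : expbdd (fun w => - X w + ip X X).
  have gF : expgrowth (fun z => - z + ip X X).
    split; first by apply: measurable_funD => //; exact: measurable_funN.
    exists (1 + `|ip X X|), 1; split; first exact: addr_ge0.
    move=> z; rewrite mul1r (le_trans (ler_normD _ _))// normrN.
    have h := norm_le_expR2 z; have h1 := expR_ge1Dx z; have h2 := expR_ge1Dx (- z).
    by have := normr_ge0 (ip X X); nra.
  exact: (expbdd_fun GX gF).
split; last exact: expbdd_integrable.
have -> : (fun w => (X w - ip X X) ^+ 2 * expR (X w - ip X X / 2)) =
  (fun w => (- X w + ip X X) * (- X w + ip X X) * expR (X w - ip X X / 2)).
  by apply/funext => w; ring.
by apply: expbdd_integrable; apply: expbddM => //; exact: expbddM.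
Qed.

Lemma gs_tilt (f : R -> R) X : G X -> continuous f -> (forall x, 0 <= f x) ->
  'E (fun w => f (X w) * expR (X w - ip X X / 2)) = 'E (fun w => f (X w + ip X X)).
Proof. by move=> GX cf f0; rewrite /Rintegral; congr fine; exact: gs_girsanov. Qed.

Let csqr (c : R) : continuous (fun x : R => (x - c) ^+ 2).
Proof.
move=> x; apply: (cvg_comp (fun x => x - c) (fun x => x ^+ 2)).
  by apply: (@cvgB _ R^o) => //; [exact: cvg_id|exact: cvg_cst].
exact: sqr_continuous.
Qed.

Lemma tilt_mass X : G X -> 'E (fun w => expR (X w - ip X X / 2)) = 1.
Proof.
move=> GX; rewrite -[RHS]E1 -[RHS](gs_tilt (f := fun=> 1) GX)//; last exact: cst_continuous.
by apply: eq_Rintegral => w _; rewrite mul1r.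
Qed.

Lemma tilt_var X : G X -> 'E (fun w => (X w - ip X X) ^+ 2 * expR (X w - ip X X / 2)) = ip X X.
Proof.
move=> GX; rewrite (gs_tilt (f := fun x => (x - ip X X) ^+ 2) GX (@csqr _)); last by move=> x; exact: sqr_ge0.
by apply: eq_Rintegral => w _; rewrite addrK expr2.
Qed.

Lemma tilt_mean0 X : G X -> 'E (fun w => (X w - ip X X) * expR (X w - ip X X / 2)) = 0.
Proof.
move=> GX; set q := ip X X; have [i2 i0] := tilt_integrable GX.
have iX := gs_integrable GX; have iX2 := gs_integrable_sqr GX.
have H := gs_tilt (f := fun x => (x - (q - 1)) ^+ 2) GX (@csqr _) (fun x => sqr_ge0 _).
have E2 : 'E (fun w => (X w + q - (q - 1)) ^+ 2) = q + 1.
  transitivity ('E (fun w => X w ^+ 2) + (2 * 'E X + 'E (fun=> 1))).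
    rewrite -(RintegralZl 2 measurableT iX) -(RintegralD measurableT (integrableZlR 2 iX) i1).
    rewrite -(RintegralD measurableT iX2 (integrableDR (integrableZlR 2 iX) i1)).
    by apply: eq_Rintegral => w _; ring.
  have -> : 'E (fun w => X w ^+ 2) = q by apply: eq_Rintegral => w _; rewrite expr2.
  by rewrite (gs_mean0 GX) mulr0 add0r (_ : \int[P]_w (1 : R) = 1)//; exact: E1.
have i4 : P.-integrable setT (EFin \o (fun w => (X w - (q - 1)) ^+ 2 * expR (X w - q / 2))).
  have h := integrableDR (integrableZlR 2 i2) (integrableZlR 2 i0).
  apply: (le_integrable measurableT _ _ h).
    apply: measurable_fun_EFin; apply: measurable_funM.
      by apply: measurable_funX; apply: measurable_funB => //; exact: gs_measurable.
    by apply: (measurableT_comp (f := @expR R)) => //; apply: measurable_funB => //; exact: gs_measurable.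
  move=> w _; rewrite /= lee_fin -/q; have e0 := expR_ge0 (X w - q / 2).
  rewrite ger0_norm; last by rewrite mulr_ge0 ?sqr_ge0.
  apply: le_trans (ler_norm _).
  by have := mulr_ge0 (sqr_ge0 (X w - q - 1)) e0; rewrite !expr2; lra.
have -> : 'E (fun w => (X w - q) * expR (X w - q / 2)) =
  2^-1 * ('E (fun w => (X w - (q - 1)) ^+ 2 * expR (X w - q / 2)) -
    'E (fun w => (X w - q) ^+ 2 * expR (X w - q / 2)) - 'E (fun w => expR (X w - q / 2))).
  rewrite -(RintegralB measurableT i4 i2) -(RintegralB measurableT (integrableBR i4 i2) i0).
  rewrite -(RintegralZl _ measurableT (integrableBR (integrableBR i4 i2) i0)).
  by apply: eq_Rintegral => w _; rewrite -/q; set e := expR _; field.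
by rewrite H E2 tilt_var// tilt_mass// -/q; field.
Qed.

Section dens_estimates.
Variable g : R.
Hypothesis g0 : 0 < g.

Let gn0 : g != 0. Proof. by rewrite gt_eqF. Qed.

Let ip_g Z : G Z -> ip (fun w => g * Z w) (fun w => g * Z w) = g ^+ 2 * ip Z Z.
Proof. by move=> GZ; rewrite ipZl// ?[ip Z _]ipC ?ipZl// ?mulrA ?expr2//; exact: gsZ. Qed.

Let tiltE Z w : G Z -> expR (g * Z w - ip (fun w => g * Z w) (fun w => g * Z w) / 2) =
  expR (g * Z w - g ^+ 2 / 2 * ip Z Z).
Proof. by move=> GZ; rewrite ip_g//; congr expR; field. Qed.

Lemma dens_mean0 Z : G Z -> 'E (fun w => dens g (ip Z Z) (Z w)) = 0.
Proof.
move=> GZ; have GgZ := gsZ g GZ.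
transitivity (- g^-1 * 'E (fun w => (g * Z w - ip (fun w => g * Z w) (fun w => g * Z w)) *
    expR (g * Z w - ip (fun w => g * Z w) (fun w => g * Z w) / 2))); last by rewrite tilt_mean0// mulr0.
rewrite -RintegralZl//.
  by apply: eq_Rintegral => w _; rewrite tiltE// ip_g// /dens; field.
have -> : (fun w => (g * Z w - ip (fun w => g * Z w) (fun w => g * Z w)) *
    expR (g * Z w - ip (fun w => g * Z w) (fun w => g * Z w) / 2)) = (fun w => - g * dens g (ip Z Z) (Z w)).
  by apply/funext => w; rewrite tiltE// ip_g// /dens; field.
apply: integrableZlR; apply: expbdd_integrable; apply: expbdd_fun => //.
exact: expgrowth_dens.
Qed.

Lemma dens_orthogonal zeta Z S S' A B (F F' f h : R -> R) (v : R) : G zeta ->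
  orth zeta Z -> orth zeta S -> orth zeta S' -> orth zeta A -> orth zeta B ->
  expgrowth F -> expgrowth F' -> expgrowth f -> expgrowth h ->
  'E (fun w => (dens g (v + ip zeta zeta) (Z w + zeta w) - dens g v (Z w)) * F (S w) *
    ((f (A w) - h (B w)) * F' (S' w))) = 0.
Proof.
move=> Gz oZ oS oS' oA oB gF gF' gf gh; set q := ip zeta zeta.
pose a1 (z : R) := expR (g * z - g ^+ 2 / 2 * q) - 1.
pose f2 (z : R) := expR (g * z - g ^+ 2 / 2 * v).
have gexp c : expgrowth (fun z => expR (g * z - c)).
  split.
    apply: (measurableT_comp (f := @expR R)) => //.
    by apply: measurable_funB => //; exact: measurable_funM.
  exists (expR (- c)), g; split; first exact: expR_ge0.
  move=> z; rewrite ger0_norm ?expR_ge0// expRD mulrC ler_wpM2l ?expR_ge0//.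
  by rewrite lerDl expR_ge0.
have ga1 : expgrowth a1.
  apply: expgrowthD; first exact: gexp.
  by apply: expgrowth_bounded => // z; rewrite normrN1.
have a10 : 'E (fun w => a1 (zeta w)) = 0.
  have ie : P.-integrable setT (EFin \o (fun w => expR (g * zeta w - g ^+ 2 / 2 * q))).
    by apply: expbdd_integrable; apply: (expbdd_fun Gz (gexp _)).
  rewrite (RintegralB measurableT ie i1) (_ : \int[P]_w (1 : R) = 1); last exact: E1.
  have := tilt_mass (gsZ g Gz); under eq_Rintegral do rewrite tiltE//.
  by rewrite -/q => ->; rewrite subrr.
have ann F0 : expgrowth F0 -> 'E (fun w => F0 (zeta w)) = 0 ->
    expbdd (fun w => F0 (zeta w)) /\ annihilates zeta (fun w => F0 (zeta w)).
  move=> gF0 E0; have e0 := expbdd_fun Gz gF0; split => //.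
  by apply: annihilates_fun => //; [case: gF0|exact: expbdd_integrable].
have term F0 K L W : expgrowth F0 -> 'E (fun w => F0 (zeta w)) = 0 -> expgrowth K -> expgrowth L -> orth zeta W ->
   expbdd (fun w => F0 (zeta w) * K (Z w) * F (S w) * L (W w) * F' (S' w)) /\
   'E (fun w => F0 (zeta w) * K (Z w) * F (S w) * L (W w) * F' (S' w)) = 0.
  move=> gF0 E0 gK gL oW.
  have s0 := ann _ gF0 E0.
  have s1 := annihilates_expbdd Gz s0 oZ gK.
  have s2 := annihilates_expbdd Gz s1 oS gF.
  have s3 := annihilates_expbdd Gz s2 oW gL.
  have [s4 s5] := annihilates_expbdd Gz s3 oS' gF'.
  by split => //; exact: (annihilates_mean0 s5).
have gdv := expgrowth_dens g v; have gdq := expgrowth_dens g q.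
have dq0 := dens_mean0 Gz; have gf2 := gexp (g ^+ 2 / 2 * v).
have [b1 e1] := term _ _ _ _ ga1 a10 gdv gf oA.
have [b2 e2] := term _ _ _ _ ga1 a10 gdv gh oB.
have [b3 e3] := term _ _ _ _ gdq dq0 gf2 gf oA.
have [b4 e4] := term _ _ _ _ gdq dq0 gf2 gh oB.
have {}b1 := expbdd_integrable b1; have {}b2 := expbdd_integrable b2.
have {}b3 := expbdd_integrable b3; have {}b4 := expbdd_integrable b4.
rewrite -[RHS](subrr 0) -[X in _ = X - _]addr0 -[X in _ = _ - X]addr0.
rewrite -[X in _ = X + _ - _]e1 -[X in _ = _ + X - _]e3 -[X in _ = _ - (X + _)]e2 -[X in _ = _ - (_ + X)]e4.
rewrite -(RintegralD measurableT b1 b3) -(RintegralD measurableT b2 b4).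
rewrite -(RintegralB measurableT (integrableDR b1 b3) (integrableDR b2 b4)).
apply: eq_Rintegral => w _; rewrite /a1 /f2 /dens.
have -> : g * (Z w + zeta w) - g ^+ 2 / 2 * (v + q) =
  (g * Z w - g ^+ 2 / 2 * v) + (g * zeta w - g ^+ 2 / 2 * q) by ring.
by rewrite expRD; ring.
Qed.

End dens_estimates.

End gaussian_space.

Section dens_estimates.
Context d (T : measurableType d) (R : realType) (P : probability T R).
Variable G : set (T -> R).
Hypothesis GG : gaussian_space P G.
Variable g : R.
Hypothesis g0 : 0 < g.

Local Notation "''E' X" := (\int[P]_w X w) (at level 10, X at level 8).

Lemma ler_expE U V : expbdd G U -> expbdd G V -> (forall w, U w <= V w) -> 'E U <= 'E V.
Proof.
move=> eU eV UV.
have [iU iV] := (expbdd_integrable GG eU, expbdd_integrable GG eV).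
by apply: le_Rintegral => // w _; exact: UV.
Qed.

Lemma expbddZ c U : expbdd G U -> expbdd G (fun w => c * U w).
Proof.
move=> eU; apply: (expbddM GG) => //; split => //.
exists (fun=> `|c| * expR ((fun=> 0) (0 : R))).
  exact: (expsum_exp (X := fun=> 0) _ (gs0 GG)).
by move=> w; rewrite expR0 mulr1.
Qed.

Lemma expbdd_exp a b c X Y : G X -> G Y -> expbdd G (fun w => expR (a * X w + b * Y w + c)).
Proof.
move=> GX GY; have GZ := gsZD GG a GX (gsZ GG b GY).
split.
  apply: (measurableT_comp (f := @expR R)) => //; apply: measurable_funD => //.
  exact: (gs_measurable GG GZ).
exists (fun w => expR c * expR (a * X w + b * Y w)); first exact: (expsum_exp _ GZ).
by move=> w; rewrite ger0_norm ?expR_ge0// expRD mulrC.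
Qed.

Lemma expE_comb a b c X Y : G X -> G Y -> 'E (fun w => expR (a * X w + b * Y w + c)) =
  expR ((a ^+ 2 * ip P X X + 2 * a * b * ip P X Y + b ^+ 2 * ip P Y Y) / 2 + c).
Proof.
move=> GX GY; rewrite expRD -(gs_expE_comb GG)// mulrC.
have i := gs_integrable_expR GG (gsZD GG a GX (gsZ GG b GY)).
rewrite -(RintegralZl _ measurableT i).
by apply: eq_Rintegral => w _; rewrite expRD mulrC.
Qed.

Lemma sqr_le_expR2 (x : R) : (x / 2) ^+ 2 + 2 <= expR x + expR (- x).
Proof.
wlog x0 : x / 0 <= x => [W|].
  have [|x0] := leP 0 x; first exact: W.
  have x1 : 0 <= - x by lra.
  by have := W _ x1; rewrite opprK mulNr sqrrN; lra.
have h1 := expR_ge1Dx (x / 2); have e0 := expR_gt0 (x / 2).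
have h2 : (expR (x / 2))^-1 <= 1 by rewrite invf_le1// (le_trans _ h1)// lerDl divr_ge0.
have -> : expR x = expR (x / 2) ^+ 2 by rewrite expr2 -expRD; congr expR; field.
have -> : expR (- x) = (expR (x / 2) ^+ 2)^-1.
  by rewrite expRN; congr (_^-1); rewrite expr2 -expRD; congr expR; field.
have -> : expR (x / 2) ^+ 2 + (expR (x / 2) ^+ 2)^-1 = (expR (x / 2) - (expR (x / 2))^-1) ^+ 2 + 2.
  by field; rewrite gt_eqF.
by rewrite lerD2r ler_pXn2r// ?nnegrE; lra.
Qed.

Definition barrier (s y : R) : R := (y <= s)%R%:R.

Lemma expgrowth_barrier s : expgrowth (barrier s).
Proof.
apply: expgrowth_bounded; last by move=> v; rewrite /barrier normr_nat lern1 leq_b1.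
have -> : barrier s = \1_(`]-oo, s]%classic).
  by apply/funext => y; rewrite indicE /barrier mem_setE in_itv.
exact: measurable_indic.
Qed.

Lemma barrier_le_expR s r y : 0 <= r -> barrier s y <= expR (r * (s - y)).
Proof.
move=> r0; rewrite /barrier; have [ys|_] := leP y s; last exact: expR_ge0.
by rewrite -[leLHS]expR0 ler_expR mulr_ge0// subr_ge0.
Qed.

(* Chernoff bound: the quadratic prefactor is absorbed by exp(+- g / 2 * (Z - g v)),
   which turns the tilt 2 g of the square into l = 5 g / 2 or 3 g / 2, and the barrier is
   bounded by exp(r (s - S)) with r = l - g. *)
Lemma dens_barrier Z S (u b C K : R) : G Z -> G S -> ip P S S = u -> ip P Z Z <= u + b ->
  `|ip P Z S - u| <= C -> 0 <= b -> 0 <= K ->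
  'E (fun w => dens g (ip P Z Z) (Z w) ^+ 2 * barrier (g * u - K) (S w)) <=
  32 / g ^+ 2 * expR (g ^+ 2 / 2 * u + 2 * g ^+ 2 * b + 4 * g ^+ 2 * C - g / 2 * K).
Proof.
move=> GZ GS Su; set v := ip P Z Z; set c := ip P Z S => vb cC b0 K0.
pose l1 := 5 / 2 * g; pose r1 := 3 / 2 * g; pose l2 := 3 / 2 * g; pose r2 := g / 2.
pose m1 := - (3 / 2) * g ^+ 2 * v; pose m2 := - (1 / 2) * g ^+ 2 * v.
pose F (r l m : R) w := expR (l * Z w + (- r) * S w + (r * (g * u - K) + m)).
have eF r l m : expbdd G (F r l m) by exact: expbdd_exp.
have eD : expbdd G (fun w => dens g v (Z w) ^+ 2 * barrier (g * u - K) (S w)).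
  apply: (expbddM GG); last exact: (expbdd_fun GG GS (expgrowth_barrier _)).
  have h := expbdd_fun GG GZ (expgrowth_dens g v).
  by under eq_fun do rewrite expr2; exact: (expbddM GG h h).
have pw w : dens g v (Z w) ^+ 2 * barrier (g * u - K) (S w) <=
    16 / g ^+ 2 * (F r1 l1 m1 w + F r2 l2 m2 w).
  have b1 := @barrier_le_expR (g * u - K) r1 (S w).
  have b2 := @barrier_le_expR (g * u - K) r2 (S w).
  have h := sqr_le_expR2 (g / 2 * (Z w - g * v)).
  rewrite /dens exprMn [expR _ ^+ 2]expr2 -expRD.
  set B := barrier _ _ in b1 b2 *; set E := expR (_ + _).
  have B0 : 0 <= B by rewrite /B /barrier.
  have E0 : 0 <= E := expR_ge0 _.
  have h1 : (- Z w + g * v) ^+ 2 <= 16 / g ^+ 2 * (expR (g / 2 * (Z w - g * v)) + expR (- (g / 2 * (Z w - g * v)))).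
    have -> : (- Z w + g * v) ^+ 2 = 16 / g ^+ 2 * (g / 2 * (Z w - g * v) / 2) ^+ 2 by field; rewrite gt_eqF.
    by rewrite ler_wpM2l ?divr_ge0 ?sqr_ge0//; lra.
  apply: (@le_trans _ _ (16 / g ^+ 2 * (expR (g / 2 * (Z w - g * v)) + expR (- (g / 2 * (Z w - g * v)))) * E * B)).
    by rewrite !ler_wpM2r.
  rewrite -[_ * _ * E]mulrA -[leLHS]mulrA ler_wpM2l ?divr_ge0 ?sqr_ge0// !mulrDl lerD//.
    rewrite /F -expRD (_ : l1 * Z w + _ + _ = (g / 2 * (Z w - g * v) + (g * Z w - g ^+ 2 / 2 * v + (g * Z w - g ^+ 2 / 2 * v))) +
      r1 * (g * u - K - S w)); last by rewrite /l1 /r1 /m1; field.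
    by rewrite [leRHS]expRD ler_wpM2l ?expR_ge0// b1// mulr_ge0 ?ltW// divr_gt0.
  rewrite /F -expRD (_ : l2 * Z w + _ + _ = (- (g / 2 * (Z w - g * v)) + (g * Z w - g ^+ 2 / 2 * v + (g * Z w - g ^+ 2 / 2 * v))) +
    r2 * (g * u - K - S w)); last by rewrite /l2 /r2 /m2; field.
  by rewrite [leRHS]expRD ler_wpM2l ?expR_ge0// b2// divr_ge0 ?ltW.
apply: (le_trans (ler_expE eD (expbddZ _ (expbddD (eF _ _ _) (eF _ _ _))) pw)).
have i1 := expbdd_integrable GG (eF r1 l1 m1); have i2 := expbdd_integrable GG (eF r2 l2 m2).
rewrite (RintegralZl _ measurableT (integrableDR i1 i2)) (RintegralD measurableT i1 i2).
rewrite /F !expE_comb// -/v -/c Su.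
have -> : 32 / g ^+ 2 = 16 / g ^+ 2 * 2 by ring.
rewrite -[leRHS]mulrA ler_wpM2l ?divr_ge0 ?sqr_ge0//.
set X := expR (_ + _); set Y := expR (_ + _); set M := expR _.
suff [hX hY] : X <= M /\ Y <= M by lra.
have g2 : 0 < g ^+ 2 by rewrite exprn_gt0.
move: cC; rewrite ler_norml => /andP[c1 c2]; have C0 : 0 <= C by lra.
have gK := mulr_ge0 (ltW g0) K0.
split; rewrite ler_expR -subr_ge0.
  suff -> : g ^+ 2 / 2 * u + 2 * g ^+ 2 * b + 4 * g ^+ 2 * C - g / 2 * K -
    ((l1 ^+ 2 * v + 2 * l1 * - r1 * c + (- r1) ^+ 2 * u) / 2 + (r1 * (g * u - K) + m1)) =
    g ^+ 2 * (13 / 8 * (u + b - v) + 15 / 4 * (C + (c - u)) + 3 / 8 * b + 1 / 4 * C) + g * K.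
    by rewrite addr_ge0// mulr_ge0 ?(ltW g2)//; lra.
  by rewrite /l1 /r1 /m1; field.
suff -> : g ^+ 2 / 2 * u + 2 * g ^+ 2 * b + 4 * g ^+ 2 * C - g / 2 * K -
    ((l2 ^+ 2 * v + 2 * l2 * - r2 * c + (- r2) ^+ 2 * u) / 2 + (r2 * (g * u - K) + m2)) =
    g ^+ 2 * (5 / 8 * (u + b - v) + 3 / 4 * (C + (c - u)) + 11 / 8 * b + 13 / 4 * C).
  by rewrite mulr_ge0 ?(ltW g2)//; lra.
by rewrite /l2 /r2 /m2; field.
Qed.

Lemma dens_integrable Z v : G Z -> P.-integrable setT (EFin \o (fun w => dens g v (Z w))).
Proof. by move=> GZ; exact: (expbdd_integrable GG (expbdd_fun GG GZ (expgrowth_dens g v))). Qed.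

Lemma tilt_scale Z (v := ip P Z Z) : G Z ->
  [/\ P.-integrable setT (EFin \o (fun w => expR (g * Z w - g ^+ 2 / 2 * v))),
      P.-integrable setT (EFin \o (fun w => (- Z w + g * v) ^+ 2 * expR (g * Z w - g ^+ 2 / 2 * v))),
      'E (fun w => expR (g * Z w - g ^+ 2 / 2 * v)) = 1 &
      'E (fun w => (- Z w + g * v) ^+ 2 * expR (g * Z w - g ^+ 2 / 2 * v)) = v].
Proof.
move=> GZ; have GgZ := gsZ GG g GZ.
have qE : ip P (fun w => g * Z w) (fun w => g * Z w) = g ^+ 2 * v.
  by rewrite (ipZl GG)// [ip P _ (fun w => _)]ipC (ipZl GG)// mulrA -expr2.
have [i2 i0] := tilt_integrable GG GgZ; have m := tilt_mass GG GgZ; have vr := tilt_var GG GgZ.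
rewrite !qE in i2 i0 m vr.
have eE : (fun w => expR (g * Z w - g ^+ 2 / 2 * v)) = (fun w => expR (g * Z w - g ^+ 2 * v / 2)).
  by apply/funext => w; congr (expR (_ - _)); ring.
have e2E : (fun w => (- Z w + g * v) ^+ 2 * expR (g * Z w - g ^+ 2 / 2 * v)) =
    (fun w => (g ^+ 2)^-1 * ((g * Z w - g ^+ 2 * v) ^+ 2 * expR (g * Z w - g ^+ 2 * v / 2))).
  apply/funext => w; rewrite (congr1 (fun f : T -> R => f w) eE); set E := expR _.
  by field; rewrite gt_eqF.
rewrite e2E eE; split => //; first exact: integrableZlR.
by rewrite (RintegralZl _ measurableT i2) vr mulKf// gt_eqF// exprn_gt0.
Qed.

Lemma dens_norm Z : G Z -> 'E (fun w => `|dens g (ip P Z Z) (Z w)|) <= (1 + ip P Z Z) / 2.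
Proof.
move=> GZ; set v := ip P Z Z; have [i0 i2 m vr] := tilt_scale GZ.
have i1 : P.-integrable setT (EFin \o (fun w => `|dens g v (Z w)|)).
  exact: integrable_norm (dens_integrable v GZ).
have -> : (1 + v) / 2 = 'E (fun w => 2^-1 * (expR (g * Z w - g ^+ 2 / 2 * v) + (- Z w + g * v) ^+ 2 * expR (g * Z w - g ^+ 2 / 2 * v))).
  by rewrite (RintegralZl _ measurableT (integrableDR i0 i2)) (RintegralD measurableT i0 i2) m vr mulrC.
apply: (le_Rintegral measurableT i1 (integrableZlR _ (integrableDR i0 i2))) => w _.
rewrite /dens normrM (ger0_norm (expR_ge0 _)) -/v; set e := expR _.
rewrite -{2}[e]mul1r -mulrDl mulrA.
rewrite ler_wpM2r ?expR_ge0// -[_ ^+ 2]real_normK ?num_real//; have := sqr_ge0 (`|- Z w + g * v| - 1).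
by rewrite !expr2; lra.
Qed.

Lemma expR_le_quad (x : R) : x <= 1 / 2 -> expR x <= 1 + x + 2 * x ^+ 2.
Proof.
move=> x1; have h := expR_ge1Dx (- x); have e0 := expR_gt0 (- x).
rewrite -[x]opprK expRN -[leLHS]mul1r ler_pdivrMr// opprK.
have x2 : 0 <= (1 + x + 2 * x ^+ 2) by have := sqr_ge0 (1 + 2 * x); have := sqr_ge0 x; rewrite !expr2; lra.
apply: (@le_trans _ _ ((1 + x + 2 * x ^+ 2) * (1 - x))); last by rewrite ler_wpM2l.
have : 0 <= x ^+ 2 * (1 - 2 * x) by rewrite mulr_ge0 ?sqr_ge0//; lra.
by rewrite !expr2; lra.
Qed.

Lemma amgm_weighted (x y t : R) : 0 < t -> x * y <= t / 2 * x ^+ 2 + (2 * t)^-1 * y ^+ 2.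
Proof.
move=> t0; rewrite -subr_ge0.
have -> : t / 2 * x ^+ 2 + (2 * t)^-1 * y ^+ 2 - x * y = (2 * t)^-1 * (t * x - y) ^+ 2.
  by field; rewrite gt_eqF.
by rewrite mulr_ge0 ?sqr_ge0// invr_ge0 mulr_ge0// ltW.
Qed.

Lemma dens_sub_le (y w v v' t : R) (e := expR (g * y - g ^+ 2 / 2 * v))
    (e' := expR (g * (y + w) - g ^+ 2 / 2 * v')) : 0 < t ->
  `|dens g v' (y + w) - dens g v y| <= (t / 2 - 5 / t + g * `|v' - v|) * e +
    (2 / t * (expR (g * y + 1 * w - g ^+ 2 / 2 * v) + expR (g * y + -1 * w - g ^+ 2 / 2 * v)) +
     (t / 2 * ((- (y + w) + g * v') ^+ 2 * e') +
      (2 * t)^-1 * (e' + expR (g * y + - g * w + g ^+ 2 * (v' / 2 - v))))).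
Proof.
move=> t0.
have [e0 p0] : 0 < e /\ 0 < e' by split; exact: expR_gt0.
have -> : dens g v' (y + w) - dens g v y =
    (- (y + w) + g * v') * (e' - e) + (- w + g * (v' - v)) * e.
  by rewrite /dens -/e -/e'; ring.
apply: (le_trans (ler_normD _ _)); rewrite !normrM (ger0_norm (ltW e0)).
set F := expR (g * y + - g * w + _).
have h1 : `|- (y + w) + g * v'| * `|e' - e| <=
    t / 2 * ((- (y + w) + g * v') ^+ 2 * e') + (2 * t)^-1 * (e' - 2 * e + F).
  have pF : e' * F = e ^+ 2 by rewrite [e ^+ 2]expr2 /e /e' /F -!expRD; congr expR; field.
  rewrite -(ler_pM2l p0) mulrA.
  have -> : e' * (t / 2 * ((- (y + w) + g * v') ^+ 2 * e') + (2 * t)^-1 * (e' - 2 * e + F)) =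
      t / 2 * (e' * `|- (y + w) + g * v'|) ^+ 2 + (2 * t)^-1 * `|e' - e| ^+ 2.
    by rewrite exprMn !real_normK ?num_real// sqrrB -pF; ring.
  exact: amgm_weighted.
have h2 : `|w| * e <= (t / 2 + 2 / t * (expR w + expR (- w) - 2)) * e.
  rewrite ler_pM2r//; have := amgm_weighted 1 `|w| t0.
  rewrite mul1r expr1n mulr1 real_normK ?num_real// => /le_trans; apply; rewrite lerD2l.
  have -> : (2 * t)^-1 * w ^+ 2 = 2 / t * (w / 2) ^+ 2 by field; rewrite gt_eqF.
  rewrite ler_wpM2l ?divr_ge0 ?(ltW t0)//; have := sqr_le_expR2 w; lra.
have h3 : `|- w + g * (v' - v)| <= `|w| + g * `|v' - v|.
  by rewrite (le_trans (ler_normD _ _))// normrN normrM (gtr0_norm g0).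
have {}h3 := ler_wpM2r (ltW e0) h3.
have -> : expR (g * y + 1 * w - g ^+ 2 / 2 * v) = expR w * e.
  by rewrite /e -expRD; congr expR; ring.
have -> : expR (g * y + -1 * w - g ^+ 2 / 2 * v) = expR (- w) * e.
  by rewrite /e -expRD; congr expR; ring.
apply: (le_trans (lerD h1 h3)); rewrite [(`|w| + _) * e]mulrDl.
apply: (@le_trans _ _ (t / 2 * ((- (y + w) + g * v') ^+ 2 * e') + (2 * t)^-1 * (e' - 2 * e + F) +
  ((t / 2 + 2 / t * (expR w + expR (- w) - 2)) * e + g * `|v' - v| * e))); first by rewrite lerD2l lerD2r.
rewrite le_eqVlt; apply/orP; left; apply/eqP; clearbody F e e'.
by move: `|v' - v| => V; field; rewrite gt_eqF.
Qed.

Lemma dens_L1_num (n t v v' o c : R) : 1 <= n -> 0 < t -> 2 * (g + 1) * n * t <= 1 ->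
  v' = v + 2 * c + o -> 0 <= o -> v' <= n -> o <= t ^+ 2 -> `|c| <= n * t ->
  t / 2 - 5 / t + g * `|v' - v| +
   (2 / t * (expR (g * c + o / 2) + expR (- (g * c) + o / 2)) +
    (t / 2 * v' + (2 * t)^-1 * (1 + expR (g ^+ 2 * o)))) <= 12 * (g + 1) ^+ 2 * n ^+ 2 * t.
Proof.
move=> n1 t0 nt v'E o0 vn' ot.
pose N := n * t; pose y := g * N + N.
have tN : t <= N by rewrite ler_peMl// ltW.
have N0 : 0 < N by rewrite (lt_le_trans t0).
have gN0 : 0 < g * N by rewrite mulr_gt0.
have y12 : y <= 1 / 2 by rewrite ler_pdivlMr// (le_trans _ nt)// le_eqVlt; apply/orP; left; apply/eqP; rewrite /y /N; ring.
have tt : t ^+ 2 <= N ^+ 2 by rewrite ler_pXn2r// nnegrE ltW.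
have tNN : t * N <= N ^+ 2 by rewrite expr2 ler_pM2r.
rewrite -/N => cN.
have -> : 12 * (g + 1) ^+ 2 * n ^+ 2 * t = t^-1 * (12 * y ^+ 2).
  by rewrite /y /N; field; rewrite gt_eqF.
have -> : t / 2 - 5 / t + g * `|v' - v| + (2 / t * (expR (g * c + o / 2) + expR (- (g * c) + o / 2)) + (t / 2 * v' + (2 * t)^-1 * (1 + expR (g ^+ 2 * o)))) =
  t^-1 * (t ^+ 2 / 2 + 2 * (expR (g * c + o / 2) + expR (- (g * c) + o / 2) - 2) + g * `|v' - v| * t + t ^+ 2 * v' / 2 + (expR (g ^+ 2 * o) - 1) / 2).
  by field; rewrite gt_eqF.
rewrite ler_pM2l ?invr_gt0//.
have NN : 0 < N ^+ 2 by rewrite exprn_gt0.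
have oN : o <= N ^+ 2 by rewrite (le_trans ot).
have gg : 0 <= g ^+ 2 by rewrite sqr_ge0.
have quad x : `|x| <= y -> expR x <= 1 + x + 2 * y ^+ 2.
  move=> xy; have x2 : x ^+ 2 <= y ^+ 2 by rewrite -[x ^+ 2]real_normK ?num_real// ler_pXn2r// nnegrE (le_trans _ xy).
  apply: (le_trans (expR_le_quad _)); last by rewrite lerD2l ler_pM2l.
  by rewrite (le_trans (ler_norm _))// (le_trans xy).
have N12 : N <= 1 / 2 by rewrite (le_trans _ y12)// /y lerDr ltW.
have N2N : N ^+ 2 <= N / 2 by rewrite expr2 ler_pM2l//; lra.
have gc : `|g * c| <= g * N by rewrite normrM (gtr0_norm g0) ler_pM2l.
have h1 : expR (g * c + o / 2) <= 1 + (g * c + o / 2) + 2 * y ^+ 2.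
  apply: quad; rewrite (le_trans (ler_normD _ _))// (ger0_norm (x := o / 2)) ?divr_ge0//.
  by rewrite /y; lra.
have h2 : expR (- (g * c) + o / 2) <= 1 + (- (g * c) + o / 2) + 2 * y ^+ 2.
  apply: quad; rewrite (le_trans (ler_normD _ _))// normrN (ger0_norm (x := o / 2)) ?divr_ge0//.
  by rewrite /y; lra.
have go : g ^+ 2 * o <= (g * N) ^+ 2 by rewrite exprMn ler_wpM2l.
have gN12 : g * N <= 1 / 2 by rewrite (le_trans _ y12)// /y lerDl ltW.
have gNgN : (g * N) ^+ 2 <= 1 / 4.
  by rewrite (_ : 1 / 4 = (1 / 2) ^+ 2)//; [rewrite ler_pXn2r// nnegrE; lra|field].
have go0 : 0 <= g ^+ 2 * o by rewrite mulr_ge0.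
have h3 : expR (g ^+ 2 * o) <= 1 + 3 / 2 * (g * N) ^+ 2.
  apply: (le_trans (expR_le_quad _)); first by lra.
  have : (g ^+ 2 * o) ^+ 2 <= 1 / 4 * (g ^+ 2 * o) by rewrite expr2 ler_wpM2r//; lra.
  lra.
have h4 : g * `|v' - v| * t <= 3 * (g * N) * N.
  have vv : `|v' - v| <= 3 * N.
    have -> : v' - v = 2 * c + o by rewrite v'E; ring.
    by rewrite (le_trans (ler_normD _ _))// normrM (ger0_norm o0) (@ger0_norm _ (2 : R))//; lra.
  rewrite (_ : 3 * _ * N = g * (3 * N) * N); last by ring.
  by apply: ler_pM; rewrite ?mulr_ge0 ?(ltW g0) ?(ltW t0)// ler_pM2l.
have h5 : t ^+ 2 * v' <= N ^+ 2.
  rewrite expr2 -mulrA; apply: (le_trans _ tNN); rewrite ler_pM2l//.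
  by rewrite /N mulrC ler_pM2r.
have yy : y ^+ 2 = (g * N) ^+ 2 + 2 * ((g * N) * N) + N ^+ 2 by rewrite /y; ring.
have := mulr_gt0 gN0 N0; have := sqr_ge0 (g * N); rewrite yy in h1 h2 *; lra.
Qed.

Lemma dens_L1 Y W (n t : R) (Y' := fun w => Y w + W w) : G Y -> G W ->
  1 <= n -> 0 < t -> 2 * (g + 1) * n * t <= 1 ->
  ip P Y Y <= n -> ip P Y' Y' <= n -> ip P W W <= t ^+ 2 ->
  'E (fun w => `|dens g (ip P Y' Y') (Y' w) - dens g (ip P Y Y) (Y w)|) <= 12 * (g + 1) ^+ 2 * n ^+ 2 * t.
Proof.
move=> GY GW n1 t0 nt; set v := ip P Y Y; set v' := ip P Y' Y'.
set o := ip P W W; pose c := ip P Y W => vn vn' ot.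
have GY' : G Y' by exact: (gsD GG).
have v'E : v' = v + 2 * c + o.
  by rewrite /v' /Y' (ipDl GG)// ![ip P _ (fun w => _ + _)]ipC !(ipDl GG)// [ip P W Y]ipC /v /c /o; ring.
have o0 : 0 <= o := ip_ge0 _ _.
have v'0 : 0 <= v' := ip_ge0 _ _.
have cN : `|c| <= n * t.
  have h a b := ip_ge0 P (fun w => a * Y w + b * W w).
  have := h t 1; have := h t (-1); rewrite !(ip_comb GG)// -/v -/c -/o => h1 h2.
  have h3 : t ^+ 2 * v + o <= 2 * t * (n * t).
    have : t ^+ 2 * v <= t ^+ 2 * n by rewrite ler_wpM2l ?sqr_ge0.
    have : t ^+ 2 * 1 <= t ^+ 2 * n by rewrite ler_wpM2l ?sqr_ge0.
    by rewrite !expr2; rewrite expr2 in ot; lra.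
  have t2 : 0 < 2 * t by rewrite mulr_gt0.
  by rewrite ler_norml -(ler_pM2l t2) -[c <= _](ler_pM2l t2); apply/andP; split; lra.
pose ey w := expR (g * Y w - g ^+ 2 / 2 * v); pose ey' w := expR (g * Y' w - g ^+ 2 / 2 * v').
have [i0 _ m _] := tilt_scale GY; have [i0' iQ m' vQ] := tilt_scale GY'.
rewrite -/v -/(ey) in i0 m; rewrite -/v' -/(ey') in i0' m' vQ iQ.
pose F a b w := expR (g * Y w + a * W w + b).
have iF a b := expbdd_integrable GG (expbdd_exp g a b GY GW).
have eF a b := expE_comb g a b GY GW; rewrite -/v -/c -/o in eF.
pose b1 := - (g ^+ 2 / 2 * v); pose b3 := g ^+ 2 * (v' / 2 - v).
pose Q w := (- Y' w + g * v') ^+ 2 * ey' w.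
pose A := t / 2 - 5 / t + g * `|v' - v|.
pose H w := A * ey w + (2 / t * (F 1 b1 w + F (-1) b1 w) + (t / 2 * Q w + (2 * t)^-1 * (ey' w + F (- g) b3 w))).
have iP1 := integrableDR (iF 1 b1) (iF (-1) b1); have iP2 := integrableDR i0' (iF (- g) b3).
have iP3 := integrableDR (integrableZlR (t / 2) iQ) (integrableZlR (2 * t)^-1 iP2).
have iP4 := integrableDR (integrableZlR (2 / t) iP1) iP3.
have iH : P.-integrable setT (EFin \o H) := integrableDR (integrableZlR A i0) iP4.
have EH : 'E H = A + (2 / t * (expR (g * c + o / 2) + expR (- (g * c) + o / 2)) + (t / 2 * v' + (2 * t)^-1 * (1 + expR (g ^+ 2 * o)))).
  rewrite /H (RintegralD measurableT (integrableZlR A i0) iP4).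
  rewrite (RintegralD measurableT (integrableZlR (2 / t) iP1) iP3).
  rewrite (RintegralD measurableT (integrableZlR (t / 2) iQ) (integrableZlR (2 * t)^-1 iP2)).
  rewrite (RintegralZl _ measurableT i0) (RintegralZl _ measurableT iP1) (RintegralZl _ measurableT iQ) (RintegralZl _ measurableT iP2).
  rewrite (RintegralD measurableT (iF 1 b1) (iF (-1) b1)) (RintegralD measurableT i0' (iF (- g) b3)).
  rewrite m m' vQ !eF mulr1 /b1 /b3.
  by congr (_ + (_ * (expR _ + expR _) + (_ + _ * (_ + expR _)))); rewrite ?v'E; field.
have pw w : `|dens g v' (Y' w) - dens g v (Y w)| <= H w by exact: dens_sub_le.
apply: (le_trans (le_Rintegral measurableT _ iH (fun w _ => pw w))).
  by apply: integrable_norm; apply: integrableBR; exact: dens_integrable.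
by rewrite EH; exact: dens_L1_num.
Qed.
End dens_estimates.

(** * Random fields on R^d *)

Section random_fields.
Context d d' (T : measurableType d) (Y : measurableType d') (R : realType).
Variables (P : probability T R) (m : {sigma_finite_measure set Y -> \bar R}).
Implicit Types f : Y -> T -> R.

Definition random_field f := measurable_fun setT (fun p : T * Y => f p.2 p.1).

Lemma random_field_at f y : random_field f -> measurable_fun setT (f y).
Proof. by move=> mf; exact: (measurableT_comp mf (pair2_measurable y)). Qed.

Lemma random_field_path f w : random_field f -> measurable_fun setT (fun y => f y w).
Proof. by move=> mf; exact: (measurableT_comp mf (pair1_measurable w)). Qed.

Lemma path_integral_measurable f : random_field f -> (forall y w, 0 <= f y w) ->
  measurable_fun setT (fun w => \int[m]_y (f y w)%:E)%E.
Proof.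
move=> mf f0; apply: (@measurable_fun_fubini_tonelli_F _ _ _ _ _ m (fun p => (f p.2 p.1)%:E)).
  exact: measurable_fun_EFin.
by move=> p; rewrite lee_fin.
Qed.

Lemma field_tonelli f : random_field f -> (forall y w, 0 <= f y w) ->
  (\int[P]_w \int[m]_y (f y w)%:E = \int[m]_y \int[P]_w (f y w)%:E)%E.
Proof.
move=> mf f0; apply: (@fubini_tonelli _ _ _ _ _ P m (fun p => (f p.2 p.1)%:E)).
  exact: measurable_fun_EFin.
by move=> p; rewrite lee_fin.
Qed.

Lemma markov_event (h : T -> \bar R) (c a : R) : measurable_fun setT h -> (forall w, 0 <= h w)%E ->
  (\int[P]_w h w <= c%:E)%E -> 0 < a ->
  exists A, [/\ measurable A, (P A <= (c / a)%:E)%E & forall w, ~ A w -> (h w < a%:E)%E].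
Proof.
move=> mh h0 hc a0; exists [set w | a%:E <= h w]%E; split.
- have := emeasurable_fun_c_infty measurableT mh a%:E; rewrite setTI.
  by congr (measurable _); apply/seteqP; split => w /=; rewrite ?in_itv/= ?andbT.
- have := le_integral_abse P measurableT mh a0; rewrite setTI.
  under eq_set do rewrite gee0_abs//.
  under eq_integral do rewrite gee0_abs//.
  move=> /le_trans/(_ hc); rewrite EFinM muleC => H.
  by rewrite lee_pdivlMr.
- by move=> w /negP; rewrite -ltNge.
Qed.

Lemma first_moment_event f (c a : R) : random_field f ->
  (\int[m]_y \int[P]_w `|f y w|%:E <= c%:E)%E -> 0 < a ->
  exists A, [/\ measurable A, (P A <= (c / a)%:E)%E &
    forall w, ~ A w -> m.-integrable setT (EFin \o (fun y => f y w)) /\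
      \int[m]_y `|f y w| <= a].
Proof.
move=> mf fc a0.
have mn : random_field (fun y w => `|f y w|).
  exact: (measurableT_comp (@normr_measurable R setT) mf).
have := fc; rewrite -(field_tonelli mn)// => fc'.
have [||A [mA PA Aw]] := markov_event (path_integral_measurable mn _) _ fc' a0 => //.
  by move=> w; apply: integral_ge0 => y _; rewrite lee_fin.
exists A; split => // w /Aw wa.
have iw : m.-integrable setT (EFin \o (fun y => f y w)).
  apply/integrableP; split; first by apply: measurable_fun_EFin; exact: random_field_path.
  by rewrite (lt_trans wa)// ltry.
split => //; rewrite -lee_fin -EFin_Rintegral ?(ltW wa)//.
exact: integrable_norm.
Qed.

Section second_moment.
Variables (f : Y -> T -> R) (B : set Y) (near : Y -> set Y) (b S v : R).
Hypotheses (mf : random_field f) (mB : measurable B) (Bb : m B = b%:E) (b0 : 0 < b).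
Hypothesis f_out : forall y w, ~ B y -> f y w = 0.
Hypothesis fS : forall y, (\int[P]_w (f y w ^+ 2)%:E <= S%:E)%E.
Hypothesis (mnear : forall y, measurable (near y)) (nearv : forall y, B y -> (m (near y) <= v%:E)%E).
Hypothesis f_far : forall x y, B x -> B y -> ~ near y x -> \int[P]_w (f x w * f y w) = 0.

Let S0 : 0 <= S.
Proof.
have [y By] : B !=set0.
  by apply/set0P; apply/eqP => B0; move: Bb; rewrite B0 measure0 => -[b00]; move: b0; rewrite -b00 ltxx.
by rewrite -lee_fin (le_trans _ (fS y))// integral_ge0// => w _; rewrite lee_fin sqr_ge0.
Qed.

Let m2 : random_field (fun y w => f y w ^+ 2).
Proof. exact: measurable_funX. Qed.

Let Q w := (\int[m]_y (f y w ^+ 2)%:E)%E.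

Let intB : (\int[m]_y (\1_B y)%:E = b%:E)%E.
Proof. by rewrite integral_indic// setIT; exact: Bb. Qed.

Let cB (c : R) (K : Y -> \bar R) : 0 <= c -> measurable_fun setT K ->
  (forall y, 0 <= K y)%E -> (forall y, B y -> (K y <= c%:E)%E) -> (forall y, ~ B y -> K y = 0%E) ->
  (\int[m]_y K y <= (c * b)%:E)%E.
Proof.
move=> c0 mK K0 KB Kout; apply: (@le_trans _ _ (\int[m]_y (c%:E * (\1_B y)%:E))%E).
  apply: ge0_le_integral => //.
  - by apply: measurable_funeM; apply: measurable_fun_EFin; exact: measurable_indic.
  - move=> y _; have [By|By] := pselect (B y).
      by rewrite indicE mem_set//= mule1; exact: KB.
    by rewrite Kout// indicE memNset//= mule0.
rewrite ge0_integralZl//; first by rewrite intB.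
by apply: measurable_fun_EFin; exact: measurable_indic.
Qed.

Let mG (f' : Y -> T -> R) : random_field f' -> (forall y w, 0 <= f' y w) ->
  measurable_fun setT (fun y => \int[P]_w (f' y w)%:E)%E.
Proof.
move=> mf' f0; apply: (@measurable_fun_fubini_tonelli_G _ _ _ _ _ P (fun p => (f' p.2 p.1)%:E)).
  exact: measurable_fun_EFin.
by move=> p; rewrite lee_fin.
Qed.

Lemma energy_le : (\int[P]_w Q w <= (S * b)%:E)%E.
Proof.
rewrite /Q (field_tonelli m2); last by move=> y w; exact: sqr_ge0.
apply: cB => //.
- by apply: mG => // y w; exact: sqr_ge0.
- by move=> y; apply: integral_ge0 => w _; rewrite lee_fin sqr_ge0.
- by move=> y By; apply: integral0_eq => w _; rewrite f_out// expr0n.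
Qed.

Section finite_energy.
Hypothesis Qfin : forall w, (Q w < +oo)%E.

Let iB : m.-integrable setT (EFin \o (\1_B : Y -> R)).
Proof.
apply/integrableP; split; first by apply: measurable_fun_EFin; exact: measurable_indic.
under eq_integral do rewrite /= ger0_norm//.
by rewrite intB ltry.
Qed.

Let if2 w : m.-integrable setT (EFin \o (fun y => f y w ^+ 2)).
Proof.
apply/integrableP; split; first by apply: measurable_fun_EFin; exact: (random_field_path w m2).
by under eq_integral do rewrite /= ger0_norm ?sqr_ge0//; exact: Qfin.
Qed.

Let f_le y w : `|f y w| <= \1_B y + f y w ^+ 2.
Proof.
have [By|By] := pselect (B y); last by rewrite f_out// normr0 expr0n/= addr0.
rewrite indicE mem_set//= -[_ ^+ 2]real_normK ?num_real//.
by have := sqr_ge0 (`|f y w| - 1); have := normr_ge0 (f y w); rewrite !expr2; nra.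
Qed.

Let if1 w : m.-integrable setT (EFin \o (fun y => f y w)).
Proof.
apply: (le_integrable measurableT _ _ (integrableDR iB (if2 w))).
  by apply: measurable_fun_EFin; exact: random_field_path.
move=> y _; rewrite /= lee_fin; apply: (le_trans (f_le y w)); exact: ler_norm.
Qed.

Let A w := \int[m]_y f y w.

Let A2 w : A w ^+ 2 <= b * fine (Q w).
Proof.
have QE : fine (Q w) = \int[m]_y (f y w ^+ 2) by [].
have : 0 <= \int[m]_y (b * f y w - A w * \1_B y) ^+ 2 by apply: Rintegral_ge0 => y _; exact: sqr_ge0.
have -> : \int[m]_y (b * f y w - A w * \1_B y) ^+ 2 =
    b ^+ 2 * fine (Q w) - 2 * b * A w * A w + A w ^+ 2 * b.
  have jB : \int[m]_y (\1_B y : R) = b.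
    by rewrite /Rintegral intB.
  rewrite QE -{4}jB -[in LHS]/(A w) -(RintegralZl _ measurableT (if2 w)).
  rewrite -{3}[A w]/(\int[m]_y f y w) -(RintegralZl _ measurableT (if1 w)).
  rewrite -(RintegralZl _ measurableT iB).
  rewrite -(RintegralB measurableT (integrableZlR _ (if2 w)) (integrableZlR _ (if1 w))).
  rewrite -(RintegralD measurableT (integrableBR (integrableZlR _ (if2 w)) (integrableZlR _ (if1 w))) (integrableZlR _ iB)).
  apply: eq_Rintegral => y _; have [By|By] := pselect (B y).
    by rewrite indicE mem_set//=; ring.
  by rewrite indicE memNset//= f_out//; ring.
by move=> H; rewrite -(ler_pM2l b0); rewrite !expr2 in H *; lra.
Qed.

Let i12 : (P \x m)%E.-integrable setT (fun p => (f p.2 p.1)%:E).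
Proof.
apply/integrable21ltyP; first exact: measurable_fun_EFin.
have mn : random_field (fun y w => `|f y w|).
  exact: (measurableT_comp (@normr_measurable R setT) mf).
apply: (@le_lt_trans _ _ ((1 + S) * b)%:E); last by rewrite ltry.
apply: cB => //=.
- by rewrite addr_ge0.
- exact: mG.
- by move=> y; apply: integral_ge0 => w _; rewrite lee_fin.
- move=> y By; apply: (@le_trans _ _ (\int[P]_w (1 + f y w ^+ 2)%:E)%E).
    apply: ge0_le_integral => //.
    + by apply: measurable_fun_EFin; exact: (random_field_at y mn).
    + by apply: measurable_fun_EFin; apply: measurable_funD => //; exact: (random_field_at y m2).
    + by move=> w _; rewrite lee_fin; have := f_le y w; rewrite indicE mem_set.
  under eq_integral do rewrite EFinD.
  rewrite ge0_integralD//; last first.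
  + by apply: measurable_fun_EFin; exact: (random_field_at y m2).
  + by move=> w _; rewrite lee_fin sqr_ge0.
  have -> : (\int[P]__ (1%:E : \bar R) = 1)%E by rewrite integral_cst// mul1e; exact: probability_setT.
  by rewrite EFinD leeD2l.
- by move=> y By; apply: integral0_eq => w _; rewrite f_out// normr0.
Qed.

Let mA : measurable_fun setT A.
Proof. by apply: (@measurableT_comp _ _ _ _ _ _ (@fine R)); [exact: fine_measurable|exact: (measurable_fubini_F i12)]. Qed.

Let EA2 : (\int[P]_w (A w ^+ 2)%:E <= (b * (S * b))%:E)%E.
Proof.
apply: (@le_trans _ _ (\int[P]_w (b%:E * Q w))%E).
  apply: ge0_le_integral => //.
  - by move=> w _; rewrite lee_fin sqr_ge0.
  - by apply: measurable_fun_EFin; exact: measurable_funX.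
  - by apply: measurable_funeM; apply: path_integral_measurable => // y w; exact: sqr_ge0.
  - move=> w _; have := A2 w; rewrite -lee_fin [in leRHS]EFinM (@fineK _ (Q w))//.
    by rewrite ge0_fin_numE ?Qfin// integral_ge0// => y _; rewrite lee_fin sqr_ge0.
rewrite ge0_integralZl//; last 3 first.
- by apply: path_integral_measurable => // y w; exact: sqr_ge0.
- by move=> w _; apply: integral_ge0 => y _; rewrite lee_fin sqr_ge0.
- by rewrite lee_fin ltW.
by rewrite EFinM lee_pmul2l ?energy_le.
Qed.

Let prod_le (g : T -> R) (c : R) : measurable_fun setT g -> (\int[P]_w (g w ^+ 2)%:E <= c%:E)%E ->
  forall y, (\int[P]_w `|g w * f y w|%:E <= (c + S)%:E)%E.
Proof.
move=> mg gc y; apply: (@le_trans _ _ (\int[P]_w ((g w ^+ 2)%:E + (f y w ^+ 2)%:E))%E).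
  apply: ge0_le_integral => //.
  - by apply: measurable_fun_EFin; apply: (measurableT_comp (@normr_measurable R setT)); apply: measurable_funM => //; exact: random_field_at.
  - by apply: emeasurable_funD; apply: measurable_fun_EFin; [exact: measurable_funX|exact: (random_field_at y m2)].
  - move=> w _; rewrite -EFinD lee_fin normrM -[g w ^+ 2]real_normK ?num_real// -[f y w ^+ 2]real_normK ?num_real//.
    have := sqr_ge0 (`|g w| - `|f y w|); have := sqr_ge0 (`|g w| + `|f y w|); rewrite !expr2; nra.
rewrite ge0_integralD//.
- by rewrite EFinD leeD.
- by move=> w _; rewrite lee_fin sqr_ge0.
- by apply: measurable_fun_EFin; exact: measurable_funX.
- by move=> w _; rewrite lee_fin sqr_ge0.
- by apply: measurable_fun_EFin; exact: (random_field_at y m2).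
Qed.

Let prod_integrable (g : T -> R) (c : R) : measurable_fun setT g -> (\int[P]_w (g w ^+ 2)%:E <= c%:E)%E ->
  (P \x m)%E.-integrable setT (fun p => (g p.1 * f p.2 p.1)%:E).
Proof.
move=> mg gc.
have c0 : 0 <= c by rewrite -lee_fin (le_trans _ gc)// integral_ge0// => w _; rewrite lee_fin sqr_ge0.
have mgf : random_field (fun y w => g w * f y w).
  by apply: measurable_funM => //; exact: (measurableT_comp mg).
have mn : random_field (fun y w => `|g w * f y w|).
  exact: (measurableT_comp (@normr_measurable R setT) mgf).
apply/integrable21ltyP; first exact: measurable_fun_EFin.
apply: (@le_lt_trans _ _ ((c + S) * b)%:E); last by rewrite ltry.
apply: cB => //=.
- by rewrite addr_ge0.
- exact: mG.
- by move=> y; apply: integral_ge0 => w _; rewrite lee_fin.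
- by move=> y _; exact: prod_le.
- by move=> y By; apply: integral0_eq => w _; rewrite f_out// mulr0 normr0.
Qed.

Let prod_integrableG (g : T -> R) (c : R) : measurable_fun setT g -> (\int[P]_w (g w ^+ 2)%:E <= c%:E)%E ->
  m.-integrable setT (fun y => \int[P]_w (g w * f y w)%:E)%E.
Proof.
move=> mg gc; have c0 : 0 <= c by rewrite -lee_fin (le_trans _ gc)// integral_ge0// => w _; rewrite lee_fin sqr_ge0.
have mK : measurable_fun setT (fun y => \int[P]_w (g w * f y w)%:E)%E.
  exact: (measurable_fubini_G (prod_integrable mg gc)).
apply/integrableP; split => //.
apply: (@le_lt_trans _ _ ((c + S) * b)%:E); last by rewrite ltry.
apply: cB => //=.
- by rewrite addr_ge0.
- exact: measurableT_comp.
- move=> y _; apply: (le_trans _ (prod_le mg gc y)); apply: le_abse_integral => //.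
  by apply: measurable_fun_EFin; apply: measurable_funM => //; exact: random_field_at.
- move=> y By; rewrite (eq_integral (fun=> 0%E)); last by move=> w _; rewrite f_out// mulr0.
  by rewrite integral0 abse0.
Qed.

Let prod_fubini (g : T -> R) (c : R) : measurable_fun setT g -> (\int[P]_w (g w ^+ 2)%:E <= c%:E)%E ->
  (\int[P]_w (g w * A w)%:E = \int[m]_y \int[P]_w (g w * f y w)%:E)%E.
Proof.
move=> mg gc; rewrite -(Fubini (prod_integrable mg gc)).
apply: eq_integral => w _; rewrite (EFin_Rintegral (integrableZlR (g w) (if1 w))).
by rewrite (RintegralZl _ measurableT (if1 w)).
Qed.

Let fA y : B y -> (\int[P]_w (f y w * A w)%:E <= (S * v)%:E)%E.
Proof.
move=> By; have mfy := random_field_at y mf.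
rewrite (prod_fubini mfy (fS y)).
apply: (@le_trans _ _ (\int[m]_x (S%:E * (\1_(near y) x)%:E))%E); last first.
  rewrite ge0_integralZl//; last by apply: measurable_fun_EFin; exact: measurable_indic.
  by rewrite integral_indic// setIT EFinM lee_wpmul2l ?lee_fin//; exact: nearv.
have inear : m.-integrable setT (EFin \o (fun x => S * \1_(near y) x)).
  apply: integrableZlR; apply/integrableP; split; first by apply: measurable_fun_EFin; exact: measurable_indic.
  under eq_integral do rewrite /= ger0_norm//.
  by rewrite integral_indic// setIT (le_lt_trans (nearv By))// ltry.
apply: le_integral => //.
- exact: (prod_integrableG mfy (fS y)).
move=> x _; rewrite -EFinM.
have [Bx|Bx] := pselect (B x); last first.
  rewrite (eq_integral (fun=> 0%E)); last by move=> w _; rewrite (f_out w Bx) mulr0.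
  by rewrite integral0 lee_fin mulr_ge0.
have ip : P.-integrable setT (EFin \o (fun w => f y w * f x w)).
  apply/integrableP; split.
    by apply: measurable_fun_EFin; apply: measurable_funM => //; exact: random_field_at.
  by apply: (@le_lt_trans _ _ (S + S)%:E); [exact: prod_le|rewrite ltry].
rewrite (EFin_Rintegral ip) lee_fin.
have [nx|nx] := pselect (near y x); last first.
  under eq_Rintegral do rewrite mulrC.
  by rewrite f_far// mulr_ge0.
have isq z : P.-integrable setT (EFin \o (fun w => f z w ^+ 2)).
  apply/integrableP; split; first by apply: measurable_fun_EFin; exact: (random_field_at z m2).
  under eq_integral do rewrite /= ger0_norm ?sqr_ge0//.
  by rewrite (le_lt_trans (fS z))// ltry.
have Esq z : \int[P]_w (f z w ^+ 2) <= S by rewrite -lee_fin -(EFin_Rintegral (isq z)).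
rewrite indicE mem_set//= mulr1.
apply: (@le_trans _ _ (\int[P]_w (2^-1 * (f y w ^+ 2 + f x w ^+ 2)))).
  apply: (le_Rintegral measurableT ip (integrableZlR _ (integrableDR (isq y) (isq x)))) => w _.
  have := sqr_ge0 (f y w - f x w); rewrite !expr2; lra.
rewrite (RintegralZl _ measurableT (integrableDR (isq y) (isq x))) (RintegralD measurableT (isq y) (isq x)).
have := Esq x; have := Esq y; lra.
Qed.

Let EA2v : (\int[P]_w (A w ^+ 2)%:E <= (S * v * b)%:E)%E.
Proof.
have v0 : 0 <= S * v.
  apply: mulr_ge0 => //.
  have [y By] : B !=set0.
    by apply/set0P; apply/eqP => B0; move: Bb; rewrite B0 measure0 => -[b00]; move: b0; rewrite -b00 ltxx.
  by rewrite -lee_fin (le_trans _ (nearv By)).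
under eq_integral do rewrite expr2.
rewrite (prod_fubini mA EA2).
apply: (@le_trans _ _ (\int[m]_y ((S * v) * \1_B y)%:E)%E); last first.
  under eq_integral do rewrite EFinM.
  rewrite ge0_integralZl//; last by apply: measurable_fun_EFin; exact: measurable_indic.
  by rewrite intB.
apply: le_integral => //.
- exact: (prod_integrableG mA EA2).
- exact: (integrableZlR _ iB).
move=> y _; have [By|By] := pselect (B y).
  by rewrite indicE mem_set//= mulr1; under eq_integral do rewrite mulrC; exact: fA.
rewrite (eq_integral (fun=> 0%E)); last by move=> w _; rewrite f_out// mulr0.
by rewrite integral0 indicE memNset//= mulr0.
Qed.

Lemma finite_second_moment_event (a : R) : 0 < a -> exists A', [/\ measurable A', (P A' <= (S * v * b / a ^+ 2)%:E)%E &
  forall w, ~ A' w -> m.-integrable setT (EFin \o (fun y => f y w)) /\ `|\int[m]_y f y w| <= a].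
Proof.
move=> a0; have a20 : 0 < a ^+ 2 by rewrite exprn_gt0.
have [||A' [mA' PA' A'w]] := markov_event _ _ EA2v a20.
- by apply: measurable_fun_EFin; exact: measurable_funX.
- by move=> w; rewrite lee_fin sqr_ge0.
exists A'; split => // w /A'w; rewrite lte_fin => wa; split; first exact: if1.
by rewrite -/(A w) -(@ler_pXn2r _ 2) ?nnegrE ?(ltW a0)// real_normK ?num_real// ltW.
Qed.

End finite_energy.
End second_moment.

Lemma second_moment_event f (B : set Y) (near : Y -> set Y) (b S v a : R) :
  random_field f -> measurable B -> m B = b%:E -> 0 < b -> (forall y w, ~ B y -> f y w = 0) ->
  (forall y, (\int[P]_w (f y w ^+ 2)%:E <= S%:E)%E) ->
  (forall y, measurable (near y)) -> (forall y, B y -> (m (near y) <= v%:E)%E) ->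
  (forall x y, B x -> B y -> ~ near y x -> \int[P]_w (f x w * f y w) = 0) -> 0 < a ->
  exists A, [/\ measurable A, (P A <= (S * v * b / a ^+ 2)%:E)%E &
    forall w, ~ A w -> m.-integrable setT (EFin \o (fun y => f y w)) /\ `|\int[m]_y f y w| <= a].
Proof.
move=> mf mB Bb b0 f_out fS mnear nearv f_far a0.
pose Q w := (\int[m]_y (f y w ^+ 2)%:E)%E.
have m2 : random_field (fun y w => f y w ^+ 2) by exact: measurable_funX.
have mQ : measurable_fun setT Q by apply: path_integral_measurable => // y w; exact: sqr_ge0.
have Q0 w : (0 <= Q w)%E by apply: integral_ge0 => y _; rewrite lee_fin sqr_ge0.
have EQ : (\int[P]_w Q w <= (S * b)%:E)%E by exact: (energy_le mf mB Bb b0 f_out fS).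
pose N := [set w | Q w = +oo%E].
have mN : measurable N.
  have := mQ measurableT [set +oo%E] (emeasurable_set1 _); rewrite setTI.
  by congr (measurable _); apply/seteqP; split => w.
have PN : P N = 0%E.
  have iQ : P.-integrable setT Q.
    apply/integrableP; split => //; under eq_integral do rewrite gee0_abs//.
    by rewrite (le_lt_trans EQ)// ltry.
  have := integrable_ae measurableT iQ; case=> M [mM PM Mw].
  apply/eqP; rewrite eq_le measure_ge0 andbT -PM le_measure ?inE//.
  by move=> w Nw; apply: Mw => /(_ Logic.I); rewrite Nw.
pose f' y w := f y w * \1_(~` N) w.
have mf' : random_field f'.
  apply: measurable_funM => //.
  by apply: (measurableT_comp _ measurable_fst); apply: measurable_indic; exact: measurableC.
have f'E y w : ~ N w -> f' y w = f y w by move=> Nw; rewrite /f' indicE mem_set// mulr1.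
have f'0 y w : N w -> f' y w = 0 by move=> Nw; rewrite /f' indicE memNset ?mulr0// => /(_ Nw).
have Q' w : (\int[m]_y (f' y w ^+ 2)%:E < +oo)%E.
  have [Nw|Nw] := pselect (N w).
    by rewrite (eq_integral (fun=> 0%E)) ?integral0 ?ltry// => y _; rewrite f'0// expr0n.
  rewrite (eq_integral (fun y => (f y w ^+ 2)%:E)); last by move=> y _; rewrite f'E.
  by rewrite ltey; apply/eqP => /Nw.
have out' y w : ~ B y -> f' y w = 0 by move=> By; rewrite /f' f_out// mul0r.
have S' y : (\int[P]_w (f' y w ^+ 2)%:E <= S%:E)%E.
  apply: (le_trans _ (fS y)); apply: ge0_le_integral => //.
  - by move=> w _; rewrite lee_fin sqr_ge0.
  - by apply: measurable_fun_EFin; apply: measurable_funX; exact: random_field_at.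
  - by apply: measurable_fun_EFin; exact: (random_field_at y m2).
  - move=> w _; rewrite lee_fin; have [Nw|Nw] := pselect (N w); last by rewrite f'E.
    by rewrite f'0// expr0n sqr_ge0.
have far' x y : B x -> B y -> ~ near y x -> \int[P]_w (f' x w * f' y w) = 0.
  move=> Bx By nxy; rewrite -(f_far x y Bx By nxy) /Rintegral; congr fine.
  apply: ae_eq_integral => //.
  - by apply: measurable_fun_EFin; apply: measurable_funM; exact: random_field_at.
  - by apply: measurable_fun_EFin; apply: measurable_funM; exact: random_field_at.
  - exists N; split => // w /= H; apply: contrapT => Nw; apply: H => _.
    by rewrite !f'E.
have [A [mA PA Aw]] := finite_second_moment_event mf' mB Bb b0 out' S' mnear nearv far' Q' a0.
exists (A `|` N); split; first exact: measurableU.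
  by rewrite (le_trans (measureU2 P mA mN))// -[leRHS]adde0; apply: leeD => //; rewrite le_eqVlt; apply/orP; left; apply/eqP.
move=> w /not_orP[/Aw[H1 H2] Nw].
have fE : (fun y => f' y w) = (fun y => f y w) by apply/funext => y; rewrite f'E.
by rewrite fE in H1 H2.
Qed.

End random_fields.

(** * Covariance kernels *)

Section seed.
Context (R : realType).

Definition seed_bounds (k : R -> R) (L B r : R) := [/\ 0 <= L, 0 < B & 0 < r] /\
  [/\ forall x y : R, 0 <= x -> 0 <= y -> `|k x - k y| <= L * `|x - y|,
      forall x : R, 0 <= x -> `|k x| <= B, forall x : R, r <= x -> k x = 0 & k 0 = 1].

Let C1_local (k k' : R -> R) (x e : R) : 0 < e ->
  (fun y : R => (k y - k x) / (y - x)) @ within (fun y : R => 0 <= y) x^' --> k' x ->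
  exists2 dl : R, 0 < dl & forall y : R, 0 <= y -> `|x - y| < dl -> y != x ->
    `|k' x - (k y - k x) / (y - x)| < e.
Proof.
move=> e0 /cvgrPdist_lt /(_ _ e0).
rewrite /dnbhs /within/= => /nbhs_ballP[dl /= dl0 H].
by exists dl => // y y0 xy yx; exact: H.
Qed.

Lemma star_scale_seed_bounds d (k : R -> R) : star_scale_seed d k ->
  exists L B r, seed_bounds k L B r.
Proof.
move=> [[k' ck' dk'] [r0 kr0] k0 _].
pose r := Num.max r0 0 + 1.
have r_gt : r0 < r by rewrite /r ltr_pwDr// le_max lexx.
have r_pos : 0 < r by rewrite /r ltr_pwDr// le_max lexx orbT.
have kr (x : R) : r <= x -> k x = 0 by move=> rx; apply: kr0; exact: lt_le_trans rx.
have cont (x : R) : 0 <= x -> k @ within (fun y : R => 0 <= y) (nbhs x) --> k x.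
  move=> x0; apply/cvgrPdist_lt => e e0.
  have [dl dl0 H] := C1_local ltr01 (dk' x x0).
  rewrite /within/=; apply/nbhs_ballP; exists (Num.min dl (e / (`|k' x| + 1))) => /=.
    by rewrite lt_min dl0 divr_gt0// ltr_wpDl.
  move=> y; rewrite /ball/= lt_min => /andP[xy1 xy2] y0.
  have [->|yx] := eqVneq y x; first by rewrite subrr normr0.
  have {}H := H y y0 xy1 yx; have yx0 : y - x != 0 by rewrite subr_eq0.
  have -> : k x - k y = ((k y - k x) / (y - x)) * (x - y) by field.
  rewrite normrM; move: xy2; rewrite ltr_pdivlMr ?ltr_wpDl// => xy2.
  apply: le_lt_trans xy2; rewrite mulrC ler_wpM2l//.
  have -> : (k y - k x) / (y - x) = k' x - (k' x - (k y - k x) / (y - x)) by ring.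
  by rewrite (le_trans (ler_normB _ _))// lerD2l ltW.
have der (x : R) : 0 < x -> is_derive x 1 k (k' x).
  move=> x0.
  have H : (fun h : R => h^-1 *: (k (h *: 1 + x) - k x)) @ 0^' --> k' x.
    apply/cvgrPdist_lt => e e0; have [dl dl0 H] := C1_local e0 (dk' x (ltW x0)).
    rewrite /dnbhs /within/=; apply/nbhs_ballP; exists (Num.min dl x) => /=; first by rewrite lt_min dl0.
    move=> h; rewrite /ball/= sub0r normrN lt_min => /andP[h1 h2] h0.
    have y0 : 0 <= h *: 1 + x.
      by rewrite /GRing.scale/= mulr1; move: h2; rewrite ltr_norml => /andP[]; lra.
    have := H (h *: 1 + x) y0; rewrite /GRing.scale/= mulr1 opprD addrCA subrr addr0 normrN addrK.
    move=> /(_ h1); rewrite -subr_eq0 addrK => /(_ h0); by rewrite mulrC.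
  by apply: DeriveDef; [exact: cvgP H|exact: cvg_lim H].
have wk (a b : R) : 0 <= a -> {within `[a, b], continuous k}.
  move=> a0; apply/subspace_continuousP => x /= xab.
  have x0 : 0 <= x by move: xab; rewrite in_itv/= => /andP[+ _]; exact: le_trans.
  apply: cvg_trans (cont x x0); apply: cvg_app; apply: within_subset.
  by move=> y /=; rewrite in_itv/= => /andP[+ _]; exact: le_trans.
have wk' : {within `[0, r], continuous k'}.
  apply: continuous_subspaceW ck' => x /=; rewrite !in_itv/= => /andP[-> _].
  by [].
have [c1 _ M1] := EVT_max (ltW r_pos) wk'; have [c2 _ M2] := EVT_min (ltW r_pos) wk'.
pose L := `|k' c1| + `|k' c2|.
have L0 : 0 <= L by rewrite addr_ge0.
have k'L (x : R) : x \in `[0, r] -> `|k' x| <= L.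
  move=> xr; have := M1 _ xr; have := M2 _ xr; rewrite ler_norml.
  have := ler_norm (k' c1); have := ler_norm (- k' c2); rewrite normrN.
  have := normr_ge0 (k' c1); have := normr_ge0 (k' c2); rewrite /L => ? ? ? ? ? ?.
  by apply/andP; split; lra.
have lip1 (x y : R) : 0 <= x -> x <= y -> y <= r -> `|k x - k y| <= L * `|x - y|.
  move=> x0 xy yr.
  have [z|z|c cxy E] := @MVT_segment R k k' x y xy.
  - by rewrite in_itv/= => /andP[xz _]; apply: der; exact: le_lt_trans xz.
  - exact: wk.
  rewrite distrC E normrM [`|x - y|]distrC ler_wpM2r// k'L//.
  by move: cxy; rewrite !in_itv/= => /andP[xc cy]; rewrite (le_trans x0)// (le_trans cy).
have lip2 (x y : R) : 0 <= x -> x <= y -> `|k x - k y| <= L * `|x - y|.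
  move=> x0 xy; have [yr|ry] := leP y r; first exact: lip1.
  rewrite (kr y (ltW ry)); have [xr|rx] := leP x r; last first.
    by rewrite (kr x (ltW rx)) subrr normr0 mulr_ge0.
  rewrite -[X in _ - X](kr r (lexx r)); apply: (le_trans (lip1 _ _ x0 xr (lexx r))).
  rewrite ler_wpM2l// ler0_norm ?subr_le0// ler0_norm ?subr_le0// !opprB; lra.
have lip (x y : R) : 0 <= x -> 0 <= y -> `|k x - k y| <= L * `|x - y|.
  move=> x0 y0; have [xy|/ltW yx] := leP x y; first exact: lip2.
  by rewrite distrC [`|x - y|]distrC; exact: lip2.
exists L, (L * r + 1), r; split; split => //.
  by rewrite ltr_wpDl// mulr_ge0// ltW.
move=> x x0; have [xr|rx] := leP x r; last first.
  by rewrite (kr x (ltW rx)) normr0 addr_ge0// mulr_ge0// ltW.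
have := lip x r x0 (ltW r_pos); rewrite (kr r (lexx r)) subr0 => /le_trans; apply.
rewrite (@le_trans _ _ (L * r))//; last by rewrite lerDl.
rewrite ler_wpM2l// ler0_norm ?subr_le0// opprB; lra.
Qed.

End seed.

Section cut.
Context (R : realType) (k : R -> R) (L B r0 : R).
Hypothesis kb : seed_bounds k L B r0.

Definition cut (s r : R) : R := \int[mu]_(u in `[1, s]) (k (u * r) / u).

Let L0 : 0 <= L. Proof. by case: kb => -[]. Qed.
Let B0 : 0 < B. Proof. by case: kb => -[]. Qed.
Let r00 : 0 < r0. Proof. by case: kb => -[]. Qed.

Let kn_cont : continuous (fun x : R => k `|x|).
Proof.
move=> x; apply/cvgrPdist_lt => e e0; apply/nbhs_ballP; exists (e / (L + 1)) => /=.
  by rewrite divr_gt0// ltr_wpDl.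
move=> y; rewrite /ball/= ltr_pdivlMr ?ltr_wpDl// => xy.
have [_ [lip _ _ _]] := kb; apply: (le_lt_trans (lip _ _ (normr_ge0 _) (normr_ge0 _))).
apply: le_lt_trans xy; rewrite mulrC; apply: ler_pM; rewrite ?lerDl//.
exact: ler_dist_dist.
Qed.

Lemma cut_integrable (a b r : R) : 1 <= a -> 0 <= r ->
  mu.-integrable `[a, b] (EFin \o (fun u : R => k (u * r) / u)).
Proof.
move=> a1 r_ge.
have h : mu.-integrable `[a, b] (EFin \o (fun u : R => k `|u * r| / u)).
  apply: continuous_compact_integrable; first exact: segment_compact.
  apply: continuous_in_subspaceT => u; rewrite inE/= in_itv/= => /andP[au _].
  have u0 : u != 0 by rewrite gt_eqF// (lt_le_trans _ au)// (lt_le_trans _ a1).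
  apply: cvgM; last by apply: cvgV => //; exact: cvg_id.
  apply: (@cvg_comp _ _ _ (fun u : R => u * r) (fun x : R => k `|x|)); last exact: kn_cont.
  by apply: cvgM; [exact: cvg_id|exact: cvg_cst].
apply: eq_integrable h; first exact: measurable_itv.
move=> u; rewrite inE/= in_itv/= => /andP[au _].
by rewrite ger0_norm// mulr_ge0// (le_trans _ au)// (le_trans _ a1).
Qed.

Lemma cut0 s : 1 <= s -> cut s 0 = ln s.
Proof.
rewrite le_eqVlt => /predU1P[<-|s1].
  by rewrite ln1 /cut /Rintegral set_itv1 integral_set1.
have [_ [_ _ _ k0]] := kb.
have -> : cut s 0 = \int[mu]_(u in `[1, s]) u^-1.
  by apply: eq_Rintegral => u _; rewrite mulr0 k0 mul1r.
have pos (x : R) : 1 <= x -> 0 < x by exact: lt_le_trans.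
rewrite /Rintegral (@continuous_FTC2 _ (fun u => u^-1) (@ln R) 1 s s1).
- by rewrite ln1 sube0.
- apply: continuous_in_subspaceT => u; rewrite inE/= in_itv/= => /andP[au _].
  by apply: cvgV; [rewrite gt_eqF// pos|exact: cvg_id].
- split.
  + move=> x; rewrite in_itv/= => /andP[x1 _]; have [] := is_derive1_ln (pos _ (ltW x1)).
    by [].
  + by apply: cvg_at_right_filter; apply: continuous_ln.
  + by apply: cvg_at_left_filter; apply: continuous_ln; exact: lt_trans s1.
- move=> x; rewrite in_itv/= => /andP[x1 _]; rewrite derive1E.
  by have [_ ->] := is_derive1_ln (pos _ (ltW x1)).
Qed.

Let Rintegral_le (a b M : R) (f : R -> R) : a <= b ->
  mu.-integrable `[a, b] (EFin \o f) -> (forall u, a <= u <= b -> `|f u| <= M) ->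
  `|\int[mu]_(u in `[a, b]) f u| <= M * (b - a).
Proof.
move=> ab fi fM; apply: (le_trans (le_normr_Rintegral _ fi)) => //.
apply: (@le_trans _ _ (\int[mu]_(u in `[a, b]) M)).
  apply: le_Rintegral => //.
  - exact: integrable_norm.
  - apply/integrableP; split; first exact: measurable_cst.
    rewrite integral_cst//= lebesgue_measure_itv/=; case: ifP => _; last by rewrite mule0 ltry.
    by rewrite -EFinM ltry.
rewrite Rintegral_cst//= lebesgue_measure_itv/= lte_fin; case: ltP => //= ba.
by rewrite (_ : b = a) ?subrr//; apply/eqP; rewrite eq_le ab ba.
Qed.

Lemma cut_lip s r r' : 1 <= s -> 0 <= r -> 0 <= r' -> `|cut s r - cut s r'| <= L * s * `|r - r'|.
Proof.
move=> s1 rr rr'; have [_ [lip _ _ _]] := kb.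
have [i i'] := (cut_integrable s (lexx 1) rr, cut_integrable s (lexx 1) rr').
rewrite /cut -(RintegralB _ i i'); last exact: measurable_itv.
apply: (@le_trans _ _ (L * `|r - r'| * (s - 1))).
  apply: Rintegral_le => //; first by apply: (integrableB _ i i'); exact: measurable_itv.
  move=> u /andP[u1 _]; have u0 : 0 < u by exact: lt_le_trans u1.
  rewrite -mulrBl normrM normfV (gtr0_norm u0) ler_pdivrMr//.
  rewrite (le_trans (lip _ _ (mulr_ge0 (ltW u0) rr) (mulr_ge0 (ltW u0) rr')))//.
  by rewrite -mulrBr normrM (gtr0_norm u0) mulrCA [leRHS]mulrC.
by rewrite mulrAC ler_wpM2r// ler_wpM2l// gerBl.
Qed.

Let cut_split (s s' r : R) : 1 <= s -> s <= s' -> 0 <= r ->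
  cut s' r = cut s r + \int[mu]_(u in `[s, s']) (k (u * r) / u).
Proof.
move=> s1 ss' rr.
have i := cut_integrable s' (lexx 1) rr; have i2 := cut_integrable s' s1 rr.
rewrite -(@Rintegral_itv_obnd_cbnd _ s (BRight s')); last first.
  apply: integrableS i2 => //; exact: subset_itv_oc_cc.
have E : `[1, s']%classic = `[1, s]%classic `|` `]s, s']%classic :> set R.
  rewrite -(@itv_bndbnd_setU _ _ (BLeft 1) (BRight s) (BRight s')) ?bnd_simp//.
rewrite /cut E Rintegral_setU//; last 2 first.
- by rewrite -E.
- by apply/disj_setPS => u /=; rewrite !in_itv/= => -[/andP[_ us] /andP[/lt_le_trans/(_ us)]]; rewrite ltxx.
Qed.

Lemma cut_local s s' r : 1 <= s -> s <= s' -> 0 <= r -> r0 <= s * r -> cut s' r = cut s r.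
Proof.
move=> s1 ss' rr sr; rewrite (cut_split s1 ss' rr).
have [_ [_ _ kr _]] := kb.
have -> : \int[mu]_(u in `[s, s']) (k (u * r) / u) = \int[mu]_(u in `[s, s']) 0.
  apply: eq_Rintegral => u; rewrite inE/= in_itv/= => /andP[su _].
  by rewrite kr ?mul0r// (le_trans sr)// ler_wpM2r.
by rewrite /Rintegral integral0 addr0.
Qed.

Lemma cut_diff s s' r : 1 <= s -> s <= s' -> 0 <= r -> `|cut s' r - cut s r| <= B / s * s'.
Proof.
move=> s1 ss' rr; rewrite (cut_split s1 ss' rr) addrC addKr.
have s0 : 0 < s by exact: lt_le_trans s1.
have [_ [_ kB _ _]] := kb.
apply: (@le_trans _ _ (B / s * (s' - s))).
  apply: Rintegral_le => //; first exact: cut_integrable.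
  move=> u /andP[su _]; have u0 : 0 < u by exact: lt_le_trans su.
  rewrite normrM normfV (gtr0_norm u0) ler_pM ?invr_ge0 ?(ltW u0)//.
    by rewrite kB// mulr_ge0// ltW.
  by rewrite lef_pV2.
by rewrite ler_wpM2l ?divr_ge0 ?ltW// gtrBl.
Qed.

Lemma cut_le s r : 1 <= s -> 0 <= r -> `|cut s r - ln s| <= L * s * r.
Proof.
move=> s1 rr; rewrite -cut0//; have := cut_lip s1 rr (lexx 0).
by rewrite subr0 (ger0_norm rr).
Qed.

End cut.

Section Kstar.
Context (R : realType) (k : R -> R) (L B r0 : R).
Hypothesis kb : seed_bounds k L B r0.

Definition kstar (r : R) : \bar R := (\int[mu]_(u in `[1%R, +oo[) (k (u * r) / u)%:E)%E.

Let r00 : 0 < r0. Proof. by case: kb => -[]. Qed.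
Let B0 : 0 < B. Proof. by case: kb => -[]. Qed.

Lemma kstar_cut (s r : R) : 1 <= s -> 0 < r -> r0 <= s * r -> kstar r = (cut k s r)%:E.
Proof.
move=> s1 rp sr; have [_ [_ _ kr _]] := kb.
have i := cut_integrable kb s (lexx 1) (ltW rp).
rewrite /cut /Rintegral fineK; last by apply: integrable_fin_num i; exact: measurable_itv.
rewrite /kstar [LHS]integral_mkcond [RHS]integral_mkcond; apply: eq_integral => u _.
rewrite /patch !mem_setE !in_itv/= andbT; case: (leP 1 u) => //= u1; case: (leP u s) => //= us.
by rewrite kr ?mul0r// (le_trans sr)// ler_wpM2r// ltW.
Qed.

Lemma kstar_sub_cut (s r : R) : 1 <= s -> 0 < r ->
  exists2 e, kstar r = (cut k s r + e)%:E & `|e| <= B * r0 / (s * r).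
Proof.
move=> s1 rp; have s0 : 0 < s by exact: lt_le_trans s1.
have [sr|sr] := leP r0 (s * r).
  by exists 0; rewrite ?addr0 ?(kstar_cut s1 rp sr)// normr0 divr_ge0 ?mulr_ge0 ?ltW.
have s1' : s <= r0 / r by rewrite ler_pdivlMr// ltW.
exists (cut k (r0 / r) r - cut k s r).
  by rewrite addrC subrK; apply: kstar_cut => //; [exact: le_trans s1'|rewrite divfK// gt_eqF].
apply: (le_trans (cut_diff kb s1 s1' (ltW rp))).
by rewrite le_eqVlt; apply/orP; left; apply/eqP; field; rewrite !gt_eqF.
Qed.

Lemma continuous_cut_norm s : 1 <= s -> continuous (fun r : R => cut k s `|r|).
Proof.
move=> s1 x; have L0 : 0 <= L by case: kb => -[].
have Ls : 0 < L * s + 1 by rewrite ltr_wpDl// mulr_ge0// (le_trans _ s1).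
apply/cvgrPdist_lt => e e0; apply/nbhs_ballP; exists (e / (L * s + 1)) => /=; first exact: divr_gt0.
move=> y; rewrite /ball/= ltr_pdivlMr// => xy.
apply: (le_lt_trans (cut_lip kb s1 (normr_ge0 _) (normr_ge0 _))).
apply: le_lt_trans xy; rewrite [leRHS]mulrC; apply: ler_pM; rewrite ?lerDl//.
  by rewrite mulr_ge0// (le_trans _ s1).
exact: ler_dist_dist.
Qed.

Lemma measurable_kstar_norm : measurable_fun setT (fun r : R => kstar `|r|).
Proof.
pose F (n : nat) (r : R) := if r == 0 then kstar 0 else (cut k n.+1%:R `|r|)%:E.
have n1 (n : nat) : 1 <= n.+1%:R :> R by rewrite ler1n.
apply: (@emeasurable_fun_cvg _ _ _ setT F).
  move=> n; apply: measurable_fun_ifT => //; first exact: measurable_fun_eqr.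
  by apply: measurable_fun_EFin; apply: continuous_measurable_fun; exact: continuous_cut_norm.
move=> r _; have [->|r_neq0] := eqVneq r 0.
  by rewrite normr0; apply: cvg_near_cst; apply: nearW => n; rewrite /F eqxx.
have rp : 0 < `|r| by rewrite normr_gt0.
apply: cvg_near_cst; near=> n; rewrite /F (negbTE r_neq0) (@kstar_cut n.+1%:R)//.
rewrite -ler_pdivrMr// (@le_trans _ _ n%:R) ?ler_nat//.
near: n; exact: nbhs_infty_ger.
Unshelve. all: by end_near.
Qed.

End Kstar.

(** * Discretisation of the mollifier *)

Section euclidean_norm.
Context (R : realType) (d : nat).
Local Notation Rd := 'rV[R]_d.
Implicit Types x y : Rd.

Lemma enorm_ge0 x : 0 <= enorm x. Proof. exact: sqrtr_ge0. Qed.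

Lemma sqr_enorm x : enorm x ^+ 2 = \sum_(i < d) x ord0 i ^+ 2.
Proof. by rewrite sqr_sqrtr// sumr_ge0// => i _; exact: sqr_ge0. Qed.

Lemma enorm0 : enorm (0 : Rd) = 0.
Proof. by rewrite /enorm big1 ?sqrtr0// => i _; rewrite mxE expr0n. Qed.

Lemma enormZ a x : enorm (a *: x) = `|a| * enorm x.
Proof.
rewrite /enorm -sqrtr_sqr -sqrtrM ?sqr_ge0// mulr_sumr; congr Num.sqrt.
by apply: eq_bigr => i _; rewrite mxE exprMn.
Qed.

Lemma enormN x : enorm (- x) = enorm x.
Proof. by rewrite -scaleN1r enormZ normrN1 mul1r. Qed.

Lemma enormBC x y : enorm (x - y) = enorm (y - x).
Proof. by rewrite -enormN opprB. Qed.

Lemma coord_le_enorm x i : `|x ord0 i| <= enorm x.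
Proof.
rewrite -(@ler_pXn2r _ 2) ?nnegrE ?enorm_ge0// sqr_enorm real_normK ?num_real//.
by rewrite (bigD1 i)//= lerDl sumr_ge0// => j _; exact: sqr_ge0.
Qed.

Lemma enorm_le_sum x : enorm x <= \sum_(i < d) `|x ord0 i|.
Proof.
have s0 (r : seq 'I_d) : 0 <= \sum_(i <- r) `|x ord0 i| by exact: sumr_ge0.
rewrite -(@ler_pXn2r _ 2) ?nnegrE ?enorm_ge0// sqr_enorm.
elim: (index_enum 'I_d) => [|i r IH]; first by rewrite !big_nil expr0n.
rewrite !big_cons sqrrD real_normK ?num_real// -addrA lerD2l.
by rewrite (le_trans IH)// lerDr mulrn_wge0// mulr_ge0.
Qed.

Lemma enorm_eq0 x : (enorm x == 0) = (x == 0).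
Proof.
apply/eqP/eqP => [x0|->]; last exact: enorm0.
apply/rowP => i; apply/eqP; rewrite mxE -normr_le0.
by have := coord_le_enorm x i; rewrite x0.
Qed.

Lemma ler_enormD x y : enorm (x + y) <= enorm x + enorm y.
Proof.
have [->|x0] := eqVneq x 0; first by rewrite add0r enorm0 add0r.
have [->|y0] := eqVneq y 0; first by rewrite addr0 enorm0 addr0.
have xp : 0 < enorm x by rewrite lt_neqAle eq_sym enorm_eq0 x0 enorm_ge0.
have yp : 0 < enorm y by rewrite lt_neqAle eq_sym enorm_eq0 y0 enorm_ge0.
rewrite -(@ler_pXn2r _ 2) ?nnegrE ?addr_ge0 ?enorm_ge0// sqrrD !sqr_enorm.
set A := enorm x in xp *; set B := enorm y in yp *.
have H : \sum_(i < d) 2 * (x ord0 i * y ord0 i) <=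
    \sum_(i < d) (B / A * x ord0 i ^+ 2 + A / B * y ord0 i ^+ 2).
  apply: ler_sum => i _; rewrite -subr_ge0.
  have -> : B / A * x ord0 i ^+ 2 + A / B * y ord0 i ^+ 2 - 2 * (x ord0 i * y ord0 i) =
    (B * x ord0 i - A * y ord0 i) ^+ 2 / (A * B) by field; rewrite !gt_eqF.
  by rewrite divr_ge0 ?sqr_ge0// mulr_ge0// ltW.
rewrite big_split/= -!mulr_sumr -!sqr_enorm -/A -/B in H.
have E : B / A * A ^+ 2 + A / B * B ^+ 2 = 2 * (A * B) by field; rewrite !gt_eqF.
rewrite E in H.
have -> : \sum_(i < d) (x + y) ord0 i ^+ 2 = \sum_(i < d) x ord0 i ^+ 2 +
    2 * (\sum_(i < d) x ord0 i * y ord0 i) + \sum_(i < d) y ord0 i ^+ 2.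
  rewrite mulr_sumr -!big_split/=; apply: eq_bigr => i _; rewrite mxE; ring.
by rewrite lerD2r lerD2l -[A * B *+ 2]mulr_natl.
Qed.

Lemma ler_dist_enorm x y : `|enorm x - enorm y| <= enorm (x - y).
Proof.
rewrite ler_norml; apply/andP; split.
  by rewrite lerNl opprB lerBlDr enormBC -[leLHS](_ : enorm (y - x + x) = _) ?ler_enormD// subrK.
by rewrite lerBlDr -[leLHS](_ : enorm (x - y + y) = _) ?ler_enormD// subrK.
Qed.

Lemma measurable_enorm : measurable_fun setT (@enorm R d).
Proof.
apply: (measurableT_comp (f := @Num.sqrt R)).
  by apply: continuous_measurable_fun; exact: sqrt_continuous.
by apply: measurable_sum => i; apply: measurable_funX; exact: measurable_coord.
Qed.

Lemma measurable_enorm_affine (a : R) y : measurable_fun setT (fun x : Rd => enorm (a *: x + y)).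
Proof.
apply: (measurableT_comp measurable_enorm).
exact: (measurableT_comp (measurable_funPT (translation y)) (measurable_funPT (dilation a))).
Qed.

End euclidean_norm.

Section grid.
Context (R : realType) (d : nat).
Local Notation Rd := 'rV[R]_d.
Variables (a dl : R) (N : nat).
Hypothesis dl0 : 0 < dl.

Definition grid (j : {ffun 'I_d -> 'I_N}) : Rd := \row_i (a + dl * (j i)%:R).

Definition cell (j : {ffun 'I_d -> 'I_N}) : set Rd :=
  [set x | forall i, 0 <= x ord0 i - grid j ord0 i < dl].

Lemma measurable_cell j : measurable (cell j).
Proof.
rewrite (_ : cell j = \bigcap_(i in [set: 'I_d])
    (fun x : Rd => x ord0 i) @^-1` `[grid j ord0 i, grid j ord0 i + dl[).
  apply: fin_bigcap_measurable; first exact: finite_finset.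
  move=> i _; rewrite -[X in measurable X]setTI.
  by apply: measurable_coord => //; exact: measurable_itv.
apply/seteqP; split => x /= xab i.
  by move=> _; rewrite /= in_itv/=; have := xab i; rewrite subr_ge0 ltrBlDl.
by have := xab i Logic.I; rewrite /= in_itv/= subr_ge0 ltrBlDl.
Qed.

Lemma cell_inj i j (x : Rd) : cell i x -> cell j x -> i = j.
Proof.
move=> xi xj; apply/ffunP => l; apply: val_inj; apply/eqP.
have := xi l; have := xj l; rewrite !mxE => /andP[h1 h2] /andP[h3 h4].
have key (m n : nat) : dl * m%:R < dl * n%:R + dl -> (m <= n)%N.
  have -> : dl * n%:R + dl = dl * (n%:R + 1) by ring.
  by rewrite ltr_pM2l// natr1 ltr_nat ltnS.
by rewrite eqn_leq; apply/andP; split; apply: key; lra.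
Qed.

Lemma cell_cover (x : Rd) : (forall i, a <= x ord0 i < a + dl * N%:R) -> exists j, cell j x.
Proof.
move=> xN; pose m i := Num.truncn ((x ord0 i - a) / dl).
have mP i : (m i)%:R <= (x ord0 i - a) / dl < (m i).+1%:R.
  apply: Num.Theory.truncn_itv; rewrite divr_ge0 ?(ltW dl0)// subr_ge0.
  by have /andP[] := xN i.
have mN i : (m i < N)%N.
  have /andP[h _] := mP i; have /andP[_ h'] := xN i.
  by rewrite -(ltr_nat R) (le_lt_trans h)// ltr_pdivrMr// mulrC; lra.
exists [ffun i => Ordinal (mN i)] => i; rewrite mxE ffunE/=.
have /andP[] := mP i; rewrite ler_pdivlMr// ltr_pdivrMr// -natr1 => h1 h2.
by apply/andP; split; lra.
Qed.

Lemma cell_grid j (x : Rd) i : cell j x -> `|x ord0 i - grid j ord0 i| <= dl.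
Proof. by move=> /(_ i) /andP[h1 h2]; rewrite ger0_norm// ltW. Qed.

Lemma cell_sum (phi : {ffun 'I_d -> 'I_N} -> R) j (x : Rd) : cell j x ->
  \sum_i \1_(cell i) x * phi i = phi j.
Proof.
move=> xj; rewrite (bigD1 j)//= indicE mem_set// mul1r big1 ?addr0// => i ij.
by rewrite indicE memNset ?mul0r// => xi; move: ij; rewrite (cell_inj xi xj) eqxx.
Qed.

End grid.

Lemma measurable_inv (R : realType) : measurable_fun setT (@GRing.inv R : R -> R).
Proof.
have o : open (~` [set (0 : R)]) by rewrite openC; exact: closed_eq.
rewrite -(setvU [set (0 : R)]); apply/measurable_funU.
- exact: open_measurable.
- exact: measurable_set1.
split; last exact: measurable_fun_set1.
apply: open_continuous_measurable_fun => // x; rewrite inE/= => x0.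
by apply: inv_continuous; exact/eqP.
Qed.

Lemma integrable_sum_fin (J : finType) d (T : measurableType d) (R : realType) (m : {measure set T -> \bar R})
    (f : J -> T -> R) : (forall j, m.-integrable setT (EFin \o f j)) ->
  m.-integrable setT (EFin \o (fun w => \sum_j f j w)).
Proof.
move=> fi; elim: (index_enum J) => [|j s IH].
  by under eq_fun do rewrite big_nil; exact: integrable0.
by under eq_fun do rewrite big_cons; exact: integrableDR.
Qed.

Lemma Rintegral_sum_fin (J : finType) d (T : measurableType d) (R : realType) (m : {measure set T -> \bar R})
    (f : J -> T -> R) : (forall j, m.-integrable setT (EFin \o f j)) ->
  \int[m]_w (\sum_j f j w) = \sum_j \int[m]_w f j w.
Proof.
move=> fi.
have key (s : seq J) : m.-integrable setT (EFin \o (fun w => \sum_(j <- s) f j w)) /\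
    \int[m]_w (\sum_(j <- s) f j w) = \sum_(j <- s) \int[m]_w f j w.
  elim: s => [|j s [IH1 IH2]].
    split; first by under eq_fun do rewrite big_nil; exact: integrable0.
    by under eq_Rintegral do rewrite big_nil; rewrite big_nil /Rintegral integral0.
  split; first by under eq_fun do rewrite big_cons; exact: integrableDR.
  under eq_Rintegral do rewrite big_cons.
  by rewrite (RintegralD measurableT (fi j) IH1) IH2 big_cons.
exact: (key _).2.
Qed.

Section mollifier_measure.
Context (R : realType) (d : nat).
Local Notation Rd := 'rV[R]_d.
Variable theta : {finite_measure set Rd -> \bar R}.
Hypothesis At : admissible_mollifier theta.

Lemma measurable_ecball (r : R) : measurable (ecball r : set Rd).
Proof.
rewrite (_ : ecball r = @enorm R d @^-1` `]-oo, r]).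
  by rewrite -[X in measurable X]setTI; apply: measurable_enorm => //; exact: measurable_itv.
by apply/seteqP; split => x; rewrite /= in_itv.
Qed.

Lemma mollifier_out : theta (~` ecball 1) = 0%E.
Proof.
have [_ _ supp _ _] := At.
have mU : measurable (~` ecball 1 : set Rd) by apply: measurableC; exact: measurable_ecball.
pose F (n : nat) : set Rd := if (unpickle n : option ('rV[rat]_d * rat)%type) is Some p then
  [set x | theta.-negligible (@rat_cube R d p) /\ rat_cube p x] else set0.
have nF n : theta.-negligible (F n).
  rewrite /F; case: unpickle => [p|]; last exact: negligible_set0.
  have [np|np] := pselect (theta.-negligible (@rat_cube R d p)).
    by apply: negligibleS np => x [].
  by apply: negligibleS (negligible_set0 theta) => x [].
apply/(negligibleP theta mU); apply: negligibleS (negligible_bigcup nF) => x xU.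
have : ~ msupport theta x by move=> /supp.
rewrite /msupport/= => /existsNP[V] /not_implyP[oV] /not_implyP[Vx /negP].
rewrite -leNgt => V0.
have mV : measurable V by exact: open_measurable_mx.
have {}V0 : theta V = 0%E by apply/eqP; rewrite eq_le V0 measure_ge0.
have := Vx; rewrite (open_bigcup_rat_cube oV) => -[p /= pV px].
exists (pickle p) => //; rewrite /F pickleK; split => //.
by exists V; split.
Qed.

Lemma mollifier_mass : theta setT = 1%E.
Proof.
have [_ _ _ t1 _] := At.
have mB := measurable_ecball 1.
rewrite -(setvU (ecball 1)) measureU//; last 2 first.
- exact: measurableC.
- by rewrite setICl.
by rewrite [X in (X + _)%E](_ : _ = 0%E); [rewrite add0e|exact: mollifier_out].
Qed.

Lemma measurable_enormB : measurable_fun setT (fun p : Rd * Rd => enorm (p.1 - p.2)).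
Proof.
apply: (measurableT_comp (@measurable_enorm R d)); apply: measurable_fun_rV => i.
under eq_fun do rewrite !mxE; apply: measurable_funB.
  exact: (measurableT_comp (measurable_coord ord0 i) measurable_fst).
exact: (measurableT_comp (measurable_coord ord0 i) measurable_snd).
Qed.

Lemma measurable_inverse_distance :
  measurable_fun setT (fun p : Rd * Rd => ((enorm (p.1 - p.2))%:E^-1)%E).
Proof.
under eq_fun do rewrite inver.
apply: measurable_fun_ifT; first by apply: measurable_fun_eqr => //; exact: measurable_enormB.
  exact: measurable_cst.
apply: measurable_fun_EFin; apply: (measurableT_comp _ measurable_enormB).
exact: measurable_inv.
Qed.

Lemma mollifier_energy : exists2 S : R, 0 <= S &
  (\int[theta]_u \int[theta]_v ((enorm (u - v))%:E)^-1 <= S%:E)%E.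
Proof.
have [_ _ _ _ Soo] := At; set s := ereal_sup _ in Soo.
have E0 (u v : Rd) : (0 <= ((enorm (u - v))%:E)^-1)%E by rewrite inve_ge0 lee_fin enorm_ge0.
have sP v : eball 5 v -> (\int[theta]_u ((enorm (u - v))%:E)^-1 <= s)%E.
  by move=> v5; apply: ereal_sup_ubound; exists v.
have s0 : (0 <= s)%E.
  apply: le_trans (sP 0 _); first by apply: integral_ge0.
  by rewrite /eball/= enorm0.
exists (fine s); first exact: fine_ge0.
have mN : measurable_fun setT (fun u : Rd => \int[theta]_v ((enorm (u - v))%:E)^-1)%E.
  by apply: (@measurable_fun_fubini_tonelli_F _ _ _ _ _ theta _ measurable_inverse_distance) => -[u v]; exact: E0.
apply: (@le_trans _ _ (\int[theta]__ s)%E); last first.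
  by rewrite integral_cst//= mollifier_mass mule1 fineK// ge0_fin_numE.
apply: ae_ge0_le_integral => //.
- by move=> u _; exact: integral_ge0.
exists (~` ecball 1); split; first by apply: measurableC; exact: measurable_ecball.
  exact: mollifier_out.
move=> u /= H u1; apply: H => _; apply: le_trans (sP u _).
  by rewrite le_eqVlt; apply/orP; left; apply/eqP; apply: eq_integral => v _; rewrite enormBC.
by rewrite /eball/= (le_lt_trans u1)// ltr1n.
Qed.

Lemma discretize (dl : R) : 0 < dl -> exists (J : finType) (p : J -> Rd) (c : J -> R),
  [/\ forall j, 0 <= c j, \sum_j c j = 1, forall j i, `|p j ord0 i| <= 2 &
    forall (phi : Rd -> R) (M m : R), measurable_fun setT phi -> (forall u, `|phi u| <= M) ->
      (forall u v, enorm (u - v) <= dl -> `|phi u - phi v| <= m) ->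
      `|\sum_j c j * phi (p j) - \int[theta]_u phi u| <= m].
Proof.
move=> dl0; pose e := dl / (d%:R + 1); have e0 : 0 < e by rewrite divr_gt0// ltr_wpDl.
have e2 : 0 <= 2 / e by rewrite divr_ge0// ltW.
pose N := (Num.truncn (2 / e)).+1.
have N2 : 2 < e * N%:R.
  by rewrite [e * _]mulrC -ltr_pdivrMr// /N; have /andP[] := truncn_itv e2.
have N2' (n : nat) : (n < N)%N -> e * n%:R <= 2.
  rewrite ltnS [e * _]mulrC -ler_pdivlMr// => nN; apply: (@le_trans _ _ (Num.truncn (2 / e))%:R); first by rewrite ler_nat.
  by have /andP[] := truncn_itv e2.
pose p := @grid R d (-1) e N; pose C := @cell R d (-1) e N.
pose c j := fine (theta (C j)).
have fC j : theta (C j) \is a fin_num by apply: fin_num_measure; exact: measurable_cell.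
have iI j a : theta.-integrable setT (EFin \o (fun u => \1_(C j) u * a)).
  apply: (@bounded_integrable _ _ _ _ _ `|a|) => [|u].
    by apply: measurable_funM => //; apply: measurable_indic; exact: measurable_cell.
  by rewrite normrM ler_piMl// indicE; case: (_ \in _); rewrite ?normr1// normr0.
have EI j a : \int[theta]_u (\1_(C j) u * a) = c j * a.
  under eq_Rintegral do rewrite mulrC.
  rewrite RintegralZl//; last by have := iI j 1; under eq_fun do rewrite mulr1.
  rewrite mulrC; congr (_ * _); rewrite /c /Rintegral integral_indic//; first by rewrite setIT.
  exact: measurable_cell.
have sumE (phi : Rd -> R) : \sum_j c j * phi (p j) = \int[theta]_u (\sum_j \1_(C j) u * phi (p j)).
  by rewrite Rintegral_sum_fin//; apply: eq_bigr => j _; rewrite EI.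
have inC u : enorm u <= 1 -> exists j, C j u.
  move=> u1; apply: cell_cover => // i; have := le_trans (coord_le_enorm u i) u1.
  by rewrite ler_norml => /andP[-> h]; lra.
exists {ffun 'I_d -> 'I_N}, p, c.
have c0 j : 0 <= c j by rewrite fine_ge0.
have p1 j i : `|p j ord0 i| <= 2.
  rewrite /p mxE; have := N2' _ (ltn_ord (j i)); have : 0 <= e * (j i)%:R by rewrite mulr_ge0// ltW.
  by rewrite ler_norml => ? ?; apply/andP; split; lra.
have iS (phi : Rd -> R) : theta.-integrable setT (EFin \o (fun u => \sum_j \1_(C j) u * phi (p j))).
  exact: integrable_sum_fin.
have ae (psi : Rd -> R) (m : R) : 0 <= m -> measurable_fun setT psi ->
    (forall u, enorm u <= 1 -> `|psi u| <= m) ->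
    theta.-integrable setT (EFin \o psi) -> `|\int[theta]_u psi u| <= m.
  move=> m0 mpsi H ipsi; apply: (le_trans (le_normr_Rintegral measurableT ipsi)).
  rewrite -lee_fin -EFin_Rintegral; last exact: integrable_norm.
  apply: (@le_trans _ _ (\int[theta]__ m%:E)%E); last first.
    by rewrite integral_cst//= mollifier_mass mule1.
  apply: ae_ge0_le_integral => //.
  - by apply: measurable_fun_EFin; exact: (measurableT_comp (@normr_measurable R setT)).
  exists (~` ecball 1); split; first by apply: measurableC; exact: measurable_ecball.
    exact: mollifier_out.
  by move=> u /= Hu u1; apply: Hu => _; rewrite lee_fin H.
split => //.
- have := sumE (fun=> 1); under eq_bigr do rewrite mulr1.
  move=> ->; have i1 : theta.-integrable setT (EFin \o (fun=> 1 : R)).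
    by apply: (@bounded_integrable _ _ _ _ _ 1) => // x; rewrite normr1.
  have t1 : \int[theta]_u (1 : R) = 1 by rewrite Rintegral_cst//= mollifier_mass mulr1.
  apply/eqP; rewrite -subr_eq0 -normr_le0 -[X in _ - X]t1 -(RintegralB measurableT (iS (fun=> 1)) i1).
  apply: ae => //.
  + apply: measurable_funB => //; apply: measurable_sum => j.
    by apply: measurable_funM => //; apply: measurable_indic; exact: measurable_cell.
  + by move=> u /inC[j uj]; rewrite (cell_sum e0 (fun=> 1) uj) subrr normr0.
  + exact: (integrableBR (iS (fun=> 1)) i1).
move=> phi M m mphi phiM modu.
have iphi : theta.-integrable setT (EFin \o phi) by exact: (@bounded_integrable _ _ _ _ _ M).
rewrite sumE -(RintegralB measurableT (iS phi) iphi).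
apply: ae => //.
- by rewrite (le_trans _ (modu 0 0 _))// subrr enorm0 ltW.
- apply: measurable_funB => //; apply: measurable_sum => j.
  by apply: measurable_funM => //; apply: measurable_indic; exact: measurable_cell.
- move=> u /inC[j uj]; rewrite (cell_sum e0 (fun j => phi (p j)) uj).
  rewrite distrC; apply: modu; apply: (le_trans (enorm_le_sum _)).
  apply: (@le_trans _ _ (\sum_(i < d) e)).
    by apply: ler_sum => i _; rewrite mxE [X in _ + X]mxE; exact: (cell_grid i uj).
  rewrite sumr_const card_ord -mulr_natl mulrC -mulrA ler_piMr ?(ltW dl0)//.
  by rewrite mulrC ler_pdivrMr ?ltr_wpDl// mul1r lerDl.
- exact: (integrableBR (iS phi) iphi).
Qed.

End mollifier_measure.

(** * The field and its approximations *)

Section linear_span.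
Context (R : realType) dT (T : measurableType dT) (P : probability T R).
Variables (I : Type) (D : set I) (X : I -> {RV P >-> R}).

Definition linear_span : set (T -> R) := [set Y | exists n (i : 'I_n -> I) (c : 'I_n -> R),
  (forall j, D (i j)) /\ Y = (fun w => \sum_(j < n) c j * X (i j) w)].

Lemma linear_span_mem i : D i -> linear_span (X i).
Proof.
move=> Di; exists 1%N, (fun=> i), (fun=> 1); split => //.
by apply/funext => w; rewrite big_ord1 mul1r.
Qed.

Lemma linear_span_gaussian : @centred_gaussian_process R dT T P I D X -> gaussian_space P linear_span.
Proof.
move=> gX; split.
- move=> _ [n [i [c [Di ->]]]]; apply: measurable_sum => j.
  by apply: measurable_funM => //; exact: measurable_funPT.
- by move=> _ [n [i [c [Di ->]]]]; exact: gX.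
- exists 0%N, (fun j : 'I_0 => match notF (ltn_ord j) with end), (fun=> 0); split; first by case.
  by apply/funext => w; rewrite big_ord0.
- move=> a _ _ [n [i [c [Di ->]]]] [n' [i' [c' [Di' ->]]]].
  exists (n + n')%N, (fun j => match fintype.split j with inl l => i l | inr l => i' l end),
    (fun j => match fintype.split j with inl l => a * c l | inr l => c' l end); split.
    by move=> j; case: fintype.split.
  apply/funext => w; rewrite big_split_ord/= mulr_sumr; congr (_ + _).
    by apply: eq_bigr => j _; rewrite (unsplitK (inl j)) mulrA.
  by apply: eq_bigr => j _; rewrite (unsplitK (inr j)).
Qed.

End linear_span.

Section covariance_ip.
Context (R : realType) dT (T : measurableType dT) (P : probability T R).
Variable G : set (T -> R).
Hypothesis GG : gaussian_space P G.

Lemma covariance_ip (X Y : {RV P >-> R}) : G X -> G Y -> covariance P X Y = (ip P X Y)%:E.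
Proof.
move=> GX GY.
have E0 (Z : {RV P >-> R}) : G Z -> expectation P Z = 0%E.
  move=> GZ; rewrite unlock (EFin_Rintegral (gs_integrable GG GZ)).
  by rewrite (gs_mean0 GG GZ).
rewrite unlock (E0 X GX) (E0 Y GY) unlock /ip -(EFin_Rintegral (gs_integrableM GG GX GY)).
apply: eq_integral => w _; congr EFin.
by change ((X w - 0) * (Y w - 0) = X w * Y w); rewrite !subr0.
Qed.

End covariance_ip.

Section sum_ip.
Context (R : realType) dT (T : measurableType dT) (P : probability T R).
Variable G : set (T -> R).
Hypothesis GG : gaussian_space P G.

Lemma gs_sum (J : finType) (c : J -> R) (X : J -> T -> R) : (forall j, G (X j)) ->
  G (fun w => \sum_j c j * X j w).
Proof.
move=> GX; elim: (index_enum J) => [|j s IH].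
  by under eq_fun do rewrite big_nil; exact: (gs0 GG).
by under eq_fun do rewrite big_cons; exact: (gsZD GG).
Qed.

Lemma ip_suml (J : finType) (c : J -> R) (X : J -> T -> R) Y : (forall j, G (X j)) -> G Y ->
  ip P (fun w => \sum_j c j * X j w) Y = \sum_j c j * ip P (X j) Y.
Proof.
move=> GX GY.
have key (s : seq J) : G (fun w => \sum_(j <- s) c j * X j w) /\
    ip P (fun w => \sum_(j <- s) c j * X j w) Y = \sum_(j <- s) c j * ip P (X j) Y.
  elim: s => [|j s [IH1 IH2]].
    split; first by under eq_fun do rewrite big_nil; exact: (gs0 GG).
    rewrite big_nil /ip; under eq_Rintegral do rewrite big_nil mul0r.
    by rewrite /Rintegral integral0.
  split; first by under eq_fun do rewrite big_cons; exact: (gsZD GG).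
  by under [X in ip P X]eq_fun do rewrite big_cons; rewrite (ipZDl GG)// IH2 big_cons.
exact: (key _).2.
Qed.

End sum_ip.

Section mollifier_charge.
Context (R : realType) (d : nat).
Local Notation Rd := 'rV[R]_d.
Variable theta : {finite_measure set Rd -> \bar R}.
Variables (eps : R) (x : Rd).

Let phi (u : Rd) : Rd := eps *: u + x.

Lemma measurable_affine : measurable_fun setT phi.
Proof. exact: (measurableT_comp (measurable_funPT (translation x)) (measurable_funPT (dilation eps))). Qed.

Let rho := mollifier_at theta eps x.

Let rhoE A : rho A = theta (phi @^-1` A).
Proof. by []. Qed.

Lemma jordan_mollifier P N (hPN : hahn_decomposition rho P N) A : measurable A ->
  jordan_pos hPN A = theta (phi @^-1` A) /\ jordan_neg hPN A = 0%E.
Proof.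
move=> mA; have [[mP _] [mN nN] PN PN0] := hPN.
have m_pre E : measurable E -> measurable (phi @^-1` E).
  by move=> mE; rewrite -[X in measurable X]setTI; exact: measurable_affine.
have rN : theta (phi @^-1` (A `&` N)) = 0%E.
  apply/eqP; rewrite eq_le measure_ge0 andbT -rhoE nN//; exact: measurableI.
split; last first.
  rewrite jordan_negE charge.cjordan_negE /crestr0 mem_set// /crestr/=.
  by rewrite [X in (- X)%E](_ : _ = 0%E) ?oppe0//.
rewrite jordan_posE charge.cjordan_posE /crestr0 mem_set// /crestr/=.
rewrite [LHS](_ : _ = theta (phi @^-1` (A `&` P)))//.
rewrite -[RHS](_ : theta (phi @^-1` ((A `&` P) `|` (A `&` N))) = _); last by rewrite -setIUr PN setIT.
rewrite preimage_setU measureU ?[X in (_ + X)%E]rN ?adde0//; try (apply: m_pre; exact: measurableI).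
by rewrite -preimage_setI setIACA PN0 setI0 preimage_set0.
Qed.

Lemma mollifier_neg A : measurable A -> rho_neg rho A = 0%E.
Proof. by move=> mA; have [_] := jordan_mollifier (hahn rho) mA. Qed.

Lemma mollifier_pos A : measurable A -> rho_pos rho A = theta (phi @^-1` A).
Proof. by move=> mA; have [] := jordan_mollifier (hahn rho) mA. Qed.

Lemma ge0_integral_mollifier (f : Rd -> \bar R) : measurable_fun setT f -> (forall y, 0 <= f y)%E ->
  (\int[rho_pos rho]_y f y = \int[theta]_u f (phi u))%E.
Proof.
move=> mf f0; transitivity (\int[pushforward theta phi]_y f y)%E.
  apply: eq_measure_integral; first exact: measurable_affine.
  by move=> ? A mA _; exact: (mollifier_pos mA).
by rewrite (ge0_integral_pushforward measurable_affine).
Qed.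

Lemma cintegral_mollifier (f : Rd -> \bar R) : measurable_fun setT f ->
  (cintegral rho f = \int[theta]_u f (phi u))%E.
Proof.
move=> mf; rewrite /cintegral.
have -> : (\int[rho_neg rho]_y f y = 0)%E.
  rewrite -[RHS](integral_measure_zero setT f).
  by apply: eq_measure_integral => A mA _; exact: (mollifier_neg mA).
rewrite sube0 integralE [RHS]integralE; congr (_ - _)%E.
  rewrite (ge0_integral_mollifier (measurable_funepos mf) (funepos_ge0 f)).
  by apply: eq_integral => u _; rewrite !funeposE.
rewrite (ge0_integral_mollifier (measurable_funeneg mf) (funeneg_ge0 f)).
by apply: eq_integral => u _; rewrite !funenegE.
Qed.

End mollifier_charge.

Lemma measurable_integral_snd d1 d2 (T1 : measurableType d1) (T2 : measurableType d2) (R : realType)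
    (m : {sigma_finite_measure set T2 -> \bar R}) (f : T1 * T2 -> \bar R) : measurable_fun setT f ->
  measurable_fun setT (fun x => \int[m]_y f (x, y))%E.
Proof.
move=> mf; under eq_fun do rewrite integralE.
apply: emeasurable_funB.
  have mp : measurable_fun setT (f^\+)%E by exact: measurable_funepos.
  have H := @measurable_fun_fubini_tonelli_F _ _ _ _ _ m _ mp (funepos_ge0 f).
  congr (measurable_fun _ _): H; apply/funext => x; apply: eq_integral => y _.
  by rewrite !funeposE.
have mn : measurable_fun setT (f^\-)%E by exact: measurable_funeneg.
have H := @measurable_fun_fubini_tonelli_F _ _ _ _ _ m _ mn (funeneg_ge0 f).
congr (measurable_fun _ _): H; apply/funext => x; apply: eq_integral => y _.
by rewrite !funenegE.
Qed.

Lemma dist_integral_le d (T : measurableType d) (R : realType) (m : {measure set T -> \bar R})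
    (f g b : T -> \bar R) : m.-integrable setT f -> m.-integrable setT g -> measurable_fun setT b ->
  (forall x, `|f x - g x| <= b x)%E -> (`|\int[m]_x f x - \int[m]_x g x| <= \int[m]_x b x)%E.
Proof.
move=> fi gi mb H; rewrite -(integralB measurableT fi gi).
have ifg := integrableB measurableT fi gi.
apply: (le_trans (le_abse_integral _ measurableT (measurable_int _ ifg))).
by apply: ge0_le_integral => //; apply: measurableT_comp => //; exact: (measurable_int _ ifg).
Qed.

Section field_covariances.
Context (R : realType) (d : nat) (dT : measure_display) (T : measurableType dT) (P : probability T R).
Local Notation Rd := 'rV[R]_d.
Variables (k : R -> R) (L B r0 : R) (h : {charge set Rd -> \bar R} -> {RV P >-> R})
  (ht : R -> Rd -> {RV P >-> R}).
Hypotheses (kb : seed_bounds k L B r0) (sf : star_scale_field k h) (cf : cutoff_field k h ht).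

Definition field_space : set (T -> R) :=
  linear_span [set i | match i with inl rho => field_test k rho | inr p => 0 < p.1 <= 1 end]
    (fun i : {charge set Rd -> \bar R} + R * Rd =>
           match i with inl rho => h rho | inr p => ht p.1 p.2 end).

Lemma field_space_gaussian : gaussian_space P field_space.
Proof. by apply: linear_span_gaussian; case: cf. Qed.

Lemma field_space_ht e x : 0 < e <= 1 -> field_space (ht e x).
Proof. by move=> e1; exact: (@linear_span_mem _ _ _ P _ _ _ (inr (e, x))). Qed.

Lemma field_space_h rho : field_test k rho -> field_space (h rho).
Proof. by move=> e1; exact: (@linear_span_mem _ _ _ P _ _ _ (inl rho)). Qed.

Lemma ip_ht e e' x y : 0 < e <= 1 -> 0 < e' <= 1 ->
  ip P (ht e x) (ht e' y) = cut k (Num.max e e')^-1 (enorm (x - y)).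
Proof.
move=> e1 e1'; have [_ + _ _] := cf; move=> /(_ e e' x y e1 e1').
by rewrite (covariance_ip field_space_gaussian); [case|exact: field_space_ht|exact: field_space_ht].
Qed.

Variable theta : {finite_measure set Rd -> \bar R}.
Hypothesis At : admissible_mollifier theta.

Lemma measurable_Kstar : measurable_fun setT (fun p : Rd * Rd => Kstar k p.1 p.2).
Proof.
have := measurableT_comp (measurable_kstar_norm kb) (@measurable_enormB R d).
by apply: eq_measurable_fun => p _; rewrite /= ger0_norm ?enorm_ge0.
Qed.

Lemma kstar_le (r : R) : 0 <= r -> (`|kstar k r| <= (B * r0)%:E * (r%:E)^-1)%E.
Proof.
have B0 : 0 < B by case: kb => -[]. 
have r00 : 0 < r0 by case: kb => -[].
rewrite le_eqVlt => /predU1P[<-|rp]; first by rewrite inve0 gt0_muley ?leey// lte_fin mulr_gt0.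
have [e ->] := kstar_sub_cut kb (lexx 1) rp.
rewrite mul1r inver gt_eqF// => eB.
by rewrite /cut set_itv1 /Rintegral integral_set1 add0r lee_fin.
Qed.

Lemma closed_msupport (m : set Rd -> \bar R) : closed (msupport m).
Proof.
rewrite -openC openE => y /= /existsNP[U] /not_implyP[oU] /not_implyP[Uy mU].
rewrite /interior; apply: filterS (open_nbhs_nbhs (conj oU Uy)) => z Uz.
by move=> /(_ _ oU Uz).
Qed.

Lemma mollifier_support eps x : 0 < eps ->
  msupport (rho_var (mollifier_at theta eps x)) `<=` [set y | forall i, x ord0 i - eps <= y ord0 i <= x ord0 i + eps].
Proof.
move=> e0 y /= ysupp i; apply: contrapT => yi.
have oU : open ((fun z : Rd => z ord0 i) @^-1` (~` `[x ord0 i - eps, x ord0 i + eps])).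
  apply: open_comp; first by move=> z _; exact: coord_continuous.
  by rewrite openC; exact: itv_closed.
have Uy : ((fun z : Rd => z ord0 i) @^-1` (~` `[x ord0 i - eps, x ord0 i + eps])) y.
  by rewrite /= in_itv/=.
have := ysupp _ oU Uy; set U := _ @^-1` _.
have mU : measurable U by exact: open_measurable_mx.
rewrite [X in (_ < X)%E](_ : _ = 0%E) ?ltxx//.
rewrite /rho_var /charge_variation/=.
have [-> ->] := jordan_mollifier (hahn (mollifier_at theta eps x)) mU.
rewrite adde0; apply: (@subset_measure0 _ _ _ theta _ (~` ecball 1)).
- by rewrite -[X in measurable X]setTI; exact: measurable_affine.
- by apply: measurableC; exact: measurable_ecball.
- move=> u /= Uu u1; apply: Uu; rewrite /= in_itv/= !mxE.
  have := le_trans (coord_le_enorm u i) u1; rewrite ler_norml => /andP[h1 h2].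
  have := ler_wpM2l (ltW e0) h1; have := ler_wpM2l (ltW e0) h2.
  by rewrite mulrN mulr1 => ? ?; apply/andP; split; lra.
- exact: mollifier_out.
Qed.

Lemma ge0_integral2_mollifier eps x (F : Rd * Rd -> \bar R) : measurable_fun setT F -> (forall p, 0 <= F p)%E ->
  (\int[rho_pos (mollifier_at theta eps x)]_y \int[rho_pos (mollifier_at theta eps x)]_z F (y, z) =
   \int[theta]_u \int[theta]_v F ((eps *: u + x)%R, (eps *: v + x)%R))%E.
Proof.
move=> mF F0.
rewrite (@ge0_integral_mollifier _ _ theta eps x (fun y => \int[rho_pos (mollifier_at theta eps x)]_z F (y, z))%E).
- apply: eq_integral => u _.
  rewrite (@ge0_integral_mollifier _ _ theta eps x (fun z => F (eps *: u + x, z)))//.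
  exact: (measurableT_comp mF (pair1_measurable _)).
- exact: measurable_integral_snd.
- by move=> y; apply: integral_ge0.
Qed.

Lemma enorm_affine eps (u v x : Rd) : 0 < eps -> enorm (eps *: u + x - (eps *: v + x)) = eps * enorm (u - v).
Proof. by move=> e0; rewrite opprD addrACA subrr addr0 -scalerBr enormZ gtr0_norm. Qed.

Let B0 : 0 < B. Proof. by case: kb => -[]. Qed.
Let r00 : 0 < r0. Proof. by case: kb => -[]. Qed.
Let L0 : 0 <= L. Proof. by case: kb => -[]. Qed.

Let N u := (\int[theta]_v ((enorm (u - v))%:E)^-1)%E.

Let inv0 (u v : Rd) : (0 <= ((enorm (u - v))%:E)^-1)%E.
Proof. by rewrite inve_ge0 lee_fin enorm_ge0. Qed.

Let mN : measurable_fun setT N.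
Proof. exact: (measurable_integral_snd _ (measurable_inverse_distance (R := R) (d := d))). Qed.

Let minv u : measurable_fun setT (fun v : Rd => ((enorm (u - v))%:E)^-1)%E.
Proof. exact: (measurableT_comp (@measurable_inverse_distance R d) (pair1_measurable u)). Qed.

Let scale_inv eps (c r : R) : 0 < eps -> 0 < c -> 0 <= r ->
  (c%:E * ((eps * r)%:E)^-1 = (c / eps)%:E * (r%:E)^-1)%E.
Proof.
move=> e0 c0; rewrite le_eqVlt => /predU1P[<-|rp].
  by rewrite mulr0 inve0 !gt0_muley// lte_fin divr_gt0.
by rewrite !inver !gt_eqF ?mulr_gt0// -!EFinM; congr EFin; field; rewrite !gt_eqF.
Qed.

Let mkstar eps : 0 < eps -> measurable_fun setT (fun p : Rd * Rd => kstar k (eps * enorm (p.1 - p.2))).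
Proof.
move=> e0; have m : measurable_fun setT (fun p : Rd * Rd => eps * enorm (p.1 - p.2)).
  by apply: measurable_funM => //; exact: measurable_enormB.
have := measurableT_comp (measurable_kstar_norm kb) m.
by apply: eq_measurable_fun => p _; rewrite /= ger0_norm ?mulr_ge0 ?enorm_ge0 ?ltW.
Qed.

Lemma kstar_energy eps : 0 < eps -> (\int[theta]_u \int[theta]_v `|kstar k (eps * enorm (u - v))| < +oo)%E.
Proof.
move=> e0; have [S _ SP] := mollifier_energy At.
have c0 : 0 < B * r0 / eps by rewrite divr_gt0// mulr_gt0.
apply: (@le_lt_trans _ _ (\int[theta]_u ((B * r0 / eps)%:E * N u))%E); last first.
  rewrite ge0_integralZl//; last 2 first.
  - by move=> u _; exact: integral_ge0.
  - by rewrite lee_fin ltW.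
  by rewrite lte_mul_pinfty// ?lee_fin ?(ltW c0)// (le_lt_trans SP)// ltry.
have mK : measurable_fun setT (fun p : Rd * Rd => `|kstar k (eps * enorm (p.1 - p.2))|)%E.
  by apply: measurableT_comp => //; exact: mkstar.
apply: ge0_le_integral => //.
- by move=> u _; exact: integral_ge0.
- exact: (measurable_integral_snd _ mK).
- exact: measurable_funeM.
move=> u _; rewrite -ge0_integralZl//; last by rewrite lee_fin ltW.
apply: ge0_le_integral => //.
- exact: (measurableT_comp mK (pair1_measurable u)).
- exact: measurable_funeM.
move=> v _; rewrite -scale_inv ?mulr_gt0 ?enorm_ge0//; apply: kstar_le.
by rewrite mulr_ge0 ?enorm_ge0// ltW.
Qed.

Lemma mollifier_field_test eps x : 0 < eps -> field_test k (mollifier_at theta eps x).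
Proof.
move=> e0; split.
- have cB : compact [set y : Rd | forall i, x ord0 i - eps <= y ord0 i <= x ord0 i + eps].
    have := @rV_compact R d (fun i => `[x ord0 i - eps, x ord0 i + eps]%classic) (fun i => @segment_compact _ _ _).
    by congr compact; apply/seteqP; split => y /= H i; have := H i; rewrite in_itv.
  apply: subclosed_compact (mollifier_support e0); [exact: closed_msupport|exact: cB].
- have mK : measurable_fun setT (fun p : Rd * Rd => `|Kstar k p.1 p.2|)%E.
    by apply: measurableT_comp => //; exact: measurable_Kstar.
  rewrite (@ge0_integral2_mollifier eps x (fun p => `|Kstar k p.1 p.2|)%E)//.
  rewrite (_ : (\int[theta]_u _)%E = (\int[theta]_u \int[theta]_v `|kstar k (eps * enorm (u - v))|)%E).
    exact: kstar_energy.
  by apply: eq_integral => u _; apply: eq_integral => v _; rewrite -(enorm_affine _ _ x e0).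
- rewrite (_ : (\int[rho_neg _]_y _)%E = 0%E) ?ltry//.
  rewrite -[RHS](@integral_measure_zero _ Rd R setT (fun y => \int[rho_neg (mollifier_at theta eps x)]_z `|Kstar k y z|)%E).
  by apply: eq_measure_integral => A mA _; exact: (mollifier_neg _ _ _ mA).
Qed.

Lemma measurable_cut_dist s eps : 1 <= s -> 0 < eps ->
  measurable_fun setT (fun p : Rd * Rd => cut k s (eps * enorm (p.1 - p.2))).
Proof.
move=> s1 e0; have m : measurable_fun setT (fun p : Rd * Rd => eps * enorm (p.1 - p.2)).
  by apply: measurable_funM => //; exact: measurable_enormB.
have := measurableT_comp (continuous_measurable_fun (continuous_cut_norm kb s1)) m.
by apply: eq_measurable_fun => p _; rewrite /= ger0_norm ?mulr_ge0 ?enorm_ge0 ?ltW.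
Qed.

Lemma cut_bounded (s r : R) : 1 <= s -> 0 <= r -> `|cut k s r| <= B * s.
Proof.
move=> s1 r_ge; have := cut_diff kb (lexx 1) s1 r_ge; rewrite divr1.
by rewrite /cut set_itv1 [X in _ - X]/Rintegral integral_set1 subr0.
Qed.

Definition cut_energy s eps := \int[theta]_u (\int[theta]_v cut k s (eps * enorm (u - v))).

Lemma cut_integrable_dist s eps (u : Rd) : 1 <= s -> 0 < eps ->
  theta.-integrable setT (EFin \o (fun v : Rd => cut k s (eps * enorm (u - v)))).
Proof.
move=> s1 e0; apply: (@bounded_integrable _ _ _ _ _ (B * s)) => [|v].
  exact: (measurableT_comp (measurable_cut_dist s1 e0) (pair1_measurable u)).
by apply: cut_bounded => //; rewrite mulr_ge0 ?enorm_ge0// ltW.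
Qed.

Lemma cut_mean_bounded s eps (u : Rd) : 1 <= s -> 0 < eps ->
  `|\int[theta]_v cut k s (eps * enorm (u - v))| <= B * s.
Proof.
move=> s1 e0; have i := cut_integrable_dist u s1 e0.
apply: (le_trans (le_normr_Rintegral measurableT i)).
apply: (@le_trans _ _ (\int[theta]_v (B * s))).
  apply: le_Rintegral => //.
  - exact: integrable_norm.
  - by apply: (@bounded_integrable _ _ _ _ _ `|B * s|).
  - by move=> v _; apply: cut_bounded => //; rewrite mulr_ge0 ?enorm_ge0// ltW.
by rewrite Rintegral_cst//= (mollifier_mass At) mulr1.
Qed.

Lemma measurable_cut_mean s eps : 1 <= s -> 0 < eps ->
  measurable_fun setT (fun u : Rd => \int[theta]_v cut k s (eps * enorm (u - v))).
Proof.
move=> s1 e0; have H := measurable_integral_snd theta (measurable_fun_EFin (measurable_cut_dist s1 e0)).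
by apply: (@measurableT_comp _ _ _ _ _ _ (@fine R)) => //; exact: fine_measurable.
Qed.

Lemma cut_mean_integrable s eps : 1 <= s -> 0 < eps ->
  theta.-integrable setT (EFin \o (fun u : Rd => \int[theta]_v cut k s (eps * enorm (u - v)))).
Proof.
move=> s1 e0; apply: (@bounded_integrable _ _ _ _ _ (B * s)) => [|v].
  exact: measurable_cut_mean.
exact: cut_mean_bounded.
Qed.

Lemma ip_ht_h e eps x y : 0 < e <= 1 -> 0 < eps ->
  ip P (ht e y) (h (mollifier_at theta eps x)) =
  \int[theta]_v cut k e^-1 (enorm (y - (eps *: v + x))).
Proof.
move=> e1 eps0; have ft := mollifier_field_test x eps0.
have [_ _ + _] := cf; move=> /(_ e y _ e1 ft).
rewrite (covariance_ip field_space_gaussian); last 2 first.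
- exact: field_space_ht.
- exact: field_space_h.
have s1 : 1 <= e^-1 by case/andP: e1 => e0 e1; rewrite invf_ge1.
rewrite cintegral_mollifier; last first.
  apply: measurable_fun_EFin.
  have m : measurable_fun setT (fun z : Rd => enorm (y - z)).
    have := measurable_enorm_affine (-1) y; congr measurable_fun; apply/funext => z.
    by rewrite scaleN1r addrC.
  have := measurableT_comp (continuous_measurable_fun (continuous_cut_norm kb s1)) m.
  by apply: eq_measurable_fun => z _; rewrite /= ger0_norm ?enorm_ge0.
by move=> E; rewrite /Rintegral -E.
Qed.

Lemma ip_h_h eps x : 0 < eps ->
  ((ip P (h (mollifier_at theta eps x)) (h (mollifier_at theta eps x)))%:E =
  \int[theta]_u \int[theta]_v kstar k (eps * enorm (u - v)))%E.
Proof.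
move=> eps0; have ft := mollifier_field_test x eps0.
have [_ /(_ _ _ ft ft)] := sf.
rewrite (covariance_ip field_space_gaussian); last 2 first.
- exact: field_space_h.
- exact: field_space_h.
move=> ->.
have inner y : cintegral (mollifier_at theta eps x) (fun z => Kstar k y z) =
    (\int[theta]_v Kstar k y (eps *: v + x)%R)%E.
  by apply: cintegral_mollifier; exact: (measurableT_comp measurable_Kstar (pair1_measurable y)).
under eq_fun do rewrite inner.
rewrite cintegral_mollifier.
  by apply: eq_integral => u _; apply: eq_integral => v _; rewrite -(enorm_affine _ _ x eps0).
apply: (@measurable_integral_snd _ _ _ _ _ theta (fun p => Kstar k p.1 (eps *: p.2 + x)%R)).
have m2 : measurable_fun setT (fun p : Rd * Rd => (p.1, (eps *: p.2 + x)%R)).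
  apply/measurable_fun_pairP; split; first exact: measurable_fst.
  exact: (measurableT_comp (measurable_affine eps x) measurable_snd).
exact: (measurableT_comp measurable_Kstar m2).
Qed.

Lemma ip_h_h_energy s eps x (S : R) : 1 <= s -> 0 < eps ->
  (\int[theta]_u \int[theta]_v ((enorm (u - v))%:E)^-1 <= S%:E)%E ->
  `|ip P (h (mollifier_at theta eps x)) (h (mollifier_at theta eps x)) - cut_energy s eps| <=
  B * r0 / (s * eps) * S.
Proof.
move=> s1 e0 SP; have s0 : 0 < s by exact: lt_le_trans s1.
pose C := B * r0 / (s * eps).
have C0 : 0 < C by rewrite divr_gt0 ?mulr_gt0.
pose g (u : Rd) := \int[theta]_v cut k s (eps * enorm (u - v)).
have point (u v : Rd) : (`|kstar k (eps * enorm (u - v)) - (cut k s (eps * enorm (u - v)))%:E| <=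
    C%:E * ((enorm (u - v))%:E)^-1)%E.
  have [uv|uv] := eqVneq (enorm (u - v)) 0.
    by rewrite uv inve0 gt0_muley ?leey// lte_fin.
  have rp : 0 < eps * enorm (u - v).
    by rewrite mulr_gt0// lt_neqAle eq_sym uv enorm_ge0.
  have [e -> eB] := kstar_sub_cut kb s1 rp.
  rewrite -EFinB addrAC subrr add0r inver (negbTE uv) -EFinM lee_fin (le_trans eB)//.
  by rewrite le_eqVlt; apply/orP; left; apply/eqP; rewrite /C; field; rewrite uv !gt_eqF.
have mk (u : Rd) : measurable_fun setT (fun v : Rd => kstar k (eps * enorm (u - v))).
  exact: (measurableT_comp (mkstar e0) (pair1_measurable u)).
have inner (u : Rd) : (`|\int[theta]_v kstar k (eps * enorm (u - v)) - (g u)%:E| <= C%:E * N u)%E.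
  rewrite /g -(EFin_Rintegral (cut_integrable_dist u s1 e0)).
  have [Noo|Noo] := eqVneq (N u) +oo%E; first by rewrite Noo gt0_muley ?leey// lte_fin.
  have Nfin : (N u < +oo)%E by rewrite ltey.
  rewrite -ge0_integralZl//; last by rewrite lee_fin ltW.
  apply: dist_integral_le => //.
  - apply/integrableP; split => //.
    have CN : (((B * r0 / eps)%:E * N u)%E < +oo)%E.
      by rewrite lte_mul_pinfty// lee_fin divr_ge0 ?mulr_ge0 ?ltW.
    apply: le_lt_trans CN; rewrite -ge0_integralZl//; last by rewrite lee_fin divr_ge0 ?mulr_ge0 ?ltW.
    apply: ge0_le_integral => //.
    + exact: measurableT_comp.
    + exact: measurable_funeM.
    + move=> v _; rewrite -scale_inv ?mulr_gt0 ?enorm_ge0//; apply: kstar_le.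
      by rewrite mulr_ge0 ?enorm_ge0// ltW.
  - exact: cut_integrable_dist.
  - exact: measurable_funeM.
have iF : theta.-integrable setT (fun u : Rd => \int[theta]_v kstar k (eps * enorm (u - v)))%E.
  have mF := measurable_integral_snd theta (mkstar e0).
  apply/integrableP; split; first exact: mF.
  apply: le_lt_trans (kstar_energy e0); apply: ge0_le_integral => //.
  - exact: measurableT_comp.
  - have mK : measurable_fun setT (fun p : Rd * Rd => `|kstar k (eps * enorm (p.1 - p.2))|)%E.
      by apply: measurableT_comp => //; exact: mkstar.
    exact: (measurable_integral_snd _ mK).
  - by move=> u _; apply: le_abse_integral.
rewrite -lee_fin EFinM -/C; apply: (@le_trans _ _ (\int[theta]_u (C%:E * N u))%E); last first.
  rewrite ge0_integralZl//; last 2 first.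
  - by move=> u _; exact: integral_ge0.
  - by rewrite lee_fin ltW.
  by rewrite lee_pmul2l.
have := dist_integral_le iF (cut_mean_integrable s1 e0) (measurable_funeM C%:E mN) inner.
by rewrite -(ip_h_h x e0) (EFin_Rintegral (cut_mean_integrable s1 e0)).
Qed.

End field_covariances.

Section smoothed_field.
Context (R : realType) (d : nat) (dT : measure_display) (T : measurableType dT) (P : probability T R).
Local Notation Rd := 'rV[R]_d.
Variables (k : R -> R) (L B r0 : R) (h : {charge set Rd -> \bar R} -> {RV P >-> R})
  (ht : R -> Rd -> {RV P >-> R}).
Hypotheses (kb : seed_bounds k L B r0) (sf : star_scale_field k h) (cf : cutoff_field k h ht).

Let GG := field_space_gaussian cf.
Local Notation G := (field_space k h ht).

Definition cutoff (u : R) (x : Rd) : T -> R := ht (expR (- u)) x.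

Let L0 : 0 <= L. Proof. by case: kb => -[]. Qed.

Lemma cutoff_scale (u : R) : 0 <= u -> 0 < expR (- u) <= 1.
Proof. by move=> u0; rewrite expR_gt0 -[leRHS]expR0 ler_expR oppr_le0. Qed.

Lemma expR_ge1 (u : R) : 0 <= u -> 1 <= expR u.
Proof. by move=> u0; rewrite -[leLHS]expR0 ler_expR. Qed.

Lemma cutoff_G u x : 0 <= u -> G (cutoff u x).
Proof. by move=> u0; apply: field_space_ht; exact: cutoff_scale. Qed.

Lemma ip_cutoff u u' x y : 0 <= u -> 0 <= u' ->
  ip P (cutoff u x) (cutoff u' y) = cut k (expR (Num.min u u')) (enorm (x - y)).
Proof.
move=> u0 u0'; rewrite (ip_ht cf)//; try exact: cutoff_scale.
by congr (cut k _ _); case: (leP u u') => uu; [rewrite max_l|rewrite max_r];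
  rewrite ?expRN ?invrK// -!expRN ler_expR lerN2// ltW.
Qed.

Variables (t : R) (J : finType) (p : J -> Rd) (c : J -> R).
Hypotheses (c0 : forall j, 0 <= c j) (c1 : \sum_j c j = 1) (p2 : forall j i, `|p j ord0 i| <= 2).
Let eps := expR (- t).

(* A finite average in place of an integral of the cut-off field against the
   mollifier: it lies in the Gaussian space with no path regularity needed. *)
Definition smoothed (u : R) (x : Rd) (w : T) : R := \sum_j c j * cutoff u (x + eps *: p j) w.

Lemma smoothed_G u x : 0 <= u -> G (smoothed u x).
Proof. by move=> u0; apply: (gs_sum GG) => j; exact: cutoff_G. Qed.

Lemma ip_smoothed_cutoff u u' x y : 0 <= u -> 0 <= u' ->
  ip P (smoothed u x) (cutoff u' y) =
  \sum_j c j * cut k (expR (Num.min u u')) (enorm (x + eps *: p j - y)).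
Proof.
move=> u0 u0'; rewrite (ip_suml GG); [|by move=> j; exact: cutoff_G|exact: cutoff_G].
by apply: eq_bigr => j _; rewrite ip_cutoff.
Qed.

Lemma ip_smoothed u u' x y : 0 <= u -> 0 <= u' -> ip P (smoothed u x) (smoothed u' y) =
  \sum_i c i * \sum_j c j * cut k (expR (Num.min u u')) (enorm (x - y + eps *: (p j - p i))).
Proof.
move=> u0 u0'; rewrite ipC (ip_suml GG); [|by move=> j; exact: cutoff_G|exact: smoothed_G].
apply: eq_bigr => i _; rewrite ipC (ip_smoothed_cutoff x (y + eps *: p i) u0 u0'); apply: (congr1 ( *%R (c i))).
apply: eq_bigr => j _; apply: (congr1 (fun z => c j * cut k _ (enorm z))).
by rewrite scalerBr opprD addrACA.
Qed.

Lemma mean_close (f : J -> R) a b : (forall j, `|f j - a| <= b) -> `|\sum_j c j * f j - a| <= b.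
Proof.
move=> fab; rewrite -[a]mul1r -{1}c1 mulr_suml -sumrB.
apply: (le_trans (ler_norm_sum _ _ _)); rewrite -[leRHS]mul1r -c1 mulr_suml.
by apply: ler_sum => j _; rewrite -mulrBr normrM ger0_norm// ler_wpM2l.
Qed.

Lemma enorm_p j : enorm (p j) <= 2 * d%:R.
Proof.
apply: (le_trans (enorm_le_sum _)); apply: (@le_trans _ _ (\sum_(i < d) 2)).
  by apply: ler_sum => i _.
by rewrite sumr_const card_ord -[2 *+ d]mulr_natr.
Qed.

Let eps0 : 0 < eps. Proof. exact: expR_gt0. Qed.

Lemma ip_smoothed_cutoff_close u u' x y : 0 <= u -> 0 <= u' ->
  `|ip P (smoothed u x) (cutoff u' y) - Num.min u u'| <=
  L * expR (Num.min u u') * (enorm (x - y) + eps * (2 * d%:R)).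
Proof.
move=> u0 u0'; rewrite ip_smoothed_cutoff//; apply: mean_close => j.
have m0 : 0 <= Num.min u u' by rewrite le_min u0.
have := cut_le kb (expR_ge1 m0) (enorm_ge0 (x + eps *: p j - y)); rewrite expRK => /le_trans; apply.
rewrite ler_wpM2l ?mulr_ge0 ?expR_ge0// addrAC (le_trans (ler_enormD _ _))// lerD2l.
by rewrite enormZ gtr0_norm// ler_pM2l// enorm_p.
Qed.

Lemma ip_smoothed_close u x : 0 <= u ->
  `|ip P (smoothed u x) (smoothed u x) - u| <= L * expR u * (eps * (4 * d%:R)).
Proof.
move=> u0; rewrite ip_smoothed// minxx; apply: mean_close => i; apply: mean_close => j.
have := cut_le kb (expR_ge1 u0) (enorm_ge0 (x - x + eps *: (p j - p i))); rewrite expRK => /le_trans; apply.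
rewrite ler_wpM2l ?mulr_ge0 ?expR_ge0// subrr add0r enormZ gtr0_norm// ler_pM2l//.
rewrite (le_trans (ler_enormD _ _))// enormN; have := enorm_p i; have := enorm_p j; lra.
Qed.

Lemma smoothed_sub_cutoff u x : 0 <= u ->
  ip P (fun w => cutoff u x w - smoothed u x w) (fun w => cutoff u x w - smoothed u x w) <=
  L * expR u * (eps * (8 * d%:R)).
Proof.
move=> u0; have [Gc Gs] := (cutoff_G x u0, smoothed_G x u0).
have GB := gsB GG Gc Gs.
rewrite (ipBl GG)// ![ip P _ (fun w => _ - _)]ipC !(ipBl GG)// [ip P (cutoff u x) (smoothed u x)]ipC.
have cc : ip P (cutoff u x) (cutoff u x) = u.
  by rewrite ip_cutoff// minxx subrr enorm0 (cut0 kb (expR_ge1 u0)) expRK.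
have := ip_smoothed_close x u0; have := ip_smoothed_cutoff_close x x u0 u0.
rewrite minxx subrr enorm0 add0r cc !ler_norml => /andP[h1 h2] /andP[h3 h4].
move: h1 h2 h3 h4; rewrite !mulrA; move: (L * expR u * eps) => q; lra.
Qed.

Section orthogonality.
Variables (u u' : R) (x : Rd).
Hypotheses (u0 : 0 <= u) (uu' : u <= u').

Let u0' : 0 <= u'. Proof. exact: le_trans uu'. Qed.
Let zeta w := smoothed u' x w - smoothed u x w.

Lemma increment_G : G zeta.
Proof. by apply: (gsB GG); exact: smoothed_G. Qed.

Lemma increment_orth_cutoff y : orth P G zeta (cutoff u y).
Proof.
split; first exact: cutoff_G.
rewrite (ipBl GG); [|exact: smoothed_G|exact: smoothed_G|exact: cutoff_G].
by rewrite !ip_smoothed_cutoff// min_r// minxx subrr.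
Qed.

Lemma increment_orth_smoothed y : orth P G zeta (smoothed u y).
Proof.
split; first exact: smoothed_G.
rewrite (ipBl GG); [|exact: smoothed_G|exact: smoothed_G|exact: smoothed_G].
by rewrite !ip_smoothed// min_r// minxx subrr.
Qed.

Lemma increment_orth_far (y : Rd) i : u <= t -> (r0 + 4) * expR (- u) <= `|x ord0 i - y ord0 i| ->
  orth P G zeta (smoothed u' y).
Proof.
move=> ut far; split; first exact: smoothed_G.
rewrite (ipBl GG); [|exact: smoothed_G|exact: smoothed_G|exact: smoothed_G].
rewrite !ip_smoothed// minxx min_l//; apply/eqP; rewrite subr_eq0; apply/eqP.
apply: eq_bigr => j _; apply: (congr1 ( *%R (c j))); apply: eq_bigr => l _; apply: (congr1 ( *%R (c l))).
apply: (cut_local kb); rewrite ?expR_ge1 ?ler_expR ?enorm_ge0//.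
have := coord_le_enorm (x - y + eps *: (p l - p j)) i; rewrite !mxE.
set a := x ord0 i - y ord0 i in far *; set b := eps * _ => H.
have bB : `|b| <= 4 * expR (- u).
  rewrite /b normrM gtr0_norm//; apply: (@le_trans _ _ (eps * 4)).
    rewrite ler_pM2l// (le_trans (ler_normB _ _))//; have := p2 l i; have := p2 j i; lra.
  by rewrite mulrC ler_pM2l// /eps ler_expR lerN2.
have E : r0 <= expR u * (`|a| - `|b|).
  have -> : r0 = expR u * (r0 * expR (- u)) by rewrite mulrCA -expRD subrr expR0 mulr1.
  by rewrite ler_pM2l ?expR_gt0//; lra.
apply: (le_trans E); rewrite ler_pM2l ?expR_gt0// (le_trans _ H)//.
by have := lerB_normD a b; lra.
Qed.

End orthogonality.

Section mollifier_comparison.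
Variables (theta : {finite_measure set Rd -> \bar R}) (S dl : R).
Hypotheses (At : admissible_mollifier theta) (dl0 : 0 < dl).
Hypothesis SP : (\int[theta]_u \int[theta]_v ((enorm (u - v))%:E)^-1 <= S%:E)%E.
Hypothesis pc : forall (phi : Rd -> R) (M m : R), measurable_fun setT phi -> (forall u, `|phi u| <= M) ->
      (forall u v, enorm (u - v) <= dl -> `|phi u - phi v| <= m) ->
      `|\sum_j c j * phi (p j) - \int[theta]_u phi u| <= m.

Definition mollified (x : Rd) : T -> R := h (mollifier_at theta eps x).

Lemma mollified_G x : G (mollified x).
Proof. by apply: field_space_h; exact: (mollifier_field_test kb At). Qed.

Let cut_close s (v v' w : Rd) : 1 <= s -> enorm (v - v') <= dl ->
  `|cut k s (eps * enorm (v - w)) - cut k s (eps * enorm (v' - w))| <= L * s * (eps * dl).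
Proof.
move=> s1 vv'; have [e0] := (ltW eps0).
apply: (le_trans (cut_lip kb s1 (mulr_ge0 e0 (enorm_ge0 _)) (mulr_ge0 e0 (enorm_ge0 _)))).
rewrite ler_wpM2l ?mulr_ge0 ?(le_trans _ s1)// -mulrBr normrM gtr0_norm// ler_pM2l//.
apply: (le_trans (ler_dist_enorm _ _)).
by rewrite opprB addrA subrK.
Qed.

Let g s (v : Rd) := \int[theta]_z cut k s (eps * enorm (v - z)).

Let mean_energy s : 1 <= s ->
  `|\sum_j c j * g s (p j) - cut_energy k theta s eps| <= L * s * (eps * dl).
Proof.
move=> s1; apply: (pc (M := B * s)).
- exact: (measurable_cut_mean kb theta s1 eps0).
- by move=> v; exact: (cut_mean_bounded kb At v s1 eps0).
move=> v v' vv'.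
have [i i'] := (cut_integrable_dist kb theta v s1 eps0, cut_integrable_dist kb theta v' s1 eps0).
rewrite /g -(RintegralB measurableT i i').
apply: (le_trans (le_normr_Rintegral measurableT (integrableBR i i'))).
apply: (@le_trans _ _ (\int[theta]_z (L * s * (eps * dl)))).
  apply: le_Rintegral => //.
  - exact: integrable_norm (integrableBR i i').
  - by apply: (@bounded_integrable _ _ _ _ _ `|L * s * (eps * dl)|).
  - by move=> z _; exact: cut_close.
by rewrite Rintegral_cst//= (mollifier_mass At) mulr1.
Qed.

Lemma smoothed_mollified_energy u x : 0 <= u ->
  `|ip P (smoothed u x) (mollified x) - cut_energy k theta (expR u) eps| <= L * expR u * (eps * dl).
Proof.
move=> u0; have s1 := expR_ge1 u0.
rewrite (ip_suml GG); [|by move=> j; exact: cutoff_G|exact: mollified_G].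
rewrite (_ : \sum_j _ = \sum_j c j * g (expR u) (p j)); first exact: mean_energy.
apply: eq_bigr => j _; congr (c j * _).
rewrite [LHS](ip_ht_h kb cf At x (x + eps *: p j) (cutoff_scale u0) eps0).
by apply: eq_Rintegral => z _; rewrite expRN invrK [x + _]addrC (enorm_affine _ _ _ eps0).
Qed.

Lemma smoothed_energy u x : 0 <= u ->
  `|ip P (smoothed u x) (smoothed u x) - cut_energy k theta (expR u) eps| <= 2 * (L * expR u * (eps * dl)).
Proof.
move=> u0; have s1 := expR_ge1 u0; have := mean_energy s1.
set E := cut_energy _ _ _ _; set m := L * _ * _ => H.
rewrite ip_smoothed// minxx.
have H' i : `|(\sum_j c j * cut k (expR u) (enorm (x - x + eps *: (p j - p i)))) - g (expR u) (p i)| <= m.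
  rewrite (_ : \sum_j _ = \sum_j c j * (fun v : Rd => cut k (expR u) (eps * enorm (v - p i))) (p j)); last first.
    by apply: eq_bigr => j _; congr (c j * cut k _ _); rewrite subrr add0r enormZ gtr0_norm.
  rewrite /g (_ : \int[theta]_z _ = \int[theta]_z cut k (expR u) (eps * enorm (z - p i))); last first.
    by apply: eq_Rintegral => z _; rewrite enormBC.
  apply: (pc (M := B * expR u)).
  - exact: (measurableT_comp (measurable_cut_dist kb s1 eps0) (pair2_measurable (p i))).
  - by move=> v; apply: (cut_bounded kb s1); rewrite mulr_ge0 ?enorm_ge0// ltW.
  - by move=> v v' vv'; exact: cut_close.
have H2 : `|\sum_i c i * (\sum_j c j * cut k (expR u) (enorm (x - x + eps *: (p j - p i)))) -
    \sum_i c i * g (expR u) (p i)| <= m.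
  rewrite -sumrB (_ : \sum_i _ = \sum_i c i * ((\sum_j c j * cut k (expR u) (enorm (x - x + eps *: (p j - p i)))) - g (expR u) (p i)) - 0); last first.
    by rewrite subr0; apply: eq_bigr => i _; rewrite mulrBr.
  by apply: mean_close => i; rewrite subr0.
rewrite (le_trans (ler_distD (\sum_i c i * g (expR u) (p i)) _ _))//; lra.
Qed.

Lemma mollified_sub_smoothed u x : 0 <= u ->
  ip P (fun w => smoothed u x w - mollified x w) (fun w => smoothed u x w - mollified x w) <=
  B * r0 / (expR u * eps) * S + 4 * (L * expR u * (eps * dl)).
Proof.
move=> u0; have [Gs Gm] := (smoothed_G x u0, mollified_G x).
have GB := gsB GG Gs Gm.
rewrite (ipBl GG)// ![ip P _ (fun w => _ - _)]ipC !(ipBl GG)// [ip P (mollified x) (smoothed u x)]ipC.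
have := ip_h_h_energy kb sf cf At x (expR_ge1 u0) eps0 SP; rewrite -/(mollified x).
have := smoothed_energy x u0; have := smoothed_mollified_energy x u0.
by rewrite !ler_norml => /andP[h1 h2] /andP[h3 h4] /andP[h5 h6]; lra.
Qed.

Lemma mollified_close u x : 0 <= u ->
  `|ip P (mollified x) (mollified x) - ip P (smoothed u x) (smoothed u x)| <=
  B * r0 / (expR u * eps) * S + 2 * (L * expR u * (eps * dl)).
Proof.
move=> u0; have := ip_h_h_energy kb sf cf At x (expR_ge1 u0) eps0 SP; rewrite -/(mollified x).
have := smoothed_energy x u0.
by rewrite !ler_norml => /andP[h1 h2] /andP[h3 h4]; apply/andP; split; lra.
Qed.

End mollifier_comparison.

End smoothed_field.

(** * Comparison of random measures *)

Section eventually.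
Context (R : realType).

Lemma near_expR_small (a C e : R) : 0 < a -> 0 < e -> \forall l \near +oo, C * expR (- (a * l)) <= e.
Proof.
move=> a0 e0; near=> l.
have l0 : `|C| / (a * e) <= l by near: l; apply: nbhs_pinfty_ge; exact: num_real.
have h : `|C| <= e * expR (a * l).
  have := expR_ge1Dx (a * l); rewrite -(ler_pM2l e0) => H.
  apply: le_trans H; move: l0; rewrite ler_pdivrMr ?mulr_gt0//.
  by have := e0; lra.
rewrite expRN -[_ * _^-1]/(_ / _) ler_pdivrMr ?expR_gt0// (le_trans _ h)//.
exact: ler_norm.
Unshelve. all: by end_near. Qed.

Lemma near_linear_expR (C b : R) : 0 < b -> \forall l \near +oo, C * l <= b * expR l.
Proof.
move=> b0; near=> l.
have l0 : 0 <= l by near: l; apply: nbhs_pinfty_ge; exact: num_real.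
have l1 : 2 * `|C| / b <= l by near: l; apply: nbhs_pinfty_ge; exact: num_real.
have := expR_ge1Dxn 1 l0; rewrite -(ler_pM2l b0) => H; apply: le_trans H.
apply: (@le_trans _ _ (`|C| * l)); first by rewrite ler_wpM2r// ler_norm.
have : 2 * `|C| * l <= b * l ^+ 2 by move: l1; rewrite ler_pdivrMr// => l1; rewrite expr2; nra.
by rewrite /= (_ : (2`!)%:R = 2 :> R)//; rewrite expr2; lra.
Unshelve. all: by end_near. Qed.

Lemma cvge0_near (T : Type) (F : set_system T) {FF : Filter F} (f : T -> \bar R) :
  (forall x, 0 <= f x)%E ->
  (forall e : R, 0 < e -> \forall x \near F, (f x <= e%:E)%E) -> f @ F --> 0%E.
Proof.
move=> f0 H; apply/fine_cvgP; split.
  near=> x; rewrite ge0_fin_numE//; apply: (@le_lt_trans _ _ 1%:E); last by rewrite ltry.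
  by near: x; exact: H.
apply/cvgrPdist_le => e e0; near=> x.
have fx : (f x <= e%:E)%E by near: x; exact: H.
rewrite sub0r normrN ger0_norm ?fine_ge0// -lee_fin fineK//.
by rewrite ge0_fin_numE// (le_lt_trans fx)// ltry.
Unshelve. all: by end_near. Qed.

Lemma cvge0_small (T : Type) (F : set_system T) {FF : Filter F} (f : T -> \bar R) (e : R) :
  (forall x, 0 <= f x)%E -> f @ F --> 0%E -> 0 < e -> \forall x \near F, (f x <= e%:E)%E.
Proof.
move=> f0 /fine_cvgP[ff /cvgrPdist_le/(_ e) H] e0; near=> x.
have fx : f x \is a fin_num by near: x.
have : `|0 - fine (f x)| <= e by near: x; exact: H.
by rewrite sub0r normrN ger0_norm ?fine_ge0// -lee_fin fineK.
Unshelve. all: by end_near. Qed.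

End eventually.

Section closeness.
Context (R : realType) (d : nat) (dT : measure_display) (T : measurableType dT) (P : probability T R).
Local Notation Rd := 'rV[R]_d.
Local Notation m := (lebesgue_rV (R := R) d).
Variables (g : Rd -> R) (M A : R).
Hypotheses (mg : measurable_fun setT g) (gM : forall x, `|g x| <= M) (A0 : 0 < A).

Definition box : set Rd := [set x | forall i, - A <= x ord0 i <= A].

Hypothesis g_out : forall x, ~ box x -> g x = 0.

Let b : R := (2 * A) ^+ d.

Let b0 : 0 < b. Proof. by rewrite exprn_gt0// mulr_gt0. Qed.

Lemma measurable_cube : measurable box. Proof. exact: measurable_box. Qed.

Lemma box_volume : m box = b%:E.
Proof.
rewrite /box (lebesgue_rV_box (a := fun=> - A) (b := fun=> A)); last by move=> i /=; have := A0; lra.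
by rewrite prodr_const card_ord; congr ((_ ^+ _)%:E); lra.
Qed.

Let M0 : 0 <= M. Proof. exact: le_trans (gM 0). Qed.

Definition close_fields (eta e : R) (F F' : Rd -> T -> R) := exists E, [/\ measurable E, (P E <= e%:E)%E &
  forall w, ~ E w -> `|\int[m]_x (g x * F x w) - \int[m]_x (g x * F' x w)| <= eta].

Lemma close_fields_trans eta eta' e e' F F' F'' : close_fields eta e F F' -> close_fields eta' e' F' F'' ->
  close_fields (eta + eta') (e + e') F F''.
Proof.
move=> [E [mE PE H]] [E' [mE' PE' H']]; exists (E `|` E'); split; first exact: measurableU.
  by rewrite (le_trans (measureU2 P mE mE'))// EFinD leeD.
move=> w /not_orP[/H h /H' h']; rewrite (le_trans (ler_distD (\int[m]_x (g x * F' x w)) _ _))//; exact: lerD.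
Qed.

Lemma box_moment (F : Rd -> T -> R) (c : R) : random_field F -> 0 <= c ->
  (forall x, P.-integrable setT (EFin \o F x) /\ \int[P]_w `|F x w| <= c) ->
  (\int[m]_x \int[P]_w `|g x * F x w|%:E <= (M * c * b)%:E)%E.
Proof.
move=> mF c0 Fc.
have mgF : random_field (fun x w => g x * F x w).
  by apply: measurable_funM => //; exact: (measurableT_comp mg).
have mn : random_field (fun x w => `|g x * F x w|).
  exact: (measurableT_comp (@normr_measurable R setT) mgF).
apply: (@le_trans _ _ (\int[m]_x (((M * c)%:E) * (\1_box x)%:E))%E).
  apply: ge0_le_integral => //.
  - by move=> x _; apply: integral_ge0 => w _; rewrite lee_fin.
  - apply: (@measurable_fun_fubini_tonelli_G _ _ _ _ _ P (fun p => `|g p.2 * F p.2 p.1|%:E)).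
      exact: measurable_fun_EFin.
    by move=> q; rewrite lee_fin.
  - by apply: measurable_funeM; apply: measurable_fun_EFin; apply: measurable_indic; exact: measurable_cube.
  - move=> x _; have [Bx|Bx] := pselect (box x); last first.
      rewrite (eq_integral (fun=> 0%E)); last by move=> w _; rewrite g_out// mul0r normr0.
      by rewrite integral0 indicE memNset//= mule0.
    rewrite indicE mem_set//= mule1; have [iF EF] := Fc x.
    under eq_integral do rewrite normrM EFinM.
    rewrite ge0_integralZl//; last by apply: measurable_fun_EFin; apply: (measurableT_comp (@normr_measurable R setT)); exact: (random_field_at x mF).
    rewrite (EFin_Rintegral (integrable_norm iF)) -EFinM lee_fin.
    by apply: ler_pM => //; apply: Rintegral_ge0 => w _; exact: normr_ge0.
rewrite ge0_integralZl//; last 2 first.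
- by apply: measurable_fun_EFin; apply: measurable_indic; exact: measurable_cube.
- by rewrite lee_fin mulr_ge0.
rewrite integral_indic//; last exact: measurable_cube.
by rewrite setIT [X in (_ * X)%E](_ : _ = b%:E)//; exact: box_volume.
Qed.

Lemma integrable_paths (F : Rd -> T -> R) (c e : R) : random_field F -> 0 <= c -> 0 < e ->
  (forall x, P.-integrable setT (EFin \o F x) /\ \int[P]_w `|F x w| <= c) ->
  exists E, [/\ measurable E, (P E <= e%:E)%E & forall w, ~ E w -> m.-integrable setT (EFin \o (fun x => g x * F x w))].
Proof.
move=> mF c0 e0 Fc.
have mgF : random_field (fun x w => g x * F x w).
  by apply: measurable_funM => //; exact: (measurableT_comp mg).
have a0 : 0 < M * c * b / e + 1 by rewrite ltr_wpDl// divr_ge0 ?(ltW e0)// mulr_ge0 ?(ltW b0)// mulr_ge0.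
have [E [mE PE H]] := first_moment_event mgF (box_moment mF c0 Fc) a0.
exists E; split => //; last by move=> w /H[].
rewrite (le_trans PE)// lee_fin ler_pdivrMr// mulrDr mulr1 [e * (_ / e)]mulrC divfK ?gt_eqF//.
by rewrite lerDl ltW.
Qed.

Lemma close_fields_L1 (F F' : Rd -> T -> R) (c r eta e : R) : random_field F -> random_field F' ->
  0 <= c -> 0 <= r -> 0 < eta -> 0 < e ->
  (forall x, P.-integrable setT (EFin \o F x) /\ \int[P]_w `|F x w| <= c) ->
  (forall x, P.-integrable setT (EFin \o F' x) /\ \int[P]_w `|F' x w| <= c) ->
  (forall x, \int[P]_w `|F x w - F' x w| <= r) ->
  3 * (M * r * b) <= eta * e -> close_fields eta e F F'.
Proof.
move=> mF mF' c0 r0 eta0 e0 Fc Fc' Fr small.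
have e3 : 0 < e / 3 by rewrite divr_gt0.
have [E1 [mE1 PE1 H1]] := integrable_paths mF c0 e3 Fc.
have [E2 [mE2 PE2 H2]] := integrable_paths mF' c0 e3 Fc'.
have mD : random_field (fun x w => F x w - F' x w) by exact: measurable_funB.
have Dr x : P.-integrable setT (EFin \o (fun w => F x w - F' x w)) /\ \int[P]_w `|F x w - F' x w| <= r.
  by split => //; exact: (integrableBR (Fc x).1 (Fc' x).1).
have mgD : random_field (fun x w => g x * (F x w - F' x w)).
  by apply: measurable_funM => //; exact: (measurableT_comp mg).
have [E3 [mE3 PE3 H3]] := first_moment_event mgD (box_moment mD r0 Dr) eta0.
exists (E1 `|` E2 `|` E3); split; first by do 2 apply: measurableU => //.
  have -> : e = e / 3 + e / 3 + e / 3 by field.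
  rewrite !EFinD (le_trans (measureU2 P (measurableU _ _ mE1 mE2) mE3))//.
  apply: leeD; first by rewrite (le_trans (measureU2 P mE1 mE2))// leeD.
  by rewrite (le_trans PE3)// lee_fin ler_pdivrMr//; lra.
move=> w /not_orP[/not_orP[/H1 i1 /H2 i2] /H3[i3 D3]].
rewrite -(RintegralB measurableT i1 i2).
rewrite (_ : \int[m]_x (g x * F x w - g x * F' x w) = \int[m]_x (g x * (F x w - F' x w))); last first.
  by apply: eq_Rintegral => x _; rewrite mulrBr.
exact: (le_trans (le_normr_Rintegral measurableT i3)).
Qed.

End closeness.

Lemma exists_union_event (R : realType) (dT : measure_display) (T : measurableType dT) (P : probability T R) (I : finType) (F : I -> set T) (b' : R) : (forall i, measurable (F i)) ->
  (forall i, (P (F i) <= b'%:E)%E) ->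
  exists E, [/\ measurable E, (P E <= (#|I|%:R * b')%:E)%E & forall i, F i `<=` E].
Proof.
move=> mF Fb.
have [E [mE PE H]] : exists E, [/\ measurable E, (P E <= ((size (enum I))%:R * b')%:E)%E & forall i, i \in enum I -> F i `<=` E].
  elim: (enum I) => [|i r [E [mE PE H]]]; first by exists set0; rewrite measure0 mul0r.
  exists (F i `|` E); split; first exact: measurableU.
    rewrite (le_trans (measureU2 P (mF i) mE))// /= -add1n natrD [(1 + _) * _]mulrDl mul1r EFinD; exact: leeD.
  by move=> j; rewrite inE => /predU1P[->|/H h] w Fw; [left|right; exact: h].
by exists E; split => // [|i]; [rewrite cardE|exact: H (mem_enum _ _)].
Qed.

Section change_of_scale.
Context (R : realType) (d : nat) (dT : measure_display) (T : measurableType dT) (P : probability T R).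
Local Notation Rd := 'rV[R]_d.
Local Notation m := (lebesgue_rV (R := R) d).
Variables (k : R -> R) (L B r0 : R) (h : {charge set Rd -> \bar R} -> {RV P >-> R})
  (ht : R -> Rd -> {RV P >-> R}).
Hypotheses (kb : seed_bounds k L B r0) (cf : cutoff_field k h ht) (d_gt0 : (0 < d)%N).

Let GG := field_space_gaussian cf.
Local Notation G := (field_space k h ht).

Local Notation gm := (sqrt2d d : R).

Lemma sqrt2d_gt0 : 0 < gm.
Proof. by rewrite sqrtr_gt0 mulr_gt0// ltr0n. Qed.

Lemma sqr_sqrt2d : gm ^+ 2 = 2 * d%:R.
Proof. by rewrite sqr_sqrtr// mulr_ge0. Qed.

Let L0 : 0 <= L. Proof. by case: kb => -[]. Qed.
Let r00 : 0 < r0. Proof. by case: kb => -[]. Qed.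

Variables (t : R) (J : finType) (p : J -> Rd) (c : J -> R).
Hypotheses (c0 : forall j, 0 <= c j) (c1 : \sum_j c j = 1) (p2 : forall j i, `|p j ord0 i| <= 2).

Local Notation Zh := (smoothed ht t p c).

Lemma measurable_cutoff u : 0 <= u -> random_field (fun x => cutoff ht u x).
Proof. by move=> u0; have [_ _ _ H] := cf; apply: H; exact: cutoff_scale. Qed.

Lemma measurable_smoothed u : 0 <= u -> random_field (fun x => Zh u x).
Proof.
move=> u0; apply: measurable_sum => j; apply: measurable_funM => //.
have mx : measurable_fun setT (fun q : T * Rd => (q.1, q.2 + expR (- t) *: p j)).
  apply/measurable_fun_pairP; split; first exact: measurable_fst.
  exact: (measurableT_comp (measurable_funPT (translation (expR (- t) *: p j))) measurable_snd).
exact: (measurableT_comp (measurable_cutoff u0) mx).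
Qed.

Definition smoothed_variance u := ip P (Zh u 0) (Zh u 0).

Lemma smoothed_varianceE u x : 0 <= u -> ip P (Zh u x) (Zh u x) = smoothed_variance u.
Proof.
move=> u0; rewrite /smoothed_variance (ip_smoothed cf t p c x x u0 u0).
by rewrite (ip_smoothed cf t p c 0 0 u0 u0) !subrr.
Qed.

Definition smoothed_derivative u (x : Rd) (w : T) := dens gm (smoothed_variance u) (Zh u x w).

Lemma measurable_smoothed_derivative u : 0 <= u -> random_field (smoothed_derivative u).
Proof. by move=> u0; apply: (measurableT_comp (measurable_dens _ _)); exact: measurable_smoothed. Qed.

Lemma smoothed_derivative_norm u x : 0 <= u -> P.-integrable setT (EFin \o smoothed_derivative u x) /\
  \int[P]_w `|smoothed_derivative u x w| <= (1 + smoothed_variance u) / 2.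
Proof.
move=> u0; have Gs := smoothed_G cf t p c x u0; split; first exact: (dens_integrable GG).
by rewrite /smoothed_derivative -(smoothed_varianceE x u0); exact: (dens_norm GG sqrt2d_gt0).
Qed.

Variables (g : Rd -> R) (M A : R).
Hypotheses (mg : measurable_fun setT g) (gM : forall x, `|g x| <= M) (A0 : 0 < A).
Hypothesis g_out : forall x, ~ box A x -> g x = 0.

Let b : R := (2 * A) ^+ d.
Let b0 : 0 < b. Proof. by rewrite exprn_gt0// mulr_gt0. Qed.
Let M0 : 0 <= M. Proof. exact: le_trans (gM 0). Qed.

Variables (u u' K bb : R).
Hypotheses (u0 : 0 < u) (uu' : u <= u') (ut : u <= t) (K0 : 0 <= K) (bb0 : 0 <= bb).
Hypotheses (vu : smoothed_variance u <= u + bb) (vu' : smoothed_variance u' <= u + bb).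
Hypothesis Ku : K <= gm * u / 2.

Let ug0 := ltW u0.
Let ug0' : 0 <= u'. Proof. exact: le_trans uu'. Qed.

Let dl := expR (- u).
Let N := (Num.truncn (2 * A / dl)).+1.
Let s := gm * u - K.

Let dl0 : 0 < dl. Proof. exact: expR_gt0. Qed.

Let N_gt : 2 * A < dl * N%:R.
Proof.
have e2 : 0 <= 2 * A / dl by rewrite divr_ge0 ?mulr_ge0 ?ltW.
by rewrite [dl * _]mulrC -ltr_pdivrMr// /N; have /andP[] := truncn_itv e2.
Qed.

Let N_le : N%:R <= (2 * A + 1) * expR u.
Proof.
have e2 : 0 <= 2 * A / dl by rewrite divr_ge0 ?mulr_ge0 ?ltW.
have /andP[h1 _] := truncn_itv e2; rewrite /N -natr1 [(2 * A + 1) * _]mulrDl mul1r lerD//.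
  by move: h1; rewrite /dl expRN invrK.
exact: expR_ge1.
Qed.

Let q := @grid R d (- A) dl N.
Let cl := @cell R d (- A) dl N.

(* The barrier is imposed at the grid point of the cell of [x], on the cut-off
   field at scale exp(-u) only. *)
Definition grid_barrier (x : Rd) (w : T) : R := \sum_j \1_(cl j) x * barrier s (cutoff ht u (q j) w).

Lemma grid_barrierE x : box A x -> exists2 j, enorm (x - q j) <= d%:R * dl &
  forall w, grid_barrier x w = barrier s (cutoff ht u (q j) w).
Proof.
move=> Bx; have [j xj] : exists j, cl j x.
  by apply: cell_cover => // i; have /andP[h1 h2] := Bx i; apply/andP; split => //; have := N_gt; lra.
exists j; last by move=> w; exact: (cell_sum dl0 (fun j => barrier s (cutoff ht u (q j) w)) xj).
apply: (le_trans (enorm_le_sum _)); apply: (@le_trans _ _ (\sum_(i < d) dl)).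
  by apply: ler_sum => i _; rewrite !mxE; have := cell_grid i xj; rewrite mxE.
by rewrite sumr_const card_ord mulr_natl.
Qed.

Lemma measurable_grid_barrier : random_field grid_barrier.
Proof.
apply: measurable_sum => j; apply: measurable_funM.
  have mI : measurable_fun setT (\1_(cl j) : Rd -> R) by apply: measurable_indic; exact: measurable_cell.
  exact: (measurableT_comp mI measurable_snd).
apply: (measurableT_comp (f := barrier s)); first by case: (expgrowth_barrier s).
exact: (measurableT_comp (measurable_funPT _) measurable_fst).
Qed.

Let C3 := 3 * L * d%:R.
Let bound := 128 / gm ^+ 2 * expR (gm ^+ 2 / 2 * u + 2 * gm ^+ 2 * bb + 4 * gm ^+ 2 * C3 - gm / 2 * K).

Let expbdd_sq v Z S : G Z -> G S -> expbdd G (fun w => dens gm v (Z w) ^+ 2 * barrier s (S w)).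
Proof.
move=> GZ GS; apply: (expbddM GG); last exact: (expbdd_fun GG GS (expgrowth_barrier _)).
have H := expbdd_fun GG GZ (expgrowth_dens gm v).
by under eq_fun do rewrite expr2; exact: (expbddM GG H H).
Qed.

Let one v x j : 0 <= v -> enorm (x - q j) <= d%:R * dl -> u <= v -> smoothed_variance v <= u + bb ->
  \int[P]_w (smoothed_derivative v x w ^+ 2 * barrier s (cutoff ht u (q j) w)) <= bound / 4.
Proof.
move=> v0 xj uv vv; have Gs := smoothed_G cf t p c x v0; have Gc := cutoff_G k h ht (q j) ug0.
have cc : ip P (cutoff ht u (q j)) (cutoff ht u (q j)) = u.
  by rewrite (ip_cutoff cf)// minxx subrr enorm0 (cut0 kb (expR_ge1 ug0)) expRK.
have := smoothed_varianceE x v0; move: vv => /[swap] <- vv.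
have cl3 : `|ip P (Zh v x) (cutoff ht u (q j)) - u| <= C3.
  have := ip_smoothed_cutoff_close kb cf t c0 c1 p2 x (q j) v0 ug0; rewrite min_r// => /le_trans; apply.
  rewrite /C3 -[3 * L * _](_ : L * expR u * (3 * d%:R * dl) = _); last first.
    by rewrite /dl expRN; field; rewrite gt_eqF// expR_gt0.
  rewrite ler_wpM2l ?mulr_ge0 ?expR_ge0//.
  have : expR (- t) * (2 * d%:R) <= dl * (2 * d%:R).
    by rewrite ler_wpM2r ?mulr_ge0// ler_expR lerN2.
  lra.
have := dens_barrier GG sqrt2d_gt0 Gs Gc cc vv cl3 bb0 K0.
rewrite /smoothed_derivative -(smoothed_varianceE x v0) => /le_trans; apply.
by rewrite /bound le_eqVlt; apply/orP; left; apply/eqP; field; rewrite gt_eqF// sqrt2d_gt0.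
Qed.

Let sum_quarter (y z v : R) : y <= v / 4 -> z <= v / 4 -> 2 * (y + z) <= v.
Proof. by lra. Qed.

Let sqrB_barrier (y z v : R) :
  (y - z) ^+ 2 * barrier s v <= 2 * (y ^+ 2 * barrier s v + z ^+ 2 * barrier s v).
Proof.
have : 0 <= barrier s v by rewrite /barrier.
rewrite -mulrDl mulrA => s0; apply: ler_wpM2r => //.
by have := sqr_ge0 (y + z); rewrite !expr2; lra.
Qed.

Definition increment (x : Rd) (w : T) := g x * (smoothed_derivative u' x w - smoothed_derivative u x w) * grid_barrier x w.

Lemma increment_second_moment x : (\int[P]_w (increment x w ^+ 2)%:E <= (M ^+ 2 * bound)%:E)%E.
Proof.
have bd0 : 0 <= bound by rewrite mulr_ge0 ?expR_ge0// divr_ge0 ?sqr_ge0.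
have [Bx|Bx] := pselect (box A x); last first.
  rewrite (eq_integral (fun=> 0%E)); last by move=> w _; rewrite /increment g_out// !mul0r expr0n.
  by rewrite integral0 lee_fin mulr_ge0 ?sqr_ge0.
have [j xj bE] := grid_barrierE Bx.
have Gc := cutoff_G k h ht (q j) ug0.
pose F v w := smoothed_derivative v x w ^+ 2 * barrier s (cutoff ht u (q j) w).
have eF v : 0 <= v -> expbdd G (F v) by move=> v0; apply: expbdd_sq => //; exact: smoothed_G.
have [i1 i2] := (expbdd_integrable GG (eF _ ug0), expbdd_integrable GG (eF _ ug0')).
apply: (@le_trans _ _ (\int[P]_w (M ^+ 2 * (2 * (F u' w + F u w)))%:E)%E).
  apply: ge0_le_integral => //.
  - by move=> w _; rewrite lee_fin sqr_ge0.
  - apply: measurable_fun_EFin; apply: measurable_funX; apply: measurable_funM; last exact: (random_field_at x measurable_grid_barrier).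
    apply: measurable_funM => //; apply: measurable_funB.
      exact: (random_field_at x (measurable_smoothed_derivative ug0')).
    exact: (random_field_at x (measurable_smoothed_derivative ug0)).
  - by apply: measurable_fun_EFin; do 2 apply: measurable_funM => //; apply: measurable_funD; [case: (eF _ ug0')|case: (eF _ ug0)].
  - move=> w _; rewrite lee_fin /increment bE /F.
    have -> : (g x * (smoothed_derivative u' x w - smoothed_derivative u x w) * barrier s (cutoff ht u (q j) w)) ^+ 2 =
        g x ^+ 2 * ((smoothed_derivative u' x w - smoothed_derivative u x w) ^+ 2 * barrier s (cutoff ht u (q j) w)).
      by rewrite !exprMn mulrA /barrier; case: (_ <= _)%R; rewrite ?expr1n// expr0n.
    apply: ler_pM; rewrite ?sqr_ge0//.
    + by rewrite mulr_ge0 ?sqr_ge0// /barrier.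
    + by rewrite -[g x ^+ 2]real_normK ?num_real// ler_pXn2r// nnegrE.
rewrite (EFin_Rintegral (integrableZlR (M ^+ 2) (integrableZlR 2 (integrableDR i2 i1)))) lee_fin.
rewrite (RintegralZl _ measurableT (integrableZlR 2 (integrableDR i2 i1))).
rewrite (RintegralZl _ measurableT (integrableDR i2 i1)) (RintegralD measurableT i2 i1).
rewrite ler_wpM2l ?sqr_ge0//.
have o' : \int[P]_w F u' w <= bound / 4 := one ug0' xj uu' vu'.
have o : \int[P]_w F u w <= bound / 4 := one ug0 xj (lexx u) vu.
exact: (sum_quarter o' o).
Qed.

Lemma increment_far x y i : box A x -> box A y -> (r0 + 4) * dl <= `|x ord0 i - y ord0 i| ->
  \int[P]_w (increment x w * increment y w) = 0.
Proof.
move=> Bx By far.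
have [j _ bx] := grid_barrierE Bx; have [l _ by_] := grid_barrierE By.
have Gz := increment_G cf t p c x ug0 uu'.
have oS := increment_orth_cutoff cf t p c x ug0 uu'.
have oZ := increment_orth_smoothed cf t p c x ug0 uu'.
have oF := increment_orth_far kb cf c p2 ug0 uu' ut far.
set zeta := (fun w => Zh u' x w - Zh u x w) in Gz oS oZ oF.
have vE : smoothed_variance u' = smoothed_variance u + ip P zeta zeta.
  rewrite -(smoothed_varianceE x ug0') -(smoothed_varianceE x ug0).
  have := ip_comb GG 1 1 (smoothed_G cf t p c x ug0) Gz.
  have -> : (fun w => 1 * Zh u x w + 1 * zeta w) = Zh u' x.
    by apply/funext => w; rewrite !mul1r /zeta addrC subrK.
  by move=> ->; rewrite [ip P _ zeta]ipC (oZ x).2; ring.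
have H := dens_orthogonal GG sqrt2d_gt0 (smoothed_variance u) Gz (oZ x) (oS (q j)) (oS (q l)) oF (oZ y)
  (expgrowth_barrier s) (expgrowth_barrier s) (expgrowth_dens gm (smoothed_variance u')) (expgrowth_dens gm (smoothed_variance u)).
pose X z l' w := (smoothed_derivative u' z w - smoothed_derivative u z w) * barrier s (cutoff ht u (q l') w).
have eX z l' : expbdd G (X z l').
  apply: (expbddM GG); last by apply: (expbdd_fun GG) (expgrowth_barrier s); exact: cutoff_G.
  have e1 := expbdd_fun GG (smoothed_G cf t p c z ug0') (expgrowth_dens gm (smoothed_variance u')).
  have e2 := expbdd_fun GG (smoothed_G cf t p c z ug0) (expgrowth_dens gm (smoothed_variance u)).
  have := expbddD e1 (expbddZ GG (-1) e2).
  by under [X in expbdd G X -> _]eq_fun do rewrite mulN1r.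
have XX : \int[P]_w (X x j w * X y l w) = 0.
  rewrite -[RHS]H; apply: eq_Rintegral => w _; rewrite /X /smoothed_derivative vE.
  have -> : Zh u' x w = Zh u x w + zeta w by rewrite /zeta addrC subrK.
  by rewrite -vE.
have iXX := expbdd_integrable GG (expbddM GG (eX x j) (eX y l)).
transitivity (g x * g y * \int[P]_w (X x j w * X y l w)); last by rewrite XX mulr0.
rewrite -(RintegralZl _ measurableT iXX).
apply: eq_Rintegral => w _; rewrite /increment bx by_ /X.
by move: (g x) (g y) (barrier _ _) (barrier _ _) (smoothed_derivative _ _ _ - _) (smoothed_derivative _ _ _ - _); clear => *; ring.
Qed.

Let viol := (2 * A + 1) ^+ d * (2 * Num.sqrt u / (gm * u)) * expR (gm * K).

Lemma barrier_violation : exists E, [/\ measurable E, (P E <= viol%:E)%E &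
  forall w, ~ E w -> forall j, cutoff ht u (q j) w <= s].
Proof.
have g0 := sqrt2d_gt0.
have gu : 0 < gm * u by rewrite mulr_gt0.
have s0 : gm * u / 2 <= s by rewrite /s; have := Ku; lra.
have s1 : 0 < s by apply: lt_le_trans s0; rewrite divr_gt0.
pose b' := 2 * Num.sqrt u / (gm * u) * expR (gm * K - d%:R * u).
have [||E [mE PE H]] := @exists_union_event _ _ _ P _ (fun j => [set w | s < cutoff ht u (q j) w]) b'.
- move=> j; have mc : measurable_fun setT (cutoff ht u (q j)) by exact: measurable_funPT.
  have := mc measurableT `]s, +oo[%classic (measurable_itv _); rewrite setTI.
  by congr (measurable _); apply/seteqP; split => w /=; rewrite in_itv/= andbT.
- move=> j; have Gc := cutoff_G k h ht (q j) ug0.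
  have cc : ip P (cutoff ht u (q j)) (cutoff ht u (q j)) = u.
    by rewrite (ip_cutoff cf)// minxx subrr enorm0 (cut0 kb (expR_ge1 ug0)) expRK.
  have c0' : 0 < ip P (cutoff ht u (q j)) (cutoff ht u (q j)) by rewrite cc.
  apply: (le_trans (gs_tail GG Gc c0' s1)); rewrite cc lee_fin /b'.
  apply: ler_pM; rewrite ?expR_ge0 ?divr_ge0 ?sqrtr_ge0 ?(ltW s1)//.
    rewrite ler_pdivrMr// mulrAC ler_pdivlMr//.
    have := sqrtr_ge0 u; move: (Num.sqrt u) s0 => z s0 z0; nra.
  rewrite ler_expR lerNl ler_pdivlMr; last by rewrite mulr_gt0.
  have := sqr_sqrt2d; rewrite /s; have := sqr_ge0 K; move: (sqrt2d d : R) => z; rewrite !expr2; nra.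
exists E; split => //; last by move=> w Ew j; rewrite leNgt; apply/negP => h'; exact: Ew (H j w h').
apply: (le_trans PE); rewrite lee_fin card_ffun !card_ord /viol /b'.
have -> : expR (gm * K - d%:R * u) = expR (gm * K) / expR u ^+ d.
  by rewrite expRD expRN mulrC expRM_natl mulrC.
have e0 : expR u ^+ d != 0 by rewrite gt_eqF// exprn_gt0// expR_gt0.
have h0 : 0 <= 2 * Num.sqrt u / (gm * u) * expR (gm * K) / expR u ^+ d.
  by rewrite !divr_ge0 ?mulr_ge0 ?expR_ge0 ?exprn_ge0 ?sqrtr_ge0// ?invr_ge0 ltW.
have hN : (N%:R : R) ^+ d <= ((2 * A + 1) * expR u) ^+ d.
  by apply: lerXn2r; rewrite ?nnegrE ?mulr_ge0 ?expR_ge0// addr_ge0// mulr_ge0// ltW.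
rewrite natrX [(_ / _) * (_ / _)]mulrA; apply: (le_trans (ler_wpM2r h0 hN)).
by rewrite exprMn le_eqVlt; apply/orP; left; apply/eqP; field; rewrite e0 !gt_eqF.
Qed.

Let rho := (r0 + 4) * dl.
Let nearby (y : Rd) : set Rd := [set x | forall i, y ord0 i - rho <= x ord0 i <= y ord0 i + rho].

Let incrementE x w : (forall j, cutoff ht u (q j) w <= s) ->
  g x * smoothed_derivative u' x w - g x * smoothed_derivative u x w = increment x w.
Proof.
move=> h1; rewrite /increment.
move: (smoothed_derivative u' x w) (smoothed_derivative u x w) => D' D.
have [Bx|Bx] := pselect (box A x); last by rewrite (g_out Bx) !mul0r subrr.
have [j _ ->] := grid_barrierE Bx.
by rewrite /barrier h1 mulr1 mulrBr.
Qed.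

Lemma change_of_scale_close eta e : 0 < eta -> 0 < e ->
  close_fields P g eta (viol + M ^+ 2 * bound * (2 * rho) ^+ d * b / eta ^+ 2 + e + e)
    (smoothed_derivative u') (smoothed_derivative u).
Proof.
move=> eta0 e0.
have rho0 : 0 < rho by rewrite mulr_gt0// addr_gt0.
have mi : random_field increment.
  apply: measurable_funM; last exact: measurable_grid_barrier.
  apply: measurable_funM; first exact: (measurableT_comp mg).
  by apply: measurable_funB; exact: measurable_smoothed_derivative.
have [E1 [mE1 PE1 H1]] := barrier_violation.
have [|||||||||E2 [mE2 PE2 H2]] := @second_moment_event _ _ _ _ _ P m increment (box A) nearby b (M ^+ 2 * bound) ((2 * rho) ^+ d) eta mi.
- exact: measurable_cube.
- exact: box_volume.
- exact: b0.
- by move=> y w By; rewrite /increment g_out// !mul0r.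
- exact: increment_second_moment.
- by move=> y; exact: measurable_box.
- move=> y _; rewrite /nearby (lebesgue_rV_box (a := fun i => y ord0 i - rho) (b := fun i => y ord0 i + rho)); last by move=> i /=; lra.
  rewrite lee_fin (eq_bigr (fun=> 2 * rho)); last by move=> i _; ring.
  by rewrite prodr_const card_ord.
- move=> x y Bx By /existsNP[i /negP far]; apply: (@increment_far x y i) => //.
  by move: far; rewrite -ler_distl -ltNge => /ltW.
- exact: eta0.
have c0' v : 0 <= v -> 0 <= (1 + smoothed_variance v) / 2.
  move=> v0; apply: (le_trans _ (smoothed_derivative_norm 0 v0).2).
  by apply: Rintegral_ge0 => w _; exact: normr_ge0.
have [E3 [mE3 PE3 H3]] := integrable_paths mg gM A0 g_out (measurable_smoothed_derivative ug0) (c0' _ ug0) e0 (fun x => smoothed_derivative_norm x ug0).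
have [E4 [mE4 PE4 H4]] := integrable_paths mg gM A0 g_out (measurable_smoothed_derivative ug0') (c0' _ ug0') e0 (fun x => smoothed_derivative_norm x ug0').
exists (E1 `|` E2 `|` E3 `|` E4); split; first by do 3 apply: measurableU => //.
  have m12 : measurable (E1 `|` E2) by exact: measurableU.
  have m123 : measurable (E1 `|` E2 `|` E3) by exact: measurableU.
  rewrite (le_trans (measureU2 P m123 mE4))// [X in (_ <= X)%E]EFinD leeD//.
  rewrite (le_trans (measureU2 P m12 mE3))// [X in (_ <= X)%E]EFinD leeD//.
  by rewrite (le_trans (measureU2 P mE1 mE2))// [X in (_ <= X)%E]EFinD leeD.
move=> w /not_orP[/not_orP[/not_orP[/H1 h1 /H2[_ h2]] /H3 h3] /H4 h4].
rewrite -(RintegralB measurableT h4 h3); apply: le_trans h2; rewrite le_eqVlt; apply/orP; left; apply/eqP.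
by congr `|_|; apply: eq_Rintegral => x _; exact: incrementE.
Qed.

Lemma change_of_scale eta e : 0 < eta -> 0 < e ->
  close_fields P g eta ((2 * A + 1) ^+ d * (2 * Num.sqrt u / (gm * u)) * expR (gm * K) +
    M ^+ 2 * (128 / gm ^+ 2) * (2 * (r0 + 4)) ^+ d * (2 * A) ^+ d / eta ^+ 2 *
      expR (4 * d%:R * bb + 24 * d%:R ^+ 2 * L - gm / 2 * K) + e + e)
    (smoothed_derivative u') (smoothed_derivative u).
Proof.
move=> eta0 e0; have := change_of_scale_close eta0 e0.
suff -> : M ^+ 2 * bound * (2 * rho) ^+ d * b / eta ^+ 2 =
  M ^+ 2 * (128 / gm ^+ 2) * (2 * (r0 + 4)) ^+ d * (2 * A) ^+ d / eta ^+ 2 *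
      expR (4 * d%:R * bb + 24 * d%:R ^+ 2 * L - gm / 2 * K) by [].
rewrite /bound /rho /b mulrA [in LHS]exprMn -expRM_natl.
set X := expR (_ - _); set Y := expR (_ * _); set Z := expR (_ - _).
have -> : Z = X * Y.
  by rewrite /X /Y /Z -expRD; congr expR; rewrite sqr_sqrt2d /C3; field.
by field; rewrite (gt_eqF sqrt2d_gt0) (gt_eqF eta0).
Qed.

End change_of_scale.

Lemma ae_eq_Rintegral (R : realType) d (T : measurableType d) (m : {measure set T -> \bar R}) (f f' : T -> R) :
  measurable_fun setT f -> measurable_fun setT f' -> {ae m, forall w, f w = f' w} ->
  \int[m]_w f w = \int[m]_w f' w.
Proof.
move=> mf mf' ff'; congr fine; apply: ae_eq_integral => //; [exact: measurable_fun_EFin|exact: measurable_fun_EFin|].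
by apply: filterS ff' => w /= -> _.
Qed.

Lemma ae_eq_integrable (R : realType) d (T : measurableType d) (m : {measure set T -> \bar R}) (f f' : T -> R) :
  measurable_fun setT f -> {ae m, forall w, f w = f' w} ->
  m.-integrable setT (EFin \o f') -> m.-integrable setT (EFin \o f).
Proof.
move=> mf ff' /integrableP[mf' if']; apply/integrableP; split; first exact: measurable_fun_EFin.
rewrite (ae_eq_integral (EFin \o (fun w => `|f' w|)))//.
- by apply: measurable_fun_EFin; exact: (measurableT_comp (@normr_measurable R setT) mf).
- by apply: measurable_fun_EFin; apply: (measurableT_comp (@normr_measurable R setT)); exact/measurable_EFinP.
- by apply: filterS ff' => w /= -> _.
Qed.

Lemma close_fields_chain (R : realType) (d : nat) dT (T : measurableType dT) (P : probability T R)
    (g : 'rV[R]_d -> R) (eta e : R) (F : nat -> 'rV[R]_d -> T -> R) n :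
  (forall i, (i < n)%N -> close_fields P g eta e (F i) (F i.+1)) ->
  close_fields P g (n%:R * eta) (n%:R * e) (F 0) (F n).
Proof.
elim: n => [_|n IH H].
  exists set0; split; [exact: measurable0|by rewrite measure0 mul0r|].
  by move=> w _; rewrite subrr normr0 mul0r.
rewrite -natr1 ![(_ + 1) * _]mulrDl !mul1r; apply: close_fields_trans (H n (ltnSn n)).
by apply: IH => i ni; apply: H; exact: ltnW.
Qed.

Lemma close_fieldsW (R : realType) (d : nat) dT (T : measurableType dT) (P : probability T R)
    (g : 'rV[R]_d -> R) (eta e e' : R) (F F' : 'rV[R]_d -> T -> R) : e <= e' ->
  close_fields P g eta e F F' -> close_fields P g eta e' F F'.
Proof. by move=> ee' [E [mE PE H]]; exists E; split => //; rewrite (le_trans PE)// lee_fin. Qed.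

Lemma near_pinfty_ge (R : realType) (a : R) : \forall l \near +oo, a <= l.
Proof. by apply: nbhs_pinfty_ge; exact: num_real. Qed.

Section close_gaussian.
Context (R : realType) (d : nat) (dT : measure_display) (T : measurableType dT) (P : probability T R).
Local Notation Rd := 'rV[R]_d.
Variable G : set (T -> R).
Hypothesis GG : gaussian_space P G.
Variables (gam : R) (g : Rd -> R) (M A : R).
Hypotheses (gam0 : 0 < gam) (mg : measurable_fun setT g) (gM : forall x, `|g x| <= M) (A0 : 0 < A).
Hypothesis g_out : forall x, ~ box A x -> g x = 0.

Let M0 : 0 <= M. Proof. exact: le_trans (gM 0). Qed.

Lemma close_gaussian_fields (C Q eta e : R) : 0 <= C -> 0 < Q -> 0 < eta -> 0 < e ->
  \forall l \near +oo, forall F F' Y W : Rd -> T -> R, random_field F -> random_field F' ->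
  (forall x, [/\ G (Y x), G (W x), ip P (Y x) (Y x) <= expR l + C,
    ip P (fun w => Y x w + W x w) (fun w => Y x w + W x w) <= expR l + C &
    ip P (W x) (W x) <= (Q * expR (- (3 * l))) ^+ 2]) ->
  (forall x, {ae P, forall w, F x w = dens gam (ip P (Y x) (Y x)) (Y x w)}) ->
  (forall x, {ae P, forall w, F' x w =
    dens gam (ip P (fun w => Y x w + W x w) (fun w => Y x w + W x w)) (Y x w + W x w)}) ->
  close_fields P g eta e F F'.
Proof.
move=> C0 Q0 eta0 e0; near=> l => F F' Y W mF mF' YW FY FW.
pose n := (C + 1) * expR l; pose t := Q * expR (- (3 * l)).
have l0 : 0 <= l by near: l; exact: near_pinfty_ge.
have el : 1 <= expR l by rewrite -expR0 ler_expR.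
have n1 : 1 <= n by rewrite /n; nra.
have nC : expR l + C <= n by rewrite /n; nra.
have t0 : 0 < t by rewrite mulr_gt0// expR_gt0.
have e1 : expR l * expR (- (3 * l)) = expR (- (2 * l)) by rewrite -expRD; congr expR; ring.
have e2 : expR l * expR (- (2 * l)) = expR (- (1 * l)) by rewrite -expRD; congr expR; ring.
have nt : 2 * (gam + 1) * n * t <= 1.
  have -> : 2 * (gam + 1) * n * t = 2 * (gam + 1) * (C + 1) * Q * expR (- (2 * l)) by rewrite -e1 /n /t; ring.
  by near: l; exact: near_expR_small.
have small : 3 * (M * (12 * (gam + 1) ^+ 2 * n ^+ 2 * t) * (2 * A) ^+ d) <= eta * e.
  have -> : 3 * (M * (12 * (gam + 1) ^+ 2 * n ^+ 2 * t) * (2 * A) ^+ d) =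
      3 * M * 12 * (gam + 1) ^+ 2 * (C + 1) ^+ 2 * Q * (2 * A) ^+ d * expR (- (1 * l)).
    by rewrite -e2 -e1 /n /t; ring.
  by near: l; apply: near_expR_small => //; exact: mulr_gt0.
pose X (Z : Rd -> T -> R) (x : Rd) w := dens gam (ip P (Z x) (Z x)) (Z x w).
pose Y' x w := Y x w + W x w.
have GY x : G (Y x) by have [] := YW x.
have GW x : G (W x) by have [] := YW x.
have GY' x : G (Y' x) by apply: (gsD GG).
have Yn x : ip P (Y x) (Y x) <= n by have [_ _ h _ _] := YW x; exact: le_trans nC.
have Yn' x : ip P (Y' x) (Y' x) <= n by have [_ _ _ h _] := YW x; exact: le_trans nC.
have Wt x : ip P (W x) (W x) <= t ^+ 2 by have [] := YW x.
have iX Z x : G (Z x) -> P.-integrable setT (EFin \o X Z x) by move=> GZ; exact: (dens_integrable GG).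
have mX Z x : G (Z x) -> measurable_fun setT (X Z x) by move=> /iX /integrableP[/measurable_EFinP].
have nX Z x : G (Z x) -> ip P (Z x) (Z x) <= n -> \int[P]_w `|X Z x w| <= (1 + n) / 2.
  by move=> GZ zn; apply: (le_trans (dens_norm GG gam0 GZ)); lra.
have ma (f : T -> R) : measurable_fun setT f -> measurable_fun setT (fun w => `|f w|).
  by move=> mf; exact: (measurableT_comp (@normr_measurable R setT) mf).
have bd (F0 : Rd -> T -> R) Z x : random_field F0 -> {ae P, forall w, F0 x w = X Z x w} -> G (Z x) ->
    ip P (Z x) (Z x) <= n -> P.-integrable setT (EFin \o F0 x) /\ \int[P]_w `|F0 x w| <= (1 + n) / 2.
  move=> mF0 FZ GZ zn; have m0 := random_field_at x mF0; split.
    by apply: (ae_eq_integrable _ FZ) => //; exact: iX.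
  rewrite (@ae_eq_Rintegral _ _ _ _ _ (fun w => `|X Z x w|)); [exact: nX|exact: ma|apply: ma; exact: mX|].
  by apply: filterS FZ => w ->.
apply: (close_fields_L1 mg gM A0 g_out mF mF' _ _ eta0 e0 (fun x => bd F Y x mF (FY x) (GY x) (Yn x))
  (fun x => bd F' Y' x mF' (FW x) (GY' x) (Yn' x)) _ small).
- by apply: divr_ge0 => //; lra.
- by rewrite mulr_ge0 ?(ltW t0)// mulr_ge0 ?sqr_ge0// mulr_ge0 ?sqr_ge0.
move=> x; rewrite (@ae_eq_Rintegral _ _ _ _ _ (fun w => `|X Y' x w - X Y x w|)).
- exact: (dens_L1 GG gam0 (GY x) (GW x) n1 t0 nt (Yn x) (Yn' x) (Wt x)).
- by apply: ma; apply: measurable_funB; exact: random_field_at.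
- by apply: ma; apply: measurable_funB; exact: mX.
- by apply: filterS2 (FY x) (FW x) => w -> ->; rewrite distrC.
Unshelve. all: by end_near. Qed.

End close_gaussian.

(* With slope 1 / (64 d) the variance excess contributes l / 16, half of the gain
   gm / 2 * (l / (4 * gm)) = l / 8 from the barrier. *)
Lemma near_barrier_bound (R : realType) (d : nat) (A C D E e : R) : (0 < d)%N -> 0 < A -> 0 < e ->
  let gm := sqrt2d d : R in
  \forall l \near +oo, forall u : R, expR l / 4 <= u ->
  [/\ 0 < u, l / (4 * gm) <= gm * u / 2 &
    (2 * A + 1) ^+ d * (2 * Num.sqrt u / (gm * u)) * expR (gm * (l / (4 * gm))) +
    D * expR (4 * d%:R * (l / (64 * d%:R) + C) + E - gm / 2 * (l / (4 * gm))) + e / 4 + e / 4 <= e].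
Proof.
move=> d0 A0 e0 gm; have gm0 : 0 < gm by exact: sqrt2d_gt0.
have e4 : 0 < e / 4 by rewrite divr_gt0.
have dR : 0 < d%:R :> R by rewrite ltr0n.
near=> l => u lu.
have l1 : 1 * l <= gm ^+ 2 / 2 * expR l.
  by near: l; apply: near_linear_expR; rewrite divr_gt0// exprn_gt0.
have l2 : (2 * A + 1) ^+ d * (4 / gm) * expR (- (4^-1 * l)) <= e / 4.
  by near: l; apply: near_expR_small => //; rewrite invr_gt0.
have l3 : D * expR (4 * d%:R * C + E) * expR (- (16^-1 * l)) <= e / 4.
  by near: l; apply: near_expR_small => //; rewrite invr_gt0.
have u0 : 0 < u by apply: lt_le_trans lu; rewrite divr_gt0// expR_gt0.
split => //.
  rewrite ler_pdivrMr ?mulr_gt0//.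
  have : gm ^+ 2 * (expR l / 4) <= gm ^+ 2 * u by rewrite ler_wpM2l ?sqr_ge0.
  by move: l1; rewrite !expr2; lra.
have -> : gm * (l / (4 * gm)) = l / 4 by field; rewrite gt_eqF.
have -> : 4 * d%:R * (l / (64 * d%:R) + C) + E - gm / 2 * (l / (4 * gm)) =
    4 * d%:R * C + E + (- (16^-1 * l)) by field; rewrite !gt_eqF.
rewrite (expRD (_ + E)) mulrA.
suff : (2 * A + 1) ^+ d * (2 * Num.sqrt u / (gm * u)) * expR (l / 4) <= e / 4 by move: l3; lra.
apply: le_trans l2; rewrite -!mulrA ler_wpM2l ?exprn_ge0//; first by have := A0; lra.
have hz : expR (l / 2) / 2 <= Num.sqrt u.
  rewrite -(@ler_pXn2r _ 2) ?nnegrE ?sqrtr_ge0 ?divr_ge0 ?expR_ge0// sqr_sqrtr ?(ltW u0)//.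
  rewrite exprMn expr2 -expRD -splitr; apply: le_trans lu.
  by rewrite exprVn; have := expR_gt0 l; lra.
have z0 : 0 < Num.sqrt u by rewrite sqrtr_gt0.
have -> : expR (- (4^-1 * l)) = expR (- (l / 2)) * expR (l / 4) by rewrite -expRD; congr expR; field.
rewrite !mulrA ler_pM2r ?expR_gt0//.
have -> : 2 * Num.sqrt u * (gm * u)^-1 = 2 / gm / Num.sqrt u.
  by rewrite -{2}[u]sqr_sqrtr ?(ltW u0)//; field; rewrite !gt_eqF.
rewrite ler_pdivrMr// expRN.
have -> : 4 * gm^-1 * (expR (l / 2))^-1 * Num.sqrt u = 2 / gm * (Num.sqrt u / (expR (l / 2) / 2)).
  by field; rewrite !gt_eqF// expR_gt0.
rewrite ler_peMr//; first by rewrite divr_ge0 ?(ltW gm0).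
by rewrite ler_pdivlMr ?mul1r// divr_gt0 ?expR_gt0.
Unshelve. all: by end_near. Qed.

Section approximation.
Context (R : realType) (d : nat) (dT : measure_display) (T : measurableType dT) (P : probability T R).
Local Notation Rd := 'rV[R]_d.

Let scale_ge0 (t l x : R) : 0 <= l -> 8 * l <= 1 * t -> x <= 6 * l -> 0 <= t - x.
Proof. by lra. Qed.

Let scale_quarter (t l x : R) : 0 <= l -> 8 * l <= 1 * t -> x <= 6 * l -> t / 4 <= t - x.
Proof. by lra. Qed.

Let variance_bound_weaken (v u a x C : R) : 0 <= a -> x <= C -> v <= u + x -> v <= u + (a + C).
Proof. by lra. Qed.

Let variance_bound_step (v u u' a x C : R) : u + a = u' -> x <= C -> v <= u' + x -> v <= u + (a + C).
Proof. by lra. Qed.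

Let variance_bound_close (v z t D D' x y L : R) : `|v - z| <= D + 2 * y -> z <= t + x -> D <= D' ->
  y <= L -> v <= t + (x + D' + 2 * L).
Proof. by rewrite ler_distl => /andP[_]; lra. Qed.

Let quadratic_bound (x L y : R) : 0 <= x -> 0 <= L -> 0 <= y -> x <= L -> x * y <= (L + 1) ^+ 2 * y.
Proof. by move=> x0 L0 y0 xL; apply: ler_wpM2r => //; rewrite expr2; nra. Qed.

Variables (k : R -> R) (L B r0 : R) (h : {charge set Rd -> \bar R} -> {RV P >-> R})
  (ht : R -> Rd -> {RV P >-> R}).
Hypotheses (kb : seed_bounds k L B r0) (sf : star_scale_field k h) (cf : cutoff_field k h ht)
  (d_gt0 : (0 < d)%N).
Variables (g : Rd -> R) (M A : R).
Hypotheses (mg : measurable_fun setT g) (gM : forall x, `|g x| <= M) (A0 : 0 < A).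
Hypothesis g_out : forall x, ~ box A x -> g x = 0.

Let GG := field_space_gaussian cf.
Local Notation G := (field_space k h ht).
Local Notation gm := (sqrt2d d : R).

Let L0 : 0 <= L. Proof. by case: kb => -[]. Qed.
Let B0 : 0 < B. Proof. by case: kb => -[]. Qed.
Let r00 : 0 < r0. Proof. by case: kb => -[]. Qed.
Let gm0 : 0 < gm. Proof. exact: sqrt2d_gt0. Qed.
Let dR : 0 < d%:R :> R. Proof. by rewrite ltr0n. Qed.

Definition weighted_points (J : finType) (p : J -> Rd) (c : J -> R) :=
  [/\ forall j, 0 <= c j, \sum_j c j = 1 & forall j i, `|p j ord0 i| <= 2].

Lemma near_change_of_scale C eta e : 0 <= C -> 0 < eta -> 0 < e ->
  \forall l \near +oo, forall (J : finType) (p : J -> Rd) (c : J -> R), weighted_points p c ->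
  forall u u', expR l / 4 <= u -> u <= u' -> u <= expR l ->
  smoothed_variance ht (expR l) p c u <= u + (l / (64 * d%:R) + C) ->
  smoothed_variance ht (expR l) p c u' <= u + (l / (64 * d%:R) + C) ->
  close_fields P g eta e (smoothed_derivative ht (expR l) p c u') (smoothed_derivative ht (expR l) p c u).
Proof.
move=> C0 eta0 e0; have e4 : 0 < e / 4 by rewrite divr_gt0.
near=> l => J p c [c0 c1 p2] u u' lu uu' ut vu vu'.
have l0 : 0 <= l by near: l; exact: near_pinfty_ge.
have [u0 Ku small] : [/\ 0 < u, l / (4 * gm) <= gm * u / 2 &
    (2 * A + 1) ^+ d * (2 * Num.sqrt u / (gm * u)) * expR (gm * (l / (4 * gm))) +
    M ^+ 2 * (128 / gm ^+ 2) * (2 * (r0 + 4)) ^+ d * (2 * A) ^+ d / eta ^+ 2 *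
    expR (4 * d%:R * (l / (64 * d%:R) + C) + 24 * d%:R ^+ 2 * L - gm / 2 * (l / (4 * gm))) + e / 4 + e / 4 <= e].
  by move: u lu {uu' ut vu vu'}; near: l; exact: near_barrier_bound.
apply: close_fieldsW small _.
apply: (change_of_scale kb cf d_gt0 c0 c1 p2 mg gM A0 g_out u0 uu' ut _ _ vu vu' Ku eta0 e4).
- by rewrite divr_ge0// mulr_ge0// ltW.
- by rewrite addr_ge0// divr_ge0// mulr_ge0.
Unshelve. all: by end_near. Qed.

Lemma smoothed_variance_le t (J : finType) (p : J -> Rd) (c : J -> R) u : weighted_points p c ->
  0 <= u -> u <= t -> smoothed_variance ht t p c u <= u + 4 * d%:R * L.
Proof.
move=> [c0 c1 p2] u0 ut.
have := ip_smoothed_close kb cf t c0 c1 p2 0 u0; rewrite ler_distl => /andP[_ h1].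
apply: (le_trans h1); rewrite lerD2l.
have : expR u * expR (- t) <= 1 by rewrite -expRD -expR0 ler_expR subr_le0.
have Ld : 0 <= 4 * d%:R * L by rewrite !mulr_ge0.
by move=> /(ler_wpM2l Ld); lra.
Qed.

(* 384 d steps of length l / (64 d) cover the distance 6 l. *)
Lemma near_smoothed_chain C eta e : 4 * d%:R * L <= C -> 0 < eta -> 0 < e ->
  \forall l \near +oo, forall (J : finType) (p : J -> Rd) (c : J -> R), weighted_points p c ->
  smoothed_variance ht (expR l) p c (expR l + 6 * l) <= expR l + C ->
  close_fields P g eta e (smoothed_derivative ht (expR l) p c (expR l + 6 * l))
    (smoothed_derivative ht (expR l) p c (expR l - 6 * l)).
Proof.
move=> LC eta0 e0; have [n nE] : exists n, n = (384 * d)%N by exists (384 * d)%N.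
have n_gt0 : (0 < n)%N by rewrite nE muln_gt0.
have n0 : 0 < n%:R :> R by rewrite ltr0n.
have C0 : 0 <= C by apply: le_trans LC; rewrite !mulr_ge0.
have etan : 0 < eta / n%:R by rewrite divr_gt0.
have en : 0 < e / n%:R by rewrite divr_gt0.
near=> l => J p c pts.
have l0 : 0 <= l by near: l; exact: near_pinfty_ge.
have lt : 8 * l <= 1 * expR l by near: l; exact: near_linear_expR.
set t := expR l in lt * => vU.
pose a := l / (64 * d%:R).
have a0 : 0 <= a by rewrite divr_ge0// mulr_ge0.
have na : n%:R * a = 6 * l by rewrite nE /a natrM; field; rewrite gt_eqF.
pose sc i := if i is 0 then t + 6 * l else t - i%:R * a.
have step : forall u u', t / 4 <= u -> u <= u' -> u <= t ->
    smoothed_variance ht t p c u <= u + (a + C) -> smoothed_variance ht t p c u' <= u + (a + C) ->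
    close_fields P g (eta / n%:R) (e / n%:R) (smoothed_derivative ht t p c u') (smoothed_derivative ht t p c u).
  move=> u u'; rewrite /t /a; move: J p c pts {vU} u u'; near: l.
  exact: near_change_of_scale.
have sE i : (0 < i)%N -> sc i = t - i%:R * a by case: i.
have sn : t - 6 * l = sc n by rewrite sE ?na.
have ia i : (i <= n)%N -> i%:R * a <= 6 * l by move=> ni; rewrite -na ler_wpM2r// ler_nat.
have -> : eta = n%:R * (eta / n%:R) by rewrite mulrC divfK// gt_eqF.
have -> : e = n%:R * (e / n%:R) by rewrite mulrC divfK// gt_eqF.
rewrite sn (_ : t + 6 * l = sc 0)//.
apply: (close_fields_chain (F := fun i => smoothed_derivative ht t p c (sc i))) => i ni.
have h1 := ia _ ni; have h0 := ia _ (ltnW ni).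
have i1 : 0 <= i.+1%:R * a by rewrite mulr_ge0.
have i0 : 0 <= i%:R * a by rewrite mulr_ge0.
have s1 : sc i.+1 + a = t - i%:R * a by rewrite sE// -natr1; ring.
have vle j : 0 <= j%:R * a -> j%:R * a <= 6 * l ->
    smoothed_variance ht t p c (t - j%:R * a) <= t - j%:R * a + 4 * d%:R * L.
  move=> j0 j6; apply: smoothed_variance_le pts _ _; first exact: scale_ge0 j6.
  by rewrite lerBlDr lerDl.
apply: step.
- by rewrite sE//; exact: scale_quarter h1.
- case: i {ni h1 h0 i1 i0} s1 => [|i] s1; last by rewrite [sc i.+1]sE// -s1 lerDl.
  by rewrite (@le_trans _ _ t)// ?lerDl ?mulr_ge0// sE// lerBlDr lerDl mulr_ge0.
- by rewrite sE// lerBlDr lerDl.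
- by apply: variance_bound_weaken a0 LC _; rewrite sE//; exact: vle.
case: i {ni h1 i1} s1 h0 i0 => [|i] s1 h0 i0.
  by rewrite addrA s1 mul0r subr0.
by apply: variance_bound_step s1 LC _; rewrite [sc i.+1]sE//; exact: vle.
Unshelve. all: by end_near. Qed.

Definition mollified_version theta t (F : Rd -> T -> R) := forall x,
  {ae P, forall w, F x w = dens gm (ip P (mollified h t theta x) (mollified h t theta x)) (mollified h t theta x w)}.

Definition cutoff_derivative u (x : Rd) (w : T) := dens gm u (cutoff ht u x w).

Lemma cutoff_variance u x : 0 <= u -> ip P (cutoff ht u x) (cutoff ht u x) = u.
Proof. by move=> u0; rewrite (ip_cutoff cf)// minxx subrr enorm0 (cut0 kb (expR_ge1 u0)) expRK. Qed.

Definition gaussian_closeness C Q eta e l := forall F F' Y W : Rd -> T -> R, random_field F -> random_field F' ->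
  (forall x, [/\ G (Y x), G (W x), ip P (Y x) (Y x) <= expR l + C,
    ip P (fun w => Y x w + W x w) (fun w => Y x w + W x w) <= expR l + C &
    ip P (W x) (W x) <= (Q * expR (- (3 * l))) ^+ 2]) ->
  (forall x, {ae P, forall w, F x w = dens gm (ip P (Y x) (Y x)) (Y x w)}) ->
  (forall x, {ae P, forall w, F' x w =
    dens gm (ip P (fun w => Y x w + W x w) (fun w => Y x w + W x w)) (Y x w + W x w)}) ->
  close_fields P g eta e F F'.

Let add_sub (X Y : T -> R) : (fun w => X w + (Y w - X w)) = Y.
Proof. by apply/funext => w; rewrite addrC subrK. Qed.

Let sqr_expR3 (l : R) : expR (- (3 * l)) ^+ 2 = expR (- (6 * l)).
Proof. by rewrite expr2 -expRD; congr expR; ring. Qed.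

Let scale_ratio (a b c : R) : a - b = c -> expR a * expR (- b) = expR c.
Proof. by move=> <-; rewrite -expRD. Qed.

Let dL0 : 0 <= d%:R * L. Proof. exact: mulr_ge0. Qed.

Section fixed_scale.
Variables (l : R) (J : finType) (p : J -> Rd) (c : J -> R).
Hypotheses (l0 : 0 <= l) (lt : 8 * l <= 1 * expR l) (pts : weighted_points p c).
Let t := expR l.

Let t0 : 0 <= t. Proof. exact: expR_ge0. Qed.

Let U0 : 0 <= t + 6 * l. Proof. by rewrite addr_ge0// mulr_ge0. Qed.

Let m0 : 0 <= t - 6 * l. Proof. exact: scale_ge0 (lexx _). Qed.

Let mt : t - 6 * l <= t. Proof. by rewrite lerBlDr lerDl mulr_ge0. Qed.

Let small_scale (a : R) : 0 <= a -> expR (- (a * l)) <= 1.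
Proof. by move=> a0; rewrite -[leRHS]expR0 ler_expR oppr_le0 mulr_ge0. Qed.

Let ratio_t : expR t * expR (- t) = 1. Proof. by rewrite (scale_ratio (subrr t)) expR0. Qed.

Let ratio_U : expR (t + 6 * l) * expR (- t) = expR (6 * l).
Proof. by apply: scale_ratio; ring. Qed.

Let ratio_m : expR (t - 6 * l) * expR (- t) = expR (- (6 * l)).
Proof. by apply: scale_ratio; ring. Qed.

Let ratio_mesh : expR (6 * l) * expR (- (12 * l)) = expR (- (6 * l)).
Proof. by apply: scale_ratio; ring. Qed.

Lemma smoothed_close_cutoff C eta e : 4 * d%:R * L <= C -> gaussian_closeness C (8 * d%:R * L + 1) eta e l ->
  close_fields P g eta e (smoothed_derivative ht t p c (t - 6 * l)) (cutoff_derivative (t - 6 * l)).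
Proof.
move=> LC key; have [c0 c1 p2] := pts; have C0 : 0 <= C by apply: le_trans LC; rewrite !mulr_ge0.
apply: (key _ _ (smoothed ht t p c (t - 6 * l)) (fun x w => cutoff ht (t - 6 * l) x w - smoothed ht t p c (t - 6 * l) x w)).
- exact: (measurable_smoothed_derivative cf).
- by apply: (measurableT_comp (measurable_dens _ _)); exact: (measurable_cutoff cf).
- move=> x; have G1 := cutoff_G k h ht x m0; have G2 := smoothed_G cf t p c x m0.
  rewrite add_sub; split; [exact: G2|exact: (gsB GG)| | |].
  + rewrite (smoothed_varianceE cf _ _ _ x m0) (le_trans (smoothed_variance_le pts m0 mt))//.
    exact: lerD.
  + by rewrite cutoff_variance// (le_trans mt)// lerDl.
  + apply: (le_trans (smoothed_sub_cutoff kb cf t c0 c1 p2 x m0)).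
    rewrite -[L * _ * _]mulrA [expR (t - _) * _]mulrA ratio_m exprMn sqr_expR3.
    rewrite [expR _ * _]mulrC [L * _]mulrA [L * _]mulrC.
    by apply: quadratic_bound => //; rewrite ?expR_ge0// !mulr_ge0.
- by move=> x; apply: aeW => w; rewrite /smoothed_derivative (smoothed_varianceE cf).
- by move=> x; apply: aeW => w; rewrite /cutoff_derivative add_sub [smoothed _ _ _ _ _ _ _ + _]addrC subrK cutoff_variance.
Qed.

Variables (theta : {finite_measure set Rd -> \bar R}) (S : R).
Hypotheses (At : admissible_mollifier theta) (S0 : 0 <= S).
Hypothesis SP : (\int[theta]_u \int[theta]_v ((enorm (u - v))%:E)^-1 <= S%:E)%E.
Hypothesis pc : forall (phi : Rd -> R) (M m : R), measurable_fun setT phi -> (forall u, `|phi u| <= M) ->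
  (forall u v, enorm (u - v) <= expR (- (12 * l)) -> `|phi u - phi v| <= m) ->
  `|\sum_j c j * phi (p j) - \int[theta]_u phi u| <= m.

Let D := B * r0 * S.

Let D0 : 0 <= D. Proof. by rewrite /D !mulr_ge0// ltW. Qed.

Let C1 := 4 * d%:R * L + D + 2 * L.
Let C2 := C1 + D + 2 * L.

Lemma mollified_variance_le x : ip P (mollified h t theta x) (mollified h t theta x) <= t + C1.
Proof.
have [c0 c1 _] := pts; apply: (variance_bound_close (mollified_close kb sf cf t c0 c1 At SP pc x t0)).
- by rewrite (smoothed_varianceE cf _ _ _ x t0); exact: smoothed_variance_le.
- by rewrite ratio_t divr1.
rewrite -mulrA [expR t * _]mulrA ratio_t mul1r -[X in _ <= X]mulr1; apply: ler_wpM2l => //.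
exact: small_scale.
Qed.

Lemma smoothed_variance_top x : ip P (smoothed ht t p c (t + 6 * l) x) (smoothed ht t p c (t + 6 * l) x) <= t + C2.
Proof.
have [c0 c1 _] := pts; have := mollified_close kb sf cf t c0 c1 At SP pc x U0; rewrite distrC => H.
apply: (variance_bound_close H); first exact: mollified_variance_le.
  rewrite ratio_U mulrAC -/D -expRN -[X in _ <= X]mulr1; apply: ler_wpM2l => //; exact: small_scale.
rewrite -mulrA [expR (t + _) * _]mulrA ratio_U ratio_mesh -[X in _ <= X]mulr1; apply: ler_wpM2l => //.
exact: small_scale.
Qed.

Lemma mollified_close_smoothed F eta e : gaussian_closeness C2 (D + 4 * L + 1) eta e l ->
  random_field F -> mollified_version theta t F ->
  close_fields P g eta e F (smoothed_derivative ht t p c (t + 6 * l)).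
Proof.
move=> key mF FE; have [c0 c1 p2] := pts; have C12 : C1 <= C2 by rewrite /C2 -addrA lerDl addr_ge0// mulr_ge0.
apply: (key _ _ (mollified h t theta) (fun x w => smoothed ht t p c (t + 6 * l) x w - mollified h t theta x w) mF _ _ FE).
- exact: (measurable_smoothed_derivative cf).
- move=> x; have G1 := mollified_G h ht kb t At x; have G2 := smoothed_G cf t p c x U0.
  rewrite add_sub; split; [exact: G1|exact: (gsB GG)| |exact: smoothed_variance_top|].
    by rewrite (le_trans (mollified_variance_le x))// lerD2l.
  apply: (le_trans (mollified_sub_smoothed kb sf cf t c0 c1 At SP pc x U0)).
  rewrite ratio_U exprMn sqr_expR3 -[L * _ * _]mulrA [expR (t + _) * _]mulrA ratio_U ratio_mesh.
  rewrite mulrAC -/D -expRN mulrA -mulrDl.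
  by apply: quadratic_bound => //; rewrite ?expR_ge0// addr_ge0// mulr_ge0.
- move=> x; apply: aeW => w; rewrite /smoothed_derivative -(smoothed_varianceE cf _ _ _ x U0).
  by rewrite add_sub [mollified _ _ _ _ _ + _]addrC subrK.
Qed.

End fixed_scale.

Lemma near_mollified_cutoff theta eta e : admissible_mollifier theta -> 0 < eta -> 0 < e ->
  \forall l \near +oo, forall F, random_field F -> mollified_version theta (expR l) F ->
  close_fields P g eta e F (cutoff_derivative (expR l - 6 * l)).
Proof.
move=> At eta0 e0; have [S S0 SP] := mollifier_energy At.
have D0 : 0 <= B * r0 * S by rewrite !mulr_ge0// ltW.
pose C2 := 4 * d%:R * L + B * r0 * S + 2 * L + B * r0 * S + 2 * L.
have C20 : 0 <= C2 by rewrite /C2 !addr_ge0// !mulr_ge0.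
have LC : 4 * d%:R * L <= C2 by rewrite /C2 -!addrA lerDl !addr_ge0// !mulr_ge0.
have Q1 : 0 < B * r0 * S + 4 * L + 1 by rewrite ltr_wpDl// addr_ge0// mulr_ge0.
have Q2 : 0 < 8 * d%:R * L + 1 by rewrite ltr_wpDl// !mulr_ge0.
have [eta3 e3] : 0 < eta / 3 /\ 0 < e / 3 by rewrite !divr_gt0.
near=> l => F mF FE.
have l0 : 0 <= l by near: l; exact: near_pinfty_ge.
have lt : 8 * l <= 1 * expR l by near: l; exact: near_linear_expR.
have key1 : gaussian_closeness C2 (B * r0 * S + 4 * L + 1) (eta / 3) (e / 3) l.
  by near: l; exact: (close_gaussian_fields GG gm0 mg gM A0 g_out).
have key2 : gaussian_closeness C2 (8 * d%:R * L + 1) (eta / 3) (e / 3) l.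
  by near: l; exact: (close_gaussian_fields GG gm0 mg gM A0 g_out).
have [J [p [c [c0 c1 p2 pc]]]] := discretize At (expR_gt0 (- (12 * l))).
have pts : weighted_points p c by split.
have third (x : R) : x = x / 3 + x / 3 + x / 3 by field.
rewrite (third eta) (third e).
have vU := smoothed_variance_top l0 pts At S0 SP pc 0.
apply: (close_fields_trans _ (smoothed_close_cutoff l0 lt pts LC key2)).
apply: (close_fields_trans (mollified_close_smoothed l0 pts At S0 SP pc key1 mF FE)).
move: J p c pts vU {c0 c1 p2 pc}; near: l; exact: near_smoothed_chain.
Unshelve. all: by end_near. Qed.

End approximation.

(** * Convergence in probability *)

Section test_function.
Context (R : realType) (d : nat).
Local Notation Rd := 'rV[R]_d.
Variable g : Rd -> R.
Hypothesis cg : continuous g.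

Lemma continuous_measurable_rV : measurable_fun setT g.
Proof.
have /continuousP cf := cg; apply: (measurability _ (RGenOpens.measurableE R)) => _ [_ [a [b ->]] <-].
by rewrite setTI; apply: open_measurable_mx; apply: cf; exact: interval_open.
Qed.

Hypothesis Kg : compact (closure [set x | g x != 0]).

Lemma continuous_compact_bound (f : Rd -> R) : continuous f ->
  exists M, forall x, g x != 0 -> `|f x| <= M.
Proof.
move=> cf.
have /compact_bounded[M0 [_ H]] : compact (f @` closure [set x | g x != 0]).
  by apply: continuous_compact Kg; exact: continuous_subspaceT.
exists (M0 + 1) => x gx; apply: (H (M0 + 1)); first by rewrite ltrDl.
by exists x => //; exact: subset_closure.
Qed.

Lemma test_function_bounded : exists M, forall x, `|g x| <= M.
Proof.
have [M H] := continuous_compact_bound cg; exists `|M| => x.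
have [->|gx] := eqVneq (g x) 0; first by rewrite normr0.
by rewrite (le_trans (H x gx))// ler_norm.
Qed.

Lemma test_function_box : exists2 A, 0 < A & forall x, ~ box A x -> g x = 0.
Proof.
have H i : exists M, forall x, g x != 0 -> `|x ord0 i| <= M.
  by apply: (continuous_compact_bound (f := fun x : Rd => x ord0 i)); exact: coord_continuous.
have [M {}H] := choice H; exists (1 + \sum_i `|M i|).
  by rewrite ltr_pwDl// sumr_ge0.
move=> x Bx; have [//|gx] := eqVneq (g x) 0; exfalso; apply: Bx => i.
rewrite -ler_norml (le_trans (H i x gx))// (le_trans (ler_norm _))//.
by rewrite (bigD1 i)//= addrCA lerDl addr_ge0// sumr_ge0.
Qed.

End test_function.

Lemma ae_eq_variance (R : realType) dT (T : measurableType dT) (P : probability T R) (X Y : T -> R) :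
  measurable_fun setT X -> measurable_fun setT Y -> {ae P, forall w, X w = Y w} -> 'V_P[X] = 'V_P[Y].
Proof.
move=> mX mY XY; rewrite /variance unlock.
have EXY : expectation P X = expectation P Y.
  by rewrite unlock; apply: ae_eq_integral => //; [exact: measurable_fun_EFin|exact: measurable_fun_EFin|]; apply: filterS XY => w /= ->.
rewrite EXY unlock; apply: ae_eq_integral => //.
- by apply: measurable_fun_EFin; apply: measurable_funM; apply: measurable_funB.
- by apply: measurable_fun_EFin; apply: measurable_funM; apply: measurable_funB.
- by apply: filterS XY => w /= XYw _; rewrite /GRing.mul/= XYw.
Qed.

Section derivative_density.
Context (R : realType) (d : nat) (dT : measure_display) (T : measurableType dT) (P : probability T R).
Local Notation Rd := 'rV[R]_d.
Variables (k : R -> R) (L B r0 : R) (h : {charge set Rd -> \bar R} -> {RV P >-> R})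
  (ht : R -> Rd -> {RV P >-> R}).
Hypotheses (kb : seed_bounds k L B r0) (sf : star_scale_field k h) (cf : cutoff_field k h ht).
Variables (theta : {finite_measure set Rd -> \bar R}) (heps : R -> Rd -> T -> R).
Hypotheses (At : admissible_mollifier theta) (hm : mollification h theta heps).
Local Notation gm := (sqrt2d d : R).

Let GG := field_space_gaussian cf.

Lemma variance_mollification t x :
  fine 'V_P[heps (expR (- t)) x] = ip P (mollified h t theta x) (mollified h t theta x).
Proof.
have [mh /(_ x) ae] := hm (expR_gt0 (- t)).
rewrite (ae_eq_variance (random_field_at x mh) (measurable_funPT _) ae).
by rewrite /variance (covariance_ip GG)//; exact: (mollified_G h ht kb t At x).
Qed.

Lemma mollified_variance0 t x : ip P (mollified h t theta x) (mollified h t theta x) =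
  ip P (mollified h t theta 0) (mollified h t theta 0).
Proof.
by apply: EFin_inj; rewrite !(ip_h_h kb sf cf At _ (expR_gt0 (- t))).
Qed.

Lemma derivative_density_dens t x w :
  derivative_density P heps (expR (- t)) x w =
  dens gm (ip P (mollified h t theta 0) (mollified h t theta 0)) (heps (expR (- t)) x w).
Proof.
rewrite /derivative_density /dens variance_mollification mollified_variance0 sqr_sqrt2d.
by rewrite [2 * _]mulrC mulfK.
Qed.

Lemma measurable_derivative_density t : random_field (derivative_density P heps (expR (- t))).
Proof.
have [mh _] := hm (expR_gt0 (- t)).
rewrite /random_field; under eq_fun do rewrite derivative_density_dens.
exact: (measurableT_comp (measurable_dens _ _) mh).
Qed.

Lemma derivative_density_version t : mollified_version h theta t (derivative_density P heps (expR (- t))).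
Proof.
move=> x; have [_ /(_ x) ae] := hm (expR_gt0 (- t)).
by apply: filterS ae => w hw; rewrite derivative_density_dens hw [in RHS]mollified_variance0.
Qed.

Lemma cutoff_density u : (fun (x : Rd) (w : T) => (- ht (expR (- u)) x w + gm * ln (expR (- u))^-1)
    * expR (gm * ht (expR (- u)) x w) * expR (- u) ^+ d) = cutoff_derivative ht u.
Proof.
apply/funext => x; apply/funext => w; rewrite /cutoff_derivative /dens /cutoff -expRN opprK expRK.
rewrite sqr_sqrt2d [2 * _]mulrC mulfK// expRD -!mulrA; congr (_ * (_ * _)).
by rewrite -mulrN expRM_natl.
Qed.

End derivative_density.

Lemma measurable_Rintegral_kernel (R : realType) d1 d2 (T : measurableType d1) (Y : measurableType d2)
    (nu : R.-ker T ~> Y) (g : Y -> R) : measurable_fun setT g ->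
  measurable_fun setT (fun w => \int[nu w]_x g x).
Proof.
move=> mg; apply: measurableT_comp; first exact: fine_measurable.
have mG : measurable_fun setT (EFin \o g) by exact: measurable_fun_EFin.
rewrite (_ : (fun _ => _) = (fun w => \int[nu w]_x (EFin \o g)^\+ x - \int[nu w]_x (EFin \o g)^\- x)%E); last first.
  by apply/funext => w; exact: integralE.
apply: emeasurable_funB; apply: measurable_fun_integral_kernel => //.
- by move=> U mU; exact: measurable_kernel.
- exact: measurable_funepos.
- by move=> U mU; exact: measurable_kernel.
- exact: measurable_funeneg.
Qed.

Lemma measurable_Rintegral_field (R : realType) (d : nat) dT (T : measurableType dT)
    (g : 'rV[R]_d -> R) (D : 'rV[R]_d -> T -> R) : measurable_fun setT g -> random_field D ->
  measurable_fun setT (fun w => \int[lebesgue_rV d]_x (g x * D x w)).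
Proof.
move=> mg mD; apply: measurableT_comp; first exact: fine_measurable.
apply: (@measurable_integral_snd _ _ _ _ _ (lebesgue_rV d) (fun q => (g q.2 * D q.2 q.1)%:E)).
by apply: measurable_fun_EFin; apply: measurable_funM => //; exact: (measurableT_comp mg).
Qed.

Lemma measurable_deviation (R : realType) dT (T : measurableType dT) (X Y : T -> R) (a : R) :
  measurable_fun setT X -> measurable_fun setT Y -> measurable [set w | a < `|X w - Y w|].
Proof.
move=> mX mY.
have mN : measurable_fun setT (fun w => `|X w - Y w|).
  by apply: (measurableT_comp (@normr_measurable R setT)); exact: measurable_funB.
have := mN measurableT `]a, +oo[%classic (measurable_itv _); rewrite setTI.
by congr (measurable _); apply/seteqP; split => w /=; rewrite in_itv/= andbT.
Qed.

Lemma near_at_right0 (R : realType) (Q : R -> Prop) : (\forall x \near 0^'+, Q x) ->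
  exists2 a : R, 0 < a & forall x, 0 < x -> x < a -> Q x.
Proof.
rewrite /prop_near1 /at_right /within/= => /nbhs_ballP[a /= a0 H].
by exists a => // x x0 xa; apply: H => //; rewrite /ball/= sub0r normrN gtr0_norm.
Qed.

Lemma derivative_density_cvg (R : realType) (d : nat) (dT : measure_display) (T : measurableType dT)
    (P : probability T R) (k : R -> R) (h : {charge set 'rV[R]_d -> \bar R} -> {RV P >-> R})
    (ht : R -> 'rV[R]_d -> {RV P >-> R}) (nu : R.-ker T ~> 'rV[R]_d)
    (theta : {finite_measure set 'rV[R]_d -> \bar R}) (heps : R -> 'rV[R]_d -> T -> R) :
  (0 < d)%N -> star_scale_seed d k -> star_scale_field k h -> cutoff_field k h ht ->
  critical_measure ht nu -> admissible_mollifier theta -> mollification h theta heps ->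
  weak_cvg_in_probability P (derivative_density P heps) nu.
Proof.
move=> d0 /star_scale_seed_bounds[L [B [r0 kb]]] sf cf [_ crit] At hm g cg Kg eta eta0.
have [M gM] := test_function_bounded cg Kg; have [A A0 g_out] := test_function_box Kg.
have mg := continuous_measurable_rV cg.
apply: cvge0_near => [eps|e e0]; first exact: measure_ge0.
have [eta2 e2] : 0 < eta / 2 /\ 0 < e / 2 by rewrite !divr_gt0.
have sm : \forall eps \near 0^'+, (P [set w | (eta / 2 <
    `|\int[lebesgue_rV d]_x (g x * ((- ht eps x w + sqrt2d d * ln (eps^-1)) * expR (sqrt2d d * ht eps x w) * eps ^+ d))
      - \int[nu w]_x g x|)%R] <= (e / 2)%:E)%E.
  by apply: cvge0_small e2; [move=> eps; exact: measure_ge0|exact: crit].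
have [dl /= dl0 small] : exists2 dl : R, 0 < dl & forall eps : R, 0 < eps -> eps < dl -> (P [set w | (eta / 2 <
    `|\int[lebesgue_rV d]_x (g x * ((- ht eps x w + sqrt2d d * ln (eps^-1)) * expR (sqrt2d d * ht eps x w) * eps ^+ d))
      - \int[nu w]_x g x|)%R] <= (e / 2)%:E)%E.
  exact: near_at_right0 sm.
have dl2 : 0 < dl / 2 by rewrite divr_gt0.
have [l0 [_ Hl]] : \forall l \near +oo, (P [set w | (eta <
    `|\int[lebesgue_rV d]_x (g x * derivative_density P heps (expR (- expR l)) x w) - \int[nu w]_x g x|)%R] <= e%:E)%E.
  near=> l.
  have lt : 8 * l <= 1 * expR l by near: l; exact: near_linear_expR.
  have l_ge0 : 0 <= l by near: l; exact: near_pinfty_ge.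
  have u0 : 0 <= expR l - 6 * l by lra.
  have ul : 1 * l <= expR l - 6 * l by lra.
  have ldl : 1 * expR (- (1 * l)) <= dl / 2 by near: l; exact: near_expR_small.
  have [E [mE PE H]] : close_fields P g (eta / 2) (e / 2) (derivative_density P heps (expR (- expR l)))
      (cutoff_derivative ht (expR l - 6 * l)).
    have key : forall F, random_field F -> mollified_version h theta (expR l) F ->
        close_fields P g (eta / 2) (e / 2) F (cutoff_derivative ht (expR l - 6 * l)).
      by near: l; exact: (near_mollified_cutoff kb sf cf d0 mg gM A0 g_out At eta2 e2).
    apply: key; first exact: (measurable_derivative_density kb sf cf At hm).
    exact: (derivative_density_version kb sf cf At hm).
  set u := expR l - 6 * l in u0 ul H.
  have PE2 : (P [set w | (eta / 2 < `|\int[lebesgue_rV d]_x (g x * cutoff_derivative ht u x w) - \int[nu w]_x g x|)%R] <= (e / 2)%:E)%E.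
    rewrite -(cutoff_density ht u); apply: (small _ (expR_gt0 _)); apply: (@le_lt_trans _ _ (dl / 2)); last by rewrite gtr_pMr// invf_lt1// ltr1n.
    by apply: le_trans ldl; rewrite mul1r ler_expR lerN2.
  have mF2 : random_field (cutoff_derivative ht u).
    by apply: (measurableT_comp (measurable_dens _ _)); exact: (measurable_cutoff cf).
  have mnu := measurable_Rintegral_kernel nu mg.
  have m2 := measurable_deviation (eta / 2) (measurable_Rintegral_field mg mF2) mnu.
  have m1 := measurable_deviation eta (measurable_Rintegral_field mg (measurable_derivative_density kb sf cf At hm (expR l))) mnu.
  apply: (@le_trans _ _ (P (E `|` [set w | eta / 2 < `|\int[lebesgue_rV d]_x (g x * cutoff_derivative ht u x w) - \int[nu w]_x g x|]))).
    apply: (le_measure P (mem_set m1) (mem_set (measurableU _ _ mE m2))).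
    move=> w /= big; have [Ew|/H Ew] := pselect (E w); [by left|right].
    rewrite ltNge; apply/negP => Ew2; move: big; apply/negP; rewrite -leNgt (splitr eta).
    rewrite (le_trans (ler_distD (\int[lebesgue_rV d]_x (g x * cutoff_derivative ht u x w)) _ _))//.
    exact: lerD.
  by rewrite (le_trans (measureU2 P mE m2))// (splitr e) EFinD leeD.
near=> eps.
have eps0 : 0 < eps by near: eps; exact: nbhs_right_gt.
have epsl : eps < expR (- expR l0) by near: eps; apply: nbhs_right_lt; exact: expR_gt0.
have ln0 : expR l0 < - ln eps by rewrite ltrNr -[ltRHS]expRK ltr_ln ?posrE ?expR_gt0.
have ln1 : 0 < - ln eps by apply: lt_trans ln0; exact: expR_gt0.
have -> : eps = expR (- expR (ln (- ln eps))) by rewrite lnK ?posrE// opprK lnK.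
by apply: Hl; rewrite -[l0]expRK ltr_ln ?posrE ?expR_gt0.
Unshelve. all: by end_near. Qed.

Theorem theorem1p2 (R : realType) (d : nat)
    (dT : measure_display) (T : measurableType dT) (P : probability T R)
    (k : R -> R)
    (h : {charge set 'rV[R]_d -> \bar R} -> {RV P >-> R})
    (ht : R -> 'rV[R]_d -> {RV P >-> R})
    (mu' : R.-ker T ~> 'rV[R]_d) :
  (0 < d)%N ->
  star_scale_seed d k ->
  star_scale_field k h ->
  cutoff_field k h ht ->
  critical_measure ht mu' ->
  exists nu : R.-ker T ~> 'rV[R]_d,
    [/\ locally_finite P nu,
        forall (theta : {finite_measure set 'rV[R]_d -> \bar R})
               (heps : R -> 'rV[R]_d -> T -> R),
          admissible_mollifier theta ->
          mollification h theta heps ->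
          weak_cvg_in_probability P (derivative_density P heps) nu &
        {ae P, forall w, forall A : set 'rV[R]_d,
          measurable A -> nu w A = mu' w A}].
Proof.
move=> d0 kseed sf cf crit; exists mu'; split.
- by case: crit.
- by move=> theta heps; exact: (derivative_density_cvg d0 kseed sf cf crit).
- exact: aeW.
Qed.
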